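(* For each $n\ge 2$ let $r=r_n\in[0,1/2]$ and let $\mathcal{G}_n=\{G_{ij}\}_{1\le i<j\le n}$ be a centered Gaussian field with $$\mathbb{E}(G_{ij}G_{kl})=\begin{cases}0 & \text{if } |\{i,j\}\cap\{k,l\}|=0,\\ r_n & \text{if } |\{i,j\}\cap\{k,l\}|=1,\\ 1 & \text{if } |\{i,j\}\cap\{k,l\}|=2.\end{cases}$$ Suppose that $(1-2r_n)\log n\to 0$. Then, as $n\to\infty$, $$c_n\left(\max_{1\le i<j\le n}G_{ij}-\sqrt{2}\,d_n\right)\xrightarrow{d}\frac{\eta_1+\eta_2}{\sqrt{2}}.$$
   Context: $c_n:=\sqrt{2\log n}$ and $d_n:=\sqrt{2\log n}-\frac{\log\log n+\log(4\pi)}{2\sqrt{2\log n}}$. Let $\{\zeta_k\}_{k\ge1}$ be i.i.d. standard exponential random variables and $\eta_i:=-\log\left(\sum_{k=1}^i\zeta_k\right)$, $i\ge1$ (so $\eta_1>\eta_2$ are the two largest points of a Poisson point process with intensity $e^{-x}\,dx$). *)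

(* Defs.v *)
From HB Require Import structures.
From mathcomp Require Import all_boot all_order all_algebra.
From mathcomp Require Import all_classical all_reals all_analysis.
Set Implicit Arguments. Unset Strict Implicit. Unset Printing Implicit Defensive.
Import Order.TTheory GRing.Theory Num.Theory.
Import numFieldNormedType.Exports.
Local Open Scope classical_set_scope.
Local Open Scope ring_scope.

Definition c_seq {R : realType} (n : nat) : R := Num.sqrt (2 * ln (n%:R)).

Definition d_seq {R : realType} (n : nat) : R :=
  Num.sqrt (2 * ln (n%:R)) -
  (ln (ln (n%:R)) + ln (4 * pi)) / (2 * Num.sqrt (2 * ln (n%:R))).

Definition gaussianRV {d} {T : measurableType d} {R : realType}
  (P : probability T R) (X : T -> R) : Prop :=
  measurable_fun setT X /\
  ((exists m s : R, s != 0 /\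
      forall A : set R, measurable A -> P (X @^-1` A) = normal_prob m s A)
   \/ (exists m : R, P [set w | X w = m] = 1%E)).

(* The Gaussian field {G_ij}_{i<j} indexed by pairs i < j of 'I_n (0-based
   version of 1 <= i < j <= n); only entries with i < j are used. *)
Definition pair_overlap (n : nat) (i j k l : 'I_n) : nat :=
  #|([set i; j] :&: [set k; l])%SET|.

Definition field_cov {R : realType} (r : R) (n : nat) (i j k l : 'I_n) : R :=
  match pair_overlap i j k l with
  | 0%N => 0
  | 1%N => r
  | _ => 1
  end.

Definition centered_gaussian_field {d} {T : measurableType d} {R : realType}
  (P : probability T R) (n : nat) (r : R) (G : 'I_n -> 'I_n -> T -> R) : Prop :=
  (forall a : 'I_n -> 'I_n -> R,
      gaussianRV P (fun w => \sum_(i < n) \sum_(j < n | (i < j)%N) a i j * G i j w))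
  /\ (forall i j : 'I_n, (i < j)%N -> ('E_P[G i j] = 0)%E)
  /\ (forall i j k l : 'I_n, (i < j)%N -> (k < l)%N ->
        ('E_P[G i j \* G k l] = (field_cov r i j k l)%:E)%E).

Definition field_max {T} {R : realType} (n : nat) (G : 'I_n -> 'I_n -> T -> R)
  (w : T) : R :=
  fine (\big[maxe/-oo%E]_(i < n) \big[maxe/-oo%E]_(j < n | (i < j)%N) (G i j w)%:E).

Definition std_exponential {d} {T : measurableType d} {R : realType}
  (P : probability T R) (X : T -> R) : Prop :=
  measurable_fun setT X /\
  forall A : set R, measurable A -> P (X @^-1` A) = exponential_prob 1 A.

Definition indep2 {d} {T : measurableType d} {R : realType}
  (P : probability T R) (X Y : T -> R) : Prop :=
  forall A B : set R, measurable A -> measurable B ->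
    P (X @^-1` A `&` Y @^-1` B) = (P (X @^-1` A) * P (Y @^-1` B))%E.

(* Main.v *)
(* Since the covariance matrix is explicit, G_ij = p (Y_i + Y_j) + R_ij with Y_1, ..., Y_n i.i.d.
   standard normal linear combinations of the field, R_ij independent of (Y_i, Y_j), and
   Var R_ij = 1 - 2 p^2 <= (1 - 2 r) + 4 / n, which is o(1 / log n).  Put U_i = c (Y_i - d).  The
   maximum of U_i + U_j over pairs is the sum of the two largest U_i, whose joint law is explicit
   and converges to that of (eta_1, eta_2); convergence of the law of the sum follows by cutting
   the plane into thin strips.  It remains to see that R is negligible, although there are n^2
   pairs.  On the event that all U_i <= K, a pair for which R_ij moves U_i + U_j across a level s
   by at least e satisfies 1 <= C exp (- mu e / 4) exp (2 (U_i + U_j)) exp (+- mu sqrt 2 c R_ij),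
   so by independence it has probability at most C' exp (- mu e / 4) E(exp (2 U); U <= K)^2, and
   n E(exp (2 U); U <= K) tends to exp K.  Choosing K and then mu large finishes the proof.
   Independence of jointly Gaussian variables is obtained from their cosine transforms. *)
Require Import Defs.
From HB Require Import structures.
From mathcomp Require Import all_boot all_order all_algebra.
From mathcomp Require Import all_classical all_reals all_analysis.
From mathcomp Require Import measurable_realfun ring lra.
Set Implicit Arguments. Unset Strict Implicit. Unset Printing Implicit Defensive.
Import Order.TTheory GRing.Theory Num.Theory.
Import numFieldNormedType.Exports.
Local Open Scope classical_set_scope.
Local Open Scope ring_scope.

(** * Integration *)

(** The obstacle is that [c * Rv i j] has vanishing variance while its maximum over all pairs need
    not vanish: among n^2 Gaussian variables it may reach the order of sqrt(log n) standard
    deviations. The residual must therefore be weighed against the distance of U_i + U_j from the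
    level: pairs far below it are numerous but need a large residual to cross. An exponential moment
    does this bookkeeping. Since n P(U > u) is about exp(- u), the weight exp(2 U) is integrable at
    minus infinity against exp(- u) du, whereas exp(U) would not be; truncation at K controls the
    other end. For a fixed multiplier mu the factor paid for the residual stays bounded because c^2
    Var R_ij tends to zero.

    The Y_i are taken in the span of the field, so no auxiliary variables are adjoined to the
    probability space. The price is that residuals may be correlated with each other and with the
    other Y_k, which a union bound over pairs tolerates.

    Cosines with an arbitrary phase carry the same information as the characteristic function and
    keep every integral real. *)

Section real_integral.
Context {d : measure_display} {T : measurableType d} {R : realType}.
Variable mu : {measure set T -> \bar R}.
Implicit Types f g : T -> R.

Definition intg f := mu.-integrable [set: T] (EFin \o f).

Lemma intg_measurable f : intg f -> measurable_fun setT f.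
Proof. by move=> /measurable_int/measurable_EFinP. Qed.

Lemma intgD f g : intg f -> intg g -> intg (fun x => f x + g x).
Proof.
by move=> intf intg; have := integrableD measurableT intf intg.
Qed.

Lemma intgZ (k : R) f : intg f -> intg (fun x => k * f x).
Proof. by move=> intf; have := integrableZl measurableT k intf. Qed.

Lemma intgB f g : intg f -> intg g -> intg (fun x => f x - g x).
Proof.
by move=> intf intg; have := integrableB measurableT intf intg.
Qed.

Lemma intg_sum (I : Type) (s : seq I) (P : pred I) (f : I -> T -> R) :
  (forall i, P i -> intg (f i)) -> intg (fun x => \sum_(i <- s | P i) f i x).
Proof.
move=> intf; have := integrable_sum measurableT s intf.
by apply: eq_integrable => // x _ /=; rewrite sumEFin.
Qed.

Lemma le_intg f g : measurable_fun setT f -> intg g ->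
  (forall x, `|f x| <= g x) -> intg f.
Proof.
move=> mf intg0 fg; apply: le_integrable intg0 => //; first exact/measurable_EFinP.
by move=> x _ /=; rewrite lee_fin (le_trans (fg x)) ?ler_norm.
Qed.

Lemma intgMb f g (M : R) : intg f -> measurable_fun setT g ->
  (forall x, `|g x| <= M) -> intg (fun x => f x * g x).
Proof.
move=> intf mg gM; apply: (le_intg (g := fun x => M * `|f x|)).
- by apply: measurable_funM => //; exact: intg_measurable.
- by apply/intgZ/integrable_norm.
- by move=> x; rewrite normrM mulrC ler_wpM2r.
Qed.

Lemma RintD f g : intg f -> intg g ->
  \int[mu]_x (f x + g x) = \int[mu]_x f x + \int[mu]_x g x.
Proof. exact: RintegralD. Qed.

Lemma RintB f g : intg f -> intg g ->
  \int[mu]_x (f x - g x) = \int[mu]_x f x - \int[mu]_x g x.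
Proof. exact: RintegralB. Qed.

Lemma RintZ (k : R) f : intg f -> \int[mu]_x (k * f x) = k * \int[mu]_x f x.
Proof. by move=> intf; rewrite RintegralZl. Qed.

Lemma Rint_sum (I : Type) (s : seq I) (P : pred I) (f : I -> T -> R) :
  (forall i, P i -> intg (f i)) ->
  \int[mu]_x (\sum_(i <- s | P i) f i x) = \sum_(i <- s | P i) \int[mu]_x f i x.
Proof.
move=> intf; elim: s => [|i s IHs].
  under eq_Rintegral do rewrite big_nil.
  by rewrite big_nil /Rintegral integral0.
rewrite big_cons -IHs; case: ifPn => Pi; last first.
  by apply: eq_Rintegral => x _; rewrite big_cons (negbTE Pi).
under eq_Rintegral do rewrite big_cons Pi.
by rewrite RintD//; [exact: intf|exact: intg_sum].
Qed.

Lemma le_Rint f g : intg f -> intg g -> (forall x, f x <= g x) ->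
  \int[mu]_x f x <= \int[mu]_x g x.
Proof. by move=> intf intg0 fg; apply: le_Rintegral. Qed.

Lemma eq_Rint f g : (forall x, f x = g x) -> \int[mu]_x f x = \int[mu]_x g x.
Proof. by move=> fg; apply: eq_Rintegral. Qed.

Lemma Rint_dominated (f_ : nat -> T -> R) f g :
  (forall n, measurable_fun setT (f_ n)) -> measurable_fun setT f -> intg g ->
  (forall x, f_ ^~ x @ \oo --> f x) -> (forall n x, `|f_ n x| <= g x) ->
  (fun n => \int[mu]_x f_ n x) @ \oo --> \int[mu]_x f x.
Proof.
move=> mf_ mf intg0 f_f f_g.
have intf_ n : intg (f_ n) by exact: le_intg (mf_ n) intg0 (f_g n).
have [|||||intf _ +] := @dominated_convergence _ _ _ mu _ measurableT
   (fun n => EFin \o f_ n) (EFin \o f) (EFin \o g).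
- by move=> n; apply/measurable_EFinP.
- by apply/measurable_EFinP.
- by apply: aeW => x _ /=; apply: cvg_EFin; [exact: nearW|exact: f_f].
- exact: intg0.
- by apply: aeW => x n _ /=; rewrite lee_fin.
move=> lim; apply: fine_cvg; rewrite fineK//.
exact: (integrable_fin_num measurableT intf).
Qed.

End real_integral.

(** * Polynomial approximation of a step function *)

Section smooth_step.
Context {R : realType}.
Implicit Types (v w : R) (k : nat).

(* Polynomials in [v] converging boundedly to the indicator of [0 < v] on [-1, 1]; evaluated at a sine they are trigonometric polynomials. *)
Definition smooth_step k v : R :=
  (1 - ((1 - v) / 2) ^+ k) ^+ (k * 2 ^ k).

Lemma smooth_step_poly k : exists p : {poly R}, forall v, smooth_step k v = p.[v].
Proof.
exists ((1 - ((1 - 'X) * (2^-1)%:P) ^+ k) ^+ (k * 2 ^ k)) => v.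
by rewrite /smooth_step !hornerE.
Qed.

Lemma smooth_step_bound k v : `|v| <= 1 -> `|smooth_step k v| <= 1.
Proof.
rewrite ler_norml => /andP[v1 v2]; rewrite /smooth_step normrX.
have w0 : 0 <= (1 - v) / 2 by lra.
have w1 : (1 - v) / 2 <= 1 by lra.
rewrite exprn_ile1// ger0_norm; last by rewrite subr_ge0 exprn_ile1.
by rewrite gerBl exprn_ge0.
Qed.

Lemma bernoulli (y : R) N : 0 <= y <= 1 -> 1 - N%:R * y <= (1 - y) ^+ N.
Proof.
move=> /andP[y0 y1]; elim: N => [|N IH]; first by rewrite mul0r subr0 expr0.
rewrite exprS -natr1.
apply: (@le_trans _ _ ((1 - y) * (1 - N%:R * y))); last by rewrite ler_wpM2l// subr_ge0.
have : 0 <= N%:R * y * y by rewrite !mulr_ge0.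
by nra.
Qed.

(** With [s] the square root of [t], one factor [s ^+ k] absorbs [k], since [k%:R * s ^+ k] is
    bounded by 1 / (1 - s), and the other factor tends to zero. *)
Lemma cvg_natM_geometric (t : R) : 0 <= t < 1 -> (fun k => k%:R * t ^+ k) @ \oo --> 0.
Proof.
move=> /andP[t0 t1].
pose s := Num.sqrt t.
have s0 : 0 <= s by exact: sqrtr_ge0.
have s1 : s < 1 by rewrite -[ltRHS]sqrtr1 ltr_sqrt.
have ts : t = s * s by rewrite -expr2 sqr_sqrtr.
have key k : k%:R * s ^+ k <= (1 - s)^-1.
  rewrite -[leRHS]mul1r ler_pdivlMr ?subr_gt0//.
  (* The bound 1 alone would not pass through the induction; the sharper [1 - s ^+ j] does. *)
  have : forall j, (j%:R * s ^+ j) * (1 - s) <= 1 - s ^+ j.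
    elim=> [|j IH]; first by rewrite mul0r mul0r expr0 subrr.
    rewrite exprS -natr1.
    have sj : 0 <= s ^+ j by exact: exprn_ge0.
    have sj1 : s * s ^+ j <= s ^+ j by rewrite ler_piMl// ltW.
    have : s * ((j%:R * s ^+ j) * (1 - s)) <= s * (1 - s ^+ j) by rewrite ler_wpM2l.
    have : s ^+ j <= 1 by rewrite exprn_ile1// ltW.
    by nra.
  move=> /(_ k) H; apply: le_trans H _; rewrite gerBl; exact: exprn_ge0.
apply: (squeeze_cvgr (f := fun=> 0) (h := fun k => (1 - s)^-1 * s ^+ k)).
- apply: nearW => k; apply/andP; split; first by rewrite mulr_ge0// exprn_ge0.
  rewrite ts exprMn mulrA; apply: ler_wpM2r => //; exact: exprn_ge0.
- exact: cvg_cst.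
- rewrite -[X in _ --> X](mulr0 (1 - s)^-1); apply: cvgM; first exact: cvg_cst.
  by apply: cvg_expr; rewrite ger0_norm.
Qed.

(** With w = (1 - v) / 2, the exponent N = k 2^k gives N w^k = k (2 w)^k. If v > 0 then 2 w < 1,
    this product vanishes, and Bernoulli's inequality gives the limit 1. If v <= 0 then 2 w >= 1,
    the product is at least k, and the value is at most exp(- k). The extra factor k in N is what
    sends the boundary case v = 0 to 0. *)
Lemma cvg_smooth_step v : `|v| <= 1 ->
  (fun k => smooth_step k v) @ \oo --> (if 0 < v then 1 else 0 : R).
Proof.
rewrite ler_norml => /andP[v1 v2].
pose w := (1 - v) / 2; pose y k := w ^+ k.
have w0 : 0 <= w by rewrite /w; lra.
have w1 : w <= 1 by rewrite /w; lra.
have y01 k : 0 <= y k <= 1 by rewrite /y exprn_ge0// exprn_ile1.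
have -> : (fun k => smooth_step k v) = (fun k => (1 - y k) ^+ (k * 2 ^ k)) by [].
have natE k : (k * 2 ^ k)%:R * y k = k%:R * (2 * w) ^+ k :> R.
  by rewrite natrM natrX exprMn mulrA.
case: ltP => v0.
- have t1 : 0 <= 2 * w < 1 by rewrite /w; lra.
  apply: (squeeze_cvgr (f := fun k => 1 - k%:R * (2 * w) ^+ k) (h := fun=> 1)).
  + apply: nearW => k; rewrite -natE bernoulli//=.
    have /andP[y0 y1] := y01 k.
    by rewrite exprn_ile1 ?subr_ge0// gerBl.
  + rewrite -[X in _ --> X]subr0; apply: cvgB; first exact: cvg_cst.
    exact: cvg_natM_geometric.
  + exact: cvg_cst.
- apply: (squeeze_cvgr (f := fun=> 0) (h := fun k => (k.+1%:R)^-1)).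
  + apply: nearW => k; have /andP[y0 y1] := y01 k.
    rewrite exprn_ge0 ?subr_ge0//=.
    have : k%:R <= (k * 2 ^ k)%:R * y k.
      rewrite natE ler_peMr// exprn_ege1// /w; lra.
    set N := (k * 2 ^ k)%N => kN.
    have e1 : (1 - y k) ^+ N <= expR (- (N%:R * y k)).
      rewrite -mulrN mulrC expRM_natr lerXn2r ?nnegrE ?subr_ge0 ?expR_ge0//.
      exact: expR_ge1Dx.
    apply: (le_trans e1); rewrite expRN lef_pV2 ?posrE ?expR_gt0//.
    rewrite -natr1; apply: le_trans (expR_ge1Dx _); lra.
  + exact: cvg_cst.
  + exact: cvg_harmonic.
Qed.
End smooth_step.

(** * Uniqueness of the cosine transform *)

Lemma indic_bigsetU (T : Type) (R : realType) (F : (set T)^nat) n (x : T) :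
  trivIset [set: nat] F ->
  \1_(\big[setU/set0]_(i < n) F i) x = \sum_(i < n) \1_(F i) x :> R.
Proof.
move=> tF; elim: n => [|n IH]; first by rewrite !big_ord0 indic0.
rewrite !big_ord_recr/= -IH !indicE in_setU.
have [Fn|] := boolP (x \in F n); last by rewrite orbF addr0.
rewrite orbT memNset ?add0r// -bigcup_mkord => -[i /= ni Fi].
have ii := tF i n I I (ex_intro _ x (conj Fi (set_mem Fn))).
by rewrite ii ltnn in ni.
Qed.

Import HBNNSimple.

Section trig_orthogonality.
Context {d : measure_display} {T : measurableType d} {R : realType}.
Variable mu : {measure set T -> \bar R}.
Variables (D X : T -> R).
Hypothesis intD : intg mu D.
Hypothesis mX : measurable_fun setT X.

Lemma measurable_cosM (a t : R) : measurable_fun setT (fun x => cos (a * X x + t)).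
Proof.
apply: measurableT_comp; first by apply: continuous_measurable_fun; exact: continuous_cos.
by apply: measurable_funD => //; exact: measurable_funM.
Qed.

(** The engine of the section: orthogonality to [D] survives dominated pointwise limits. It carries
    the property from trigonometric polynomials to half-lines, Borel sets and finally measurable
    functions. *)
Lemma orthogonal_lim (g_ : nat -> T -> R) (g h : T -> R) :
  (forall n, measurable_fun setT (g_ n)) -> measurable_fun setT g ->
  measurable_fun setT h -> intg mu (fun x => D x * h x) ->
  (forall n x, `|g_ n x| <= h x) -> (forall x, g_ ^~ x @ \oo --> g x) ->
  (forall n, \int[mu]_x (D x * g_ n x) = 0) -> \int[mu]_x (D x * g x) = 0.
Proof.
move=> mg_ mg mh intDh g_h g_g Dg0.
have mD := intg_measurable intD.
have : (fun n => \int[mu]_x (D x * g_ n x)) @ \oo --> \int[mu]_x (D x * g x).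
  apply: (@Rint_dominated _ _ _ _ _ _ (fun x => `|D x * h x|)).
  - by move=> n; exact: measurable_funM.
  - exact: measurable_funM.
  - exact: integrable_norm.
  - by move=> x; apply: cvgM; [exact: cvg_cst|exact: g_g].
  - move=> n x; rewrite !normrM ler_wpM2l//; apply: le_trans (g_h n x) (ler_norm _).
under eq_cvg do rewrite Dg0.
by move=> /cvg_lim <- //; rewrite lim_cst.
Qed.

Hypothesis D_cos : forall a t, \int[mu]_x (D x * cos (a * X x + t)) = 0.

(** The product-to-sum formula lowers the power by one and shifts frequency and phase, hence the
    extra cosine with arbitrary [a] and [t] in the induction. *)
Lemma orthogonal_cosX (c e : R) k a t :
  \int[mu]_x (D x * (cos (c * X x + e) ^+ k * cos (a * X x + t))) = 0.
Proof.
elim: k a t => [|k IH] a t.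
  by rewrite -(D_cos a t); apply: eq_Rint => x; rewrite expr0 mul1r.
have ibd a' t' : intg mu (fun x => D x * (cos (c * X x + e) ^+ k * cos (a' * X x + t'))).
  apply: (intgMb (M := 1)) => //.
    by apply: measurable_funM; [apply: measurable_funX|]; exact: measurable_cosM.
  move=> x; rewrite normrM normrX mulr_ile1 ?exprn_ge0 ?normr_ge0// ?exprn_ile1 ?cos_max//.
have -> : \int[mu]_x (D x * (cos (c * X x + e) ^+ k.+1 * cos (a * X x + t))) =
  \int[mu]_x (2^-1 * (D x * (cos (c * X x + e) ^+ k * cos ((c + a) * X x + (e + t)))
   + D x * (cos (c * X x + e) ^+ k * cos ((c - a) * X x + (e - t))))).
  apply: eq_Rint => x; rewrite exprSr.
  have -> : (c + a) * X x + (e + t) = (c * X x + e) + (a * X x + t) by ring.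
  have -> : (c - a) * X x + (e - t) = (c * X x + e) - (a * X x + t) by ring.
  by move: (c * X x + e) (a * X x + t) => u w; rewrite cosB cosD; field.
by rewrite RintZ ?RintD ?IH ?addr0 ?mulr0//; exact: intgD.
Qed.

Lemma orthogonal_poly (p : {poly R}) (c e : R) :
  \int[mu]_x (D x * p.[cos (c * X x + e)]) = 0.
Proof.
have ibd k : intg mu (fun x => D x * cos (c * X x + e) ^+ k).
  apply: (intgMb (M := 1)) => //; first by apply: measurable_funX; exact: measurable_cosM.
  by move=> x; rewrite normrX exprn_ile1 ?cos_max.
transitivity (\int[mu]_x (\sum_(i < size p) (p`_i * (D x * cos (c * X x + e) ^+ i)))).
  by apply: eq_Rint => x; rewrite horner_coef mulr_sumr; apply: eq_bigr => i _; ring.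
rewrite Rint_sum => [|i _]; last exact: intgZ.
rewrite big1// => i _; rewrite RintZ//.
have := orthogonal_cosX c e i 0 0; under eq_Rint do rewrite mul0r addr0 cos0 mulr1.
by move=> ->; rewrite mulr0.
Qed.

Lemma orthogonal_sin_gt0 (c e : R) :
  \int[mu]_x (D x * (if 0 < cos (c * X x + e) then 1 else 0)) = 0.
Proof.
have mc := measurable_cosM c e.
apply: (@orthogonal_lim (fun k x => smooth_step k (cos (c * X x + e))) _ (cst 1)) => //.
- move=> k; rewrite /smooth_step; apply: measurable_funX; apply: measurable_funB => //.
  by apply: measurable_funX; apply: measurable_funM => //; exact: measurable_funB.
- by apply: measurable_fun_ifT => //; exact: measurable_fun_ltr.
- by apply: (intgMb (M := 1)) => // x; rewrite normr1.
- by move=> k x; exact/smooth_step_bound/cos_max.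
- by move=> x; exact/cvg_smooth_step/cos_max.
- move=> k; have [p pE] := @smooth_step_poly R k.
  by under eq_Rint do rewrite pE; exact: orthogonal_poly.
Qed.

(** A half-line is the limit of the periodic sets where sin(c_n (X - b)) is positive, with c_n
    tending to 0: once c_n |X - b| < pi, the sine has the sign of X - b. The phase - pi / 2 turns
    the cosine into this sine. *)
Lemma orthogonal_halfline (b : R) :
  \int[mu]_x (D x * (if b < X x then 1 else 0)) = 0.
Proof.
have mi c e : measurable_fun setT (fun x => if 0 < cos (c * X x + e) then 1 else 0 : R).
  apply: measurable_fun_ifT => //; apply: measurable_fun_ltr => //; exact: measurable_cosM.
pose c n : R := (n.+1%:R)^-1.
apply: (@orthogonal_lim (fun n x => if 0 < cos (c n * X x + (- (c n * b) - pi / 2)) then 1 else 0)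
   _ (cst 1)) => //.
- by apply: measurable_fun_ifT => //; exact: measurable_fun_ltr.
- by apply: (intgMb (M := 1)) => // x; rewrite normr1.
- by move=> n x; case: ifP => _; rewrite ?normr1 ?normr0.
- move=> x; apply: cvg_near_cst.
  have c0 : (fun n => c n * `|X x - b|) @ \oo --> (0 : R).
    rewrite -[X in _ --> X](mul0r `|X x - b|); apply: cvgM; last exact: cvg_cst.
    exact: cvg_harmonic.
  near=> n.
  have cn0 : 0 < c n by rewrite invr_gt0.
  have : c n * `|X x - b| < pi.
    by near: n; apply: (cvgr_lt 0 c0); exact: pi_gt0.
  have -> : c n * X x + (- (c n * b) - pi / 2) = c n * (X x - b) - pi / 2 by ring.
  rewrite cosBpihalf; case: (ltP b (X x)) => bX.
    rewrite gtr0_norm ?subr_gt0// => H; rewrite sin_gt0_pi// H andbT.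
    by rewrite mulr_gt0// subr_gt0.
  rewrite ler0_norm ?subr_le0// mulrN => H.
  rewrite ltNge -[X in X <= 0]opprK -sinN oppr_le0 sin_ge0_pi//.
  by rewrite (ltW H) andbT -mulrN mulr_ge0 ?(ltW cn0)// oppr_ge0 subr_le0.
- by move=> n; exact: orthogonal_sin_gt0.
Unshelve. all: by end_near.
Qed.

Lemma orthogonal_indic (A : set R) : measurable A -> \int[mu]_x (D x * \1_A (X x)) = 0.
Proof.
have mD := intg_measurable intD.
have mI (B : set R) : measurable B -> measurable_fun setT (fun x => \1_B (X x) : R).
  by move=> mB; apply: measurableT_comp => //; exact: measurable_indic.
have iD1 : intg mu (fun x => D x * (cst 1 : T -> R) x).
  by apply: (intgMb (M := 1)) => // x; rewrite normr1.
have iI (B : set R) : measurable B -> intg mu (fun x => D x * \1_B (X x)).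
  move=> mB; apply: (intgMb (M := 1)) => //; first exact: mI.
  by move=> x; rewrite indicE; case: (_ \in _); rewrite ?normr1 ?normr0.
(* Frequency zero says that [D] has integral zero; the whole space and the complements in the Dynkin
   argument need it. *)
have D0 : \int[mu]_x (D x * 1) = 0.
  by rewrite -(D_cos 0 0); apply: eq_Rint => x; rewrite mul0r addr0 cos0.
have mG : @measurable _ R = <<s @RGenOInfty.G R >> by exact: RGenOInfty.measurableE.
move=> mA; have : <<s @RGenOInfty.G R >> A by rewrite -mG.
move: A {mA}; apply: (dynkin_induction mG).
- move=> _ _ [x ->] [y ->]; exists (Num.max x y).
  by apply/seteqP; split => z /=; rewrite !in_itv/= !andbT gt_max => /andP.
- by rewrite -D0; apply: eq_Rint => x; rewrite indicT.
- move=> _ [b ->]; rewrite -(orthogonal_halfline b); apply: eq_Rint => x.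
  by rewrite indicE mem_setE in_itv/= andbT; case: ifP.
- move=> S mS S0.
  transitivity (\int[mu]_x (D x * 1 - D x * \1_S (X x))).
    apply: eq_Rint => x; rewrite -mulrBr; congr (_ * _).
    by rewrite !indicE in_setC; case: (_ \in _); rewrite /= ?subr0 ?subrr.
  by rewrite RintB ?S0 ?D0 ?subr0//; exact: iI.
- move=> F mF tF F0.
  apply: (@orthogonal_lim (fun n x => \1_(\big[setU/set0]_(i < n) F i) (X x)) _ (cst 1)) => //.
  + by move=> n; apply: mI; exact: bigsetU_measurable.
  + by apply: mI; exact: bigcup_measurable.
  + by move=> n x; rewrite indicE; case: (_ \in _); rewrite ?normr1 ?normr0.
  + move=> x; apply: cvg_near_cst.
    have [[i _ Fi]|nF] := pselect ((\bigcup_k F k) (X x)).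
      near=> n; rewrite !indicE !mem_set//; first by exists i.
      rewrite -bigcup_mkord; exists i => //=; near: n; exact: nbhs_infty_gt.
    apply: nearW => n; rewrite !indicE !memNset//.
    by apply: contra_not nF; rewrite -bigcup_mkord => -[i _ Fi]; exists i.
  + move=> n.
    transitivity (\int[mu]_x (\sum_(i < n) D x * \1_(F i) (X x))).
      apply: eq_Rint => x; rewrite -mulr_sumr; congr (_ * _).
      by rewrite indic_bigsetU.
    by rewrite Rint_sum ?big1// => i _; exact: iI.
Unshelve. all: by end_near.
Qed.

(** Simple functions increase to [f], and [f] itself dominates them, so [f] may be unbounded; this
    is needed for exponentials. *)
Lemma orthogonal_ge0 (f : R -> R) : measurable_fun setT f -> (forall y, 0 <= f y) ->
  intg mu (fun x => D x * f (X x)) -> \int[mu]_x (D x * f (X x)) = 0.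
Proof.
move=> mf f0 iDf.
have mf' : measurable_fun setT (EFin \o f) by exact/measurable_EFinP.
pose g_ n : R -> R := nnsfun_approx measurableT mf' n.
have g_cvg y : g_ ^~ y @ \oo --> f y.
  have := @cvg_nnsfun_approx _ _ _ _ measurableT _ mf' _ y I.
  move=> /(_ (fun x _ => f0 x)) /fine_cvg //.
have g_le n y : g_ n y <= f y.
  rewrite -(cvg_lim (@Rhausdorff R) (g_cvg y)).
  apply: nondecreasing_cvgn_le; last by apply/cvg_ex; exists (f y); exact: g_cvg.
  by move=> i j ij; have /lefP := nd_nnsfun_approx measurableT mf' ij; exact.
apply: (@orthogonal_lim (fun n x => g_ n (X x)) _ (fun x => f (X x))) => //.
- by move=> n; exact: measurableT_comp.
- exact: measurableT_comp.
- exact: measurableT_comp.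
- by move=> n x; rewrite ger0_norm.
- move=> n.
  pose s := nnsfun_approx measurableT mf' n.
  have ms y : measurable (s @^-1` [set y]) by exact: measurable_funPTI.
  transitivity (\int[mu]_x (\sum_(y <- finmap.enum_fset (fset_set (range s))) (y * (D x * \1_(s @^-1` [set y]) (X x))))).
    apply: eq_Rint => x; rewrite /g_ fimfunE fsbig_finite//= mulr_sumr.
    by apply: eq_bigr => y _; ring.
  have iI (y : R) : intg mu (fun x => D x * \1_(s @^-1` [set y]) (X x)).
    apply: (intgMb (M := 1)) => //; first by apply: measurableT_comp => //; exact: measurable_indic.
    by move=> x; rewrite indicE; case: (_ \in _); rewrite ?normr1 ?normr0.
  rewrite Rint_sum => [|y _]; last exact: intgZ.
  by rewrite big1// => y _; rewrite RintZ// orthogonal_indic// mulr0.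
Qed.
End trig_orthogonality.

(** * Independence of jointly Gaussian variables *)

Section gaussian_independence.
Context {d : measure_display} {T : measurableType d} {R : realType}.
Variable P : probability T R.

Lemma intg_bounded (g : T -> R) (M : R) : measurable_fun setT g ->
  (forall x, `|g x| <= M) -> intg P g.
Proof.
move=> mg gM.
apply: (le_intg (g := cst M)) => //.
exact: finite_measure_integrable_cst.
Qed.

Lemma Rint_cst (c : R) : \int[P]_x c = c.
Proof.
rewrite Rintegral_cst// -[RHS]mulr1; congr (_ * _).
exact: (congr1 fine (@probability_setT _ _ _ P)).
Qed.

Lemma measurable_sumM (I : Type) (s : seq I) (a : I -> R) (X : I -> T -> R) :
  (forall i, measurable_fun setT (X i)) ->
  measurable_fun setT (fun x => \sum_(i <- s) a i * X i x).
Proof. by move=> mX; apply: measurable_sum => i; exact: measurable_funM. Qed.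

Lemma measurable_cosD (L : T -> R) (t : R) : measurable_fun setT L ->
  measurable_fun setT (fun x => cos (L x + t)).
Proof.
move=> mL; apply: measurableT_comp; last exact: measurable_funD.
by apply: continuous_measurable_fun; exact: continuous_cos.
Qed.

(* [W] has the same cosine transform along [X] as if it were independent of the centred Gaussian vector [X] with independent coordinates of variances [v]. *)
Definition gauss_weight (I : eqType) (s : seq I) (v : I -> R) (X : I -> T -> R) (W : T -> R) :=
  forall (a : I -> R) t,
    \int[P]_x (W x * cos (\sum_(i <- s) a i * X i x + t)) =
    (\int[P]_x W x) * expR (- (\sum_(i <- s) a i ^+ 2 * v i) / 2) * cos t.

Variables (I : eqType) (v : I -> R) (X : I -> T -> R).
Hypothesis mX : forall i, measurable_fun setT (X i).
Hypothesis gX : forall i a t,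
  \int[P]_x cos (a * X i x + t) = expR (- (a ^+ 2 * v i) / 2) * cos t.

(** Fix a combination L of the remaining coordinates. The hypothesis says that W cos(L + t), minus a
    suitable constant, is orthogonal to every cosine of [X i], hence to [f (X i)]. So multiplying
    [W] by [f (X i)] only changes its integral, and the product is again a weight for the remaining
    coordinates. *)
Lemma gauss_weight_factor i s W (f : R -> R) : i \notin s -> intg P W ->
  gauss_weight (i :: s) v X W -> measurable_fun setT f -> (forall y, 0 <= f y) ->
  intg P (fun x => f (X i x)) -> intg P (fun x => W x * f (X i x)) ->
  \int[P]_x (W x * f (X i x)) = (\int[P]_x W x) * \int[P]_x f (X i x) /\
  gauss_weight s v X (fun x => W x * f (X i x)).
Proof.
move=> nis iW gW mf f0 if_ iWf.
have mW := intg_measurable iW.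
have cosb (L : T -> R) t : measurable_fun setT L -> intg P (fun x => W x * cos (L x + t)).
  move=> mL; apply: (intgMb (M := 1)) => //; first exact: measurable_cosD.
  by move=> x; exact: cos_max.
suff key (a : I -> R) t :
    \int[P]_x (W x * f (X i x) * cos (\sum_(j <- s) a j * X j x + t)) =
    (\int[P]_x W x) * (\int[P]_x f (X i x)) *
    expR (- (\sum_(j <- s) a j ^+ 2 * v j) / 2) * cos t.
  have E : \int[P]_x (W x * f (X i x)) = (\int[P]_x W x) * \int[P]_x f (X i x).
    have := key (fun=> 0) 0.
    rewrite [X in expR (- X / 2)]big1 => [|j _]; last by rewrite expr0n mul0r.
    rewrite oppr0 mul0r expR0 cos0 !mulr1 => <-; apply: eq_Rint => x.
    by rewrite big1 => [|j _]; rewrite ?mul0r// addr0 cos0 mulr1.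
  by split => // a t; rewrite key E.
pose L x := \sum_(j <- s) a j * X j x.
have mL : measurable_fun setT L by exact: measurable_sumM.
(* The value that cos(L + t), weighted by [W], would have if [X i] were independent of both; it is
   what makes [D] orthogonal. *)
pose c := (\int[P]_x W x) * expR (- (\sum_(j <- s) a j ^+ 2 * v j) / 2) * cos t.
pose D x := W x * cos (L x + t) - c.
have iD : intg P D.
  apply: intgB; first exact: cosb.
  by apply: (@intg_bounded _ `|c|) => // x.
have key2 b u : \int[P]_x (W x * cos (b * X i x + (L x + u))) =
    (\int[P]_x W x) * expR (- (b ^+ 2 * v i) / 2) *
    expR (- (\sum_(j <- s) a j ^+ 2 * v j) / 2) * cos u.
  have := gW (fun j => if j == i then b else a j) u.
  rewrite !big_cons eqxx mulNr mulrDl opprD expRD mulrA -!mulNr.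
  rewrite (eq_big_seq (fun j => a j ^+ 2 * v j)); last first.
    by move=> j js; case: eqP => // ji; rewrite -ji js in nis.
  move=> <-; apply: eq_Rint => x; rewrite !big_cons eqxx addrA.
  congr (_ * cos (_ + _ + _)); apply: eq_big_seq => j js.
  by case: eqP => // ji; rewrite -ji js in nis.
(* The frequency of [L] is negated by applying [key2] to [- b] and [- u], as the cosine is even; the
   product-to-sum formula needs both signs. *)
have key3 b u : \int[P]_x (W x * cos (b * X i x + (- L x + u))) =
    (\int[P]_x W x) * expR (- (b ^+ 2 * v i) / 2) *
    expR (- (\sum_(j <- s) a j ^+ 2 * v j) / 2) * cos u.
  rewrite -[u]opprK cosN -[X in expR (- (X * _) / 2)]sqrrN -key2.
  by apply: eq_Rint => x; rewrite -cosN; congr (_ * cos _); ring.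
have D_cos b u : \int[P]_x (D x * cos (b * X i x + u)) = 0.
  transitivity (\int[P]_x (2^-1 * (W x * cos (b * X i x + (L x + (t + u))) +
      W x * cos (b * X i x + (- L x + (u - t)))) - c * cos (b * X i x + u))).
    apply: eq_Rint => x; rewrite /D.
    have -> : b * X i x + (L x + (t + u)) = (b * X i x + u) + (L x + t) by ring.
    have -> : b * X i x + (- L x + (u - t)) = (b * X i x + u) - (L x + t) by ring.
    by move: (b * X i x + u) (L x + t) => y z; rewrite cosB cosD; field.
  have mbX : measurable_fun setT (fun x => b * X i x) by exact: measurable_funM.
  have i1 : intg P (fun x => W x * cos (b * X i x + (L x + (t + u)))).
    under eq_fun do rewrite addrA; apply: cosb; exact: measurable_funD.
  have i2 : intg P (fun x => W x * cos (b * X i x + (- L x + (u - t)))).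
    under eq_fun do rewrite addrA; apply: cosb; apply: measurable_funD => //.
    exact: measurableT_comp.
  have i3 : intg P (fun x => cos (b * X i x + u)).
    by apply: (@intg_bounded _ 1); [exact: measurable_cosD|move=> x; exact: cos_max].
  rewrite RintB; [|by apply: intgZ; exact: intgD|exact: intgZ].
  rewrite !RintZ//; last exact: intgD.
  by rewrite RintD// key2 key3 gX /c cosB cosD; field.
have := orthogonal_ge0 iD (mX i) D_cos mf f0.
have iDfE x : D x * f (X i x) = W x * f (X i x) * cos (L x + t) - c * f (X i x).
  by rewrite /D; ring.
have i1 : intg P (fun x => W x * f (X i x) * cos (L x + t)).
  apply: (intgMb (M := 1)) => //; first exact: measurable_cosD.
  by move=> x; exact: cos_max.
under eq_fun do rewrite iDfE.
move=> /(_ (intgB i1 (intgZ c if_))).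
rewrite RintB//; last exact: intgZ.
rewrite RintZ// => /eqP; rewrite subr_eq0 => /eqP ->; rewrite /c; ring.
Qed.

(** The factors are absorbed into the weight one at a time, which is the reason for allowing a
    general [W]. *)
Lemma gauss_weight_prod s W (f : I -> R -> R) (M : I -> R) : uniq s -> intg P W ->
  gauss_weight s v X W -> (forall i, i \in s -> measurable_fun setT (f i)) ->
  (forall i y, i \in s -> 0 <= f i y <= M i) ->
  \int[P]_x (W x * \prod_(i <- s) f i (X i x)) =
  (\int[P]_x W x) * \prod_(i <- s) \int[P]_x f i (X i x).
Proof.
elim: s W => [|i s IH] W us iW gW mf f0M.
  by rewrite big_nil mulr1; apply: eq_Rint => x; rewrite big_nil mulr1.
move: us => /= /andP[nis us].
have is_ : i \in i :: s by rewrite inE eqxx.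
have js j : j \in s -> j \in i :: s by rewrite inE => ->; rewrite orbT.
have mfi : measurable_fun setT (fun x => f i (X i x)).
  by apply: measurableT_comp => //; exact: mf.
have fM x : `|f i (X i x)| <= M i.
  by have /andP[f0 fM] := f0M i (X i x) is_; rewrite ger0_norm.
have iWf : intg P (fun x => W x * f i (X i x)) by exact: intgMb fM.
have [E gWf] := @gauss_weight_factor i s W (f i) nis iW gW (mf i is_)
  (fun y => proj1 (andP (f0M i y is_))) (intg_bounded mfi fM) iWf.
rewrite big_cons mulrA -E -IH//.
- by apply: eq_Rint => x; rewrite big_cons mulrA.
- by move=> j /js; exact: mf.
- by move=> j y /js; exact: f0M.
Qed.

End gaussian_independence.

(** * Transfer of integrals for laws with a density *)

Lemma Rint_EFin {d : measure_display} {T : measurableType d} {R : realType}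
  (mu : {measure set T -> \bar R}) (f : T -> R) : intg mu f ->
  (\int[mu]_x (f x)%:E)%E = (\int[mu]_x f x)%:E.
Proof. by move=> intf; rewrite fineK//; exact: (integrable_fin_num measurableT intf). Qed.

Lemma Rint_indic {d : measure_display} {T : measurableType d} {R : realType}
  (mu : {measure set T -> \bar R}) (A : set T) : measurable A ->
  \int[mu]_x \1_A x = fine (mu A).
Proof. by move=> mA; rewrite /Rintegral integral_indic// setIT. Qed.

Section density.
Context {d : measure_display} {T : measurableType d} {R : realType}.
Variables (P : probability T R) (X : T -> R) (p : R -> R).
Local Notation mu := (@lebesgue_measure R).
Hypothesis mX : measurable_fun setT X.
Hypothesis p0 : forall y, 0 <= p y.
Hypothesis ip : intg mu p.
Hypothesis XP : forall A : set R, measurable A ->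
  P (X @^-1` A) = (\int[mu]_(x in A) (p x)%:E)%E.

Let density_sfun (s : {nnsfun R >-> R}) :
  (\int[P]_x (s (X x))%:E = \int[mu]_y (s y * p y)%:E)%E.
Proof.
have mp := intg_measurable ip.
have ms y : measurable (s @^-1` [set y]) by exact: measurable_funPTI.
have mXs y : measurable (X @^-1` (s @^-1` [set y])).
  by rewrite -[X in measurable X]setTI; exact: mX.
have iP (y : R) : intg P (fun x => \1_(s @^-1` [set y]) (X x)).
  apply: (@intg_bounded _ _ _ _ _ 1); first by apply: measurableT_comp => //; exact: measurable_indic.
  by move=> x; rewrite indicE; case: (_ \in _); rewrite ?normr1 ?normr0.
have imu (y : R) : intg mu (fun x => p x * \1_(s @^-1` [set y]) x).
  apply: (intgMb (M := 1)) => //; first exact: (@measurable_indic _ _ R setT _ (ms y)).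
  by move=> x; rewrite indicE; case: (_ \in _); rewrite ?normr1 ?normr0.
pose r := finmap.enum_fset (fset_set (range s)).
have e1 x : s (X x) = \sum_(y <- r) (y * \1_(s @^-1` [set y]) (X x)).
  by rewrite fimfunE fsbig_finite.
have e2 x : s x * p x = \sum_(y <- r) (y * (p x * \1_(s @^-1` [set y]) x)).
  by rewrite fimfunE fsbig_finite//= mulr_suml; apply: eq_bigr => y _; ring.
under eq_integral do rewrite e1.
under [RHS]eq_integral do rewrite e2.
rewrite !Rint_EFin; [|by apply: intg_sum => y _; exact: intgZ..].
congr EFin; rewrite !Rint_sum; [|by move=> y _; exact: intgZ..].
apply: eq_bigr => y _; rewrite !RintZ//; congr (_ * _).
transitivity (fine (P (X @^-1` (s @^-1` [set y])))).
  by rewrite -Rint_indic.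
rewrite XP// integral_mkcond /Rintegral; congr fine; apply: eq_integral => x _.
rewrite patchE indicE; case: ifPn => _ /=; by rewrite ?mulr1 ?mulr0.
Qed.

Lemma ge0_integral_density (f : R -> R) : measurable_fun setT f ->
  (forall y, 0 <= f y) ->
  (\int[P]_x (f (X x))%:E = \int[mu]_y (f y * p y)%:E)%E.
Proof.
move=> mf f0.
have mp := intg_measurable ip.
have mf' : measurable_fun setT (EFin \o f) by exact/measurable_EFinP.
pose s := nnsfun_approx measurableT mf'.
have s_cvg y : (s n y)%:E @[n --> \oo] --> (f y)%:E.
  by apply: (@cvg_nnsfun_approx _ _ _ _ measurableT _ mf' _ y I) => x _; rewrite lee_fin.
have s_nd y : {homo (fun n => s n y) : m n / (m <= n)%N >-> m <= n}.
  by move=> m n mn; exact/lefP/nd_nnsfun_approx.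
transitivity (limn (fun n => \int[P]_x (s n (X x))%:E)%E).
  rewrite -monotone_convergence//.
  - by apply: eq_integral => x _; apply/esym/cvg_lim => //; exact: s_cvg.
  - by move=> n; apply/measurable_EFinP/measurableT_comp.
  - by move=> n x _; rewrite lee_fin.
  - by move=> x _ m n mn; rewrite lee_fin; exact: s_nd.
under eq_fun do rewrite density_sfun.
rewrite -monotone_convergence//.
- apply: eq_integral => x _; apply/cvg_lim => //.
  apply: cvg_EFin; first exact: nearW.
  apply: cvgM; last exact: cvg_cst.
  exact: (fine_cvg (s_cvg x)).
- move=> n; apply/measurable_EFinP; apply: measurable_funM; [|exact: mp].
  have ms : measurable_fun [set: R] (s n) by [].
  exact: ms.
- by move=> n x _; rewrite lee_fin mulr_ge0.
- by move=> x _ m n mn; rewrite lee_fin ler_wpM2r//; exact: s_nd.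
Qed.

Lemma intg_density (f : R -> R) : measurable_fun setT f ->
  intg mu (fun y => f y * p y) -> intg P (fun x => f (X x)).
Proof.
move=> mf /integrableP[_ fp]; apply/integrableP; split.
  by apply/measurable_EFinP; exact: measurableT_comp.
rewrite (eq_integral (fun x => (`|f (X x)|)%:E))//.
rewrite (ge0_integral_density (f := fun y => `|f y|))//; last exact: measurableT_comp.
apply: le_lt_trans fp; rewrite le_eqVlt; apply/orP; left; apply/eqP.
by apply: eq_integral => x _ /=; rewrite normrM (ger0_norm (p0 x)).
Qed.

Lemma Rint_density (f : R -> R) : measurable_fun setT f ->
  intg mu (fun y => f y * p y) -> \int[P]_x f (X x) = \int[mu]_y (f y * p y).
Proof.
move=> mf ifp.
have mp := intg_measurable ip.
have mn : measurable_fun setT (fun y => `|f y|) by exact: measurableT_comp.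
(* [f] is written as a difference of the nonnegative functions [g] and [|f|], to which the
   nonnegative transfer formula applies. *)
pose g y := f y + `|f y|.
have ing : intg mu (fun y => `|f y| * p y).
  apply: (le_intg _ (integrable_norm ifp)); first exact: measurable_funM.
  by move=> x /=; rewrite !normrM normr_id.
have mg : measurable_fun setT g by exact: measurable_funD.
have g0 y : 0 <= g y by rewrite /g -lerBlDl sub0r -normrN ler_norm.
have ig : intg mu (fun y => g y * p y).
  by under eq_fun do rewrite mulrDl; exact: intgD.
have E (h : R -> R) : measurable_fun setT h -> (forall y, 0 <= h y) ->
    \int[P]_x h (X x) = \int[mu]_y (h y * p y).
  by move=> mh h0; rewrite /Rintegral ge0_integral_density.
transitivity (\int[P]_x (g (X x) - `|f (X x)|)).
  by apply: eq_Rint => x; rewrite /g addrK.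
rewrite RintB; [|exact: intg_density|exact: (intg_density (f := fun y => `|f y|))].
rewrite (E (fun y => `|f y|))// E// -RintB//; apply: eq_Rint => x.
by rewrite /g; ring.
Qed.

End density.

(** The fundamental theorem on [-(n+1), n+1], then dominated convergence; [n.+1] keeps the interval
    nondegenerate. *)
Lemma Rint_derive0 {R : realType} (f F : R -> R) :
  continuous f -> intg (@lebesgue_measure R) f ->
  (forall x, is_derive x (1 : R) F (f x)) ->
  F x @[x --> +oo] --> 0 -> F x @[x --> -oo] --> 0 ->
  \int[@lebesgue_measure R]_x f x = 0.
Proof.
move=> cf intf dF Fy FNy.
have mf := intg_measurable intf.
pose g n x := f x * \1_(`[- n.+1%:R, n.+1%:R] : set R) x.
have gE n : \int[lebesgue_measure]_x g n x = F n.+1%:R - F (- n.+1%:R).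
  have ab : - n.+1%:R < n.+1%:R :> R by rewrite ltrNl; apply: (@lt_trans _ _ 0); rewrite ?oppr_lt0.
  have : (\int[@lebesgue_measure R]_(x in `[(- n.+1%:R)%R, n.+1%:R%R]) (f x)%:E
      = (F n.+1%:R)%:E - (F (- n.+1%:R))%:E)%E.
    have cF x : {for x, continuous F}.
      by apply/differentiable_continuous/derivable1_diffP; exact: ex_derive.
    apply: continuous_FTC2 => //.
    - exact: continuous_subspaceT.
    - split.
      + by move=> x _; exact: ex_derive.
      + by apply: cvg_at_right_filter; exact: cF.
      + by apply: cvg_at_left_filter; exact: cF.
    - by move=> x _; rewrite derive1E; exact: derive_val.
  move=> H; rewrite -[RHS]/(fine ((F n.+1%:R)%:E - (F (- n.+1%:R))%:E)%E) -H.
  rewrite integral_mkcond /Rintegral; congr fine; apply: eq_integral => x _.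
  by rewrite patchE /g indicE; case: ifPn; rewrite /= ?mulr1 ?mulr0.
have lim1 : (fun n => \int[lebesgue_measure]_x g n x) @ \oo --> \int[lebesgue_measure]_x f x.
  apply: (@Rint_dominated _ _ _ lebesgue_measure g f (fun x => `|f x|)) => //.
  - by move=> n; apply: measurable_funM => //; exact: measurable_indic.
  - exact: integrable_norm.
  - move=> x; apply: cvg_near_cst; near=> n.
    rewrite /g indicE mem_set ?mulr1//= in_itv/= -ler_norml.
    apply: (@le_trans _ _ n%:R); last by rewrite ler_nat.
    by near: n; exact: nbhs_infty_ger.
  - move=> n x; rewrite /g normrM indicE; case: (_ \in _); rewrite ?normr1 ?normr0 ?mulr1 ?mulr0//.
have ny : (n.+1%:R : R) @[n --> \oo] --> +oo.
  by apply/(@cvgryPge R) => A; near=> n; apply: (@le_trans _ _ n%:R);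
    [near: n; exact: nbhs_infty_ger|rewrite ler_nat].
have lim2 : (fun n => \int[lebesgue_measure]_x g n x) @ \oo --> (0 - 0 : R).
  under eq_cvg do rewrite gE.
  apply: cvgB; first exact: (cvg_comp _ _ ny Fy).
  by apply: (cvg_comp (fun n => - n.+1%:R) F _ FNy); apply/cvgNrNy; exact: ny.
rewrite subr0 in lim2.
by rewrite -(cvg_lim (@Rhausdorff R) lim1) (cvg_lim (@Rhausdorff R) lim2).
Unshelve. all: by end_near.
Qed.

(** * Normal integrals *)

Section normal_integrals.
Context {R : realType}.
Local Notation mu := (@lebesgue_measure R).
Variables (m s : R).
Hypothesis s0 : s != 0.
Local Notation p := (normal_pdf m s).

Lemma normal_pdf_expR y : p y = normal_peak s * expR (- (y - m) ^+ 2 / (2 * s ^+ 2)).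
Proof. by rewrite normal_pdfE// /normal_fun mulr_natl. Qed.

Lemma is_derive_normal_pdf y : is_derive y (1 : R) p (- ((y - m) / s ^+ 2) * p y).
Proof.
have s20 : s ^+ 2 != 0 by rewrite sqrf_eq0.
have -> : p = (fun y => normal_peak s * expR (- (y - m) ^+ 2 / (2 * s ^+ 2))).
  by apply/funext => x; exact: normal_pdf_expR.
apply: trigger_derive; rewrite /GRing.scale/=.
by field.
Qed.

Lemma continuous_pdf : continuous p. Proof. exact: continuous_normal_pdf. Qed.

(** Doubling the variance absorbs a quadratic factor: the exponential of [p] is the square of the
    one, E', with variance 2 s^2, and exp x >= 1 + x gives (1 + (y - m)^2 / (4 s^2)) E' <= 1. *)
Lemma normal_pdf_growth : exists2 D : R, 0 <= D & forall y,
  (1 + `|y - m|) ^+ 2 * p y <= D * normal_pdf m (Num.sqrt 2 * s) y.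
Proof.
have t0 : Num.sqrt 2 * s != 0 by rewrite mulf_neq0// gt_eqF// sqrtr_gt0.
exists ((2 * (1 + 4 * s ^+ 2)) * normal_peak s / normal_peak (Num.sqrt 2 * s)).
  by rewrite !mulr_ge0 ?invr_ge0 ?normal_peak_ge0// addr_ge0// mulr_ge0// sqr_ge0.
move=> y; rewrite normal_pdf_expR (@normal_pdfE _ m _ t0) /normal_fun.
set E := expR (- (y - m) ^+ 2 / (2 * s ^+ 2)).
set E' := expR (_ / (_ *+ 2)).
have EE : E = E' * E'.
  rewrite -expRD; congr expR; rewrite exprMn sqr_sqrtr// -mulr_natl.
  by field.
have s2 : 0 < s ^+ 2 by rewrite exprn_even_gt0.
have E'0 : 0 < E' by exact: expR_gt0.
have k1 : (1 + (y - m) ^+ 2 / (4 * s ^+ 2)) * E' <= 1.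
  rewrite -ler_pdivlMr// div1r -expRN; apply: le_trans (expR_ge1Dx _).
  rewrite lerD2l exprMn sqr_sqrtr// -mulr_natl le_eqVlt; apply/orP; left; apply/eqP.
  by field.
have k2 : (1 + `|y - m|) ^+ 2 <= 2 * (1 + (y - m) ^+ 2).
  rewrite -(real_normK (num_real (y - m))).
  have := sqr_ge0 (1 - `|y - m|); nra.
have k3 : 1 + (y - m) ^+ 2 <= (1 + 4 * s ^+ 2) * (1 + (y - m) ^+ 2 / (4 * s ^+ 2)).
  have : 0 <= (y - m) ^+ 2 / (4 * s ^+ 2) by rewrite divr_ge0// ?sqr_ge0// mulr_ge0// ltW.
  set u := (y - m) ^+ 2 / _ => u0.
  have -> : (y - m) ^+ 2 = 4 * s ^+ 2 * u by rewrite /u; field.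
  nra.
have k : (1 + `|y - m|) ^+ 2 * E <= 2 * (1 + 4 * s ^+ 2) * E'.
  rewrite EE mulrA; apply: ler_wpM2r; first exact: ltW.
  apply: (@le_trans _ _ (2 * ((1 + 4 * s ^+ 2) * ((1 + (y - m) ^+ 2 / (4 * s ^+ 2)) * E')))).
    have -> : 2 * ((1 + 4 * s ^+ 2) * ((1 + (y - m) ^+ 2 / (4 * s ^+ 2)) * E')) =
      (2 * ((1 + 4 * s ^+ 2) * (1 + (y - m) ^+ 2 / (4 * s ^+ 2)))) * E' by ring.
    apply: ler_wpM2r; first exact: ltW.
    by apply: (le_trans k2); apply: ler_wpM2l.
  have -> : 2 * (1 + 4 * s ^+ 2) = 2 * ((1 + 4 * s ^+ 2) * 1) by ring.
  apply: ler_wpM2l => //; apply: ler_wpM2l => //.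
  by rewrite addr_ge0// mulr_ge0// ltW.
have pk : 0 < normal_peak (Num.sqrt 2 * s) by exact: normal_peak_gt0.
have -> : 2 * (1 + 4 * s ^+ 2) * normal_peak s / normal_peak (Num.sqrt 2 * s) *
  (normal_peak (Num.sqrt 2 * s) * E') = normal_peak s * (2 * (1 + 4 * s ^+ 2) * E').
  by field; rewrite gt_eqF.
by rewrite mulrCA; apply: ler_wpM2l; [exact: normal_peak_ge0|exact: k].
Qed.

Lemma intg_normal_pdf (h : R -> R) (C : R) : measurable_fun setT h ->
  (forall y, `|h y| <= C * (1 + `|y - m|) ^+ 2) -> intg mu (fun y => h y * p y).
Proof.
move=> mh hC; have [D D0 HD] := normal_pdf_growth.
have C0 : 0 <= C.
  have := le_trans (normr_ge0 _) (hC m); rewrite subrr normr0 addr0 expr1n mulr1 //.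
apply: (@le_intg _ _ _ mu _ (fun y => (C * D) * normal_pdf m (Num.sqrt 2 * s) y)).
- by apply: measurable_funM => //; exact: measurable_normal_pdf.
- by apply: intgZ; exact: integrable_normal_pdf.
- move=> y; rewrite normrM (ger0_norm (normal_pdf_ge0 _ _ _)) -mulrA.
  apply: (@le_trans _ _ (C * ((1 + `|y - m|) ^+ 2 * p y))); last by rewrite ler_wpM2l.
  by rewrite mulrA ler_wpM2r// normal_pdf_ge0.
Qed.

(** The quadratic bound leaves one spare factor 1 / (1 + |y - m|) when [h] grows at most
    linearly. *)
Lemma cvg_normal_pdf0 (h : R -> R) (C : R) : (forall y, `|h y| <= C * (1 + `|y - m|)) ->
  h y * p y @[y --> +oo] --> 0 /\ h y * p y @[y --> -oo] --> 0.
Proof.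
move=> hC; have [D D0 HD] := normal_pdf_growth.
have C0 : 0 <= C.
  have := le_trans (normr_ge0 _) (hC m); rewrite subrr normr0 addr0 mulr1 //.
pose B := C * (D * normal_peak (Num.sqrt 2 * s)).
have key y : `|h y * p y| <= B * (1 + `|y - m|)^-1.
  have y0 : 0 < 1 + `|y - m| by rewrite ltr_pwDl.
  rewrite ler_pdivlMr// normrM (ger0_norm (normal_pdf_ge0 _ _ _)).
  apply: (@le_trans _ _ (C * ((1 + `|y - m|) ^+ 2 * p y))).
    have := hC y; have := normal_pdf_ge0 m s y; move: (p y) (1 + _) y0 => q z z0 q0.
    move=> H; rewrite expr2.
    have -> : C * (z * z * q) = (C * z) * (q * z) by ring.
    by rewrite -[leLHS]mulrA; apply: ler_wpM2r => //; rewrite mulr_ge0// ltW.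
  rewrite /B ler_wpM2l//; apply: (le_trans (HD y)); rewrite ler_wpM2l//.
  by apply: normal_pdf_ub; rewrite mulf_neq0// gt_eqF// sqrtr_gt0.
have B0 : 0 <= B by rewrite !mulr_ge0 ?normal_peak_ge0.
have main (F : set_system R) (FF : Filter F) : (forall A : R, \forall y \near F, A <= `|y - m|) ->
    h y * p y @[y --> F] --> 0.
  move=> HF; apply/cvgrPdist_le => e e0; near=> y.
  rewrite sub0r normrN; apply: (le_trans (key y)).
  have y0 : 0 < 1 + `|y - m| by rewrite ltr_pwDl.
  rewrite ler_pdivrMr// mulrC -ler_pdivrMr//.
  have : B / e <= `|y - m| by near: y; exact: HF.
  move=> H; apply: (le_trans H); by rewrite lerDr.
split; apply: main => A.
  near=> y; apply: le_trans (ler_norm _); rewrite lerBrDr; near: y.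
  by apply: nbhs_pinfty_ge; exact: num_real.
near=> y; rewrite distrC; apply: le_trans (ler_norm _); rewrite lerBrDr -lerBrDl; near: y.
by apply: nbhs_ninfty_le; exact: num_real.
Unshelve. all: by end_near.
Qed.

(** Stein's identity: since p' = - (y - m) p / s^2, the integrand is the derivative of s^2 h p.
    Suitable choices of [h] give the mean, the variance and the differential equation of the cosine
    transform. *)
Lemma gauss_stein (h h' : R -> R) (C : R) :
  (forall y, is_derive y (1 : R) h (h' y)) -> continuous h' ->
  (forall y, `|h y| <= C * (1 + `|y - m|)) ->
  (forall y, `|h' y| <= C * (1 + `|y - m|) ^+ 2) ->
  \int[mu]_y ((s ^+ 2 * h' y - (y - m) * h y) * p y) = 0.
Proof.
move=> dh ch' hC h'C.
have ch : continuous h.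
  by move=> x; apply/differentiable_continuous/derivable1_diffP; exact: ex_derive.
have s20 : s ^+ 2 != 0 by rewrite sqrf_eq0.
have C0 : 0 <= C.
  have := le_trans (normr_ge0 _) (hC m); rewrite subrr normr0 addr0 mulr1 //.
have cid : continuous (fun y : R => y - m).
  by move=> x; apply: cvgB; [exact: cvg_id|exact: cvg_cst].
have cg : continuous (fun y => s ^+ 2 * h' y - (y - m) * h y).
  move=> x; apply: cvgB; apply: cvgM => //; try exact: cvg_cst.
    exact: ch'.
    exact: cid.
    exact: ch.
have shC y : `|s ^+ 2 * h y| <= (s ^+ 2 * C) * (1 + `|y - m|).
  by rewrite normrM (ger0_norm (sqr_ge0 s)) -mulrA; apply: ler_wpM2l; rewrite ?sqr_ge0.
have [Fy FNy] := cvg_normal_pdf0 shC.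
apply: (@Rint_derive0 _ _ (fun y => s ^+ 2 * h y * p y)) => //.
- by move=> x; apply: cvgM; [exact: cg|exact: continuous_pdf].
- apply: (@intg_normal_pdf _ (s ^+ 2 * C + C)).
    exact: continuous_measurable_fun.
  move=> y; apply: (le_trans (ler_normB _ _)); rewrite [leRHS]mulrDl; apply: lerD.
    by rewrite normrM (ger0_norm (sqr_ge0 s)) -mulrA; apply: ler_wpM2l; rewrite ?sqr_ge0.
  rewrite normrM; have := hC y; move: (h y) (normr_ge0 (y - m)) => z; move: `|y - m| => w w0 H.
  apply: (@le_trans _ _ (w * (C * (1 + w)))); first by rewrite ler_wpM2l.
  have : 0 <= C * (1 + w) by rewrite mulr_ge0// addr_ge0.
  nra.
- move=> x; have := is_derive_normal_pdf x; have := dh x => d1 d2.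
  apply: trigger_derive; rewrite /GRing.scale/=.
  by field.
Qed.

Lemma normal_mean0 : \int[mu]_y ((y - m) * p y) = 0.
Proof.
have := @gauss_stein (cst 1) (cst 0) 1.
move=> /(_ (fun=> is_derive_cst _ _ _)) /(_ (fun=> cvg_cst _)) H.
transitivity (\int[mu]_y (-1 * ((s ^+ 2 * cst 0 y - (y - m) * cst 1 y) * p y))).
  by apply: eq_Rint => y /=; ring.
rewrite RintZ.
  rewrite H ?mulr0// => y.
  - by rewrite normr1 mul1r lerDl.
  - by rewrite normr0 mul1r exprn_ge0// addr_ge0.
have -> : (fun x => (s ^+ 2 * cst 0 x - (x - m) * cst 1 x) * p x) = (fun x => (m - x) * p x).
  by apply/funext => x /=; ring.
apply: (@intg_normal_pdf _ 1); first exact: measurable_funB.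
by move=> y; rewrite distrC mul1r; have := normr_ge0 (y - m); nra.
Qed.

Lemma normal_variance : \int[mu]_y ((y - m) ^+ 2 * p y) = s ^+ 2.
Proof.
have dh (y : R) : is_derive y (1 : R) (fun y => y - m) 1.
  by apply: trigger_derive; rewrite subr0.
have := @gauss_stein (fun y => y - m) (cst 1) 1 dh (fun=> cvg_cst _).
have -> : (fun y => (s ^+ 2 * cst 1 y - (y - m) * (y - m)) * p y) =
   (fun y => s ^+ 2 * p y - (y - m) ^+ 2 * p y).
  by apply/funext => y /=; ring.
have i2 : intg mu (fun y => (y - m) ^+ 2 * p y).
  apply: (@intg_normal_pdf _ 1); first by apply: measurable_funX; exact: measurable_funB.
  move=> y; rewrite normrX mul1r lerXn2r ?nnegrE ?addr_ge0// lerDr //.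
rewrite RintB//; last by apply: intgZ; exact: integrable_normal_pdf.
rewrite RintZ; last exact: integrable_normal_pdf.
rewrite [X in _ * X]/Rintegral integral_normal_pdf /= mulr1.
move=> H; apply/esym/eqP; rewrite -subr_eq0; apply/eqP; apply: H => y.
- by rewrite mul1r lerDr.
- by rewrite normr1 mul1r exprn_ege1// lerDl.
Qed.

(** Differentiating under the integral and applying Stein's identity to a sine gives psi'(a) = - s^2
    a psi(a). Hence psi(a) exp(a^2 s^2 / 2) is constant, with value cos t at a = 0. *)
Lemma normal_cos (a t : R) :
  \int[mu]_y (cos (a * (y - m) + t) * p y) = expR (- (a ^+ 2 * s ^+ 2) / 2) * cos t.
Proof.
pose psi a := \int[mu]_y (cos (a * (y - m) + t) * p y).
have ml b : measurable_fun setT (fun y : R => b * (y - m) + t).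
  by apply: measurable_funD => //; apply: measurable_funM => //; exact: measurable_funB.
have dpsi b : is_derive b (1 : R) psi (- (s ^+ 2 * b) * psi b).
  have icos c : intg mu (fun y => cos (c * (y - m) + t) * p y).
    apply: (@intg_normal_pdf _ 1).
      by apply: measurableT_comp => //; apply: continuous_measurable_fun; exact: continuous_cos.
    by move=> y; rewrite mul1r (le_trans (cos_max _))// exprn_ege1// lerDl.
  have isin c : intg mu (fun y => (y - m) * sin (c * (y - m) + t) * p y).
    apply: (@intg_normal_pdf _ 1).
      apply: measurable_funM; first exact: measurable_funB.
      by apply: measurableT_comp => //; apply: continuous_measurable_fun; exact: continuous_sin.
    move=> y; rewrite mul1r normrM; apply: (@le_trans _ _ (`|y - m| * 1)).
      by rewrite ler_wpM2l// sin_max.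
    by have := normr_ge0 (y - m); nra.
  have dcos c y : is_derive c (1 : R) (fun c => cos (c * (y - m) + t) * p y)
      (- ((y - m) * sin (c * (y - m) + t)) * p y).
    apply: trigger_derive; rewrite /GRing.scale/=.
    by ring.
  have E1 : \int[mu]_y (- ((y - m) * sin (b * (y - m) + t)) * p y) = - (s ^+ 2 * b) * psi b.
    have dh (y : R) : is_derive y (1 : R) (fun y => sin (b * (y - m) + t)) (b * cos (b * (y - m) + t)).
      by apply: trigger_derive; rewrite /GRing.scale/=; ring.
    have := @gauss_stein _ _ (1 + `|b|) dh.
    have -> : (fun y => (s ^+ 2 * (b * cos (b * (y - m) + t)) - (y - m) * sin (b * (y - m) + t)) * p y) =
      (fun y => (s ^+ 2 * b) * (cos (b * (y - m) + t) * p y) + (- ((y - m) * sin (b * (y - m) + t)) * p y)).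
      by apply/funext => y; ring.
    have isin' : intg mu (fun y => - ((y - m) * sin (b * (y - m) + t)) * p y).
      by under eq_fun do rewrite -mulN1r -mulrA; apply: intgZ.
    rewrite RintD//; last exact: intgZ.
    rewrite RintZ// -/(psi b) => H.
    apply/eqP; rewrite mulNr -addr_eq0 addrC; apply/eqP; apply: H.
    - move=> x; apply: cvgM; first exact: cvg_cst.
      apply: (@cvg_comp _ _ _ (fun y => b * (y - m) + t) cos); last exact: continuous_cos.
      by apply: cvgD; [apply: cvgM; [exact: cvg_cst|apply: cvgB; [exact: cvg_id|exact: cvg_cst]]|exact: cvg_cst].
    - move=> y; apply: (le_trans (sin_max _)); have := normr_ge0 (y - m); have := normr_ge0 b; nra.
    - move=> y; rewrite normrM.
      apply: (@le_trans _ _ (`|b| * 1)); first by rewrite ler_wpM2l// cos_max.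
      rewrite mulr1; apply: (@le_trans _ _ (1 + `|b|)); first by rewrite lerDr.
      by rewrite ler_peMr ?addr_ge0// exprn_ege1// lerDl.
  have Ib : (`]b - 1, b + 1[%classic : set R) b by rewrite /= in_itv/= ltrBlDr ltrDl ltr01.
  pose f c y := cos (c * (y - m) + t) * p y.
  have pf c y : partial1of2 f c y = - ((y - m) * sin (c * (y - m) + t)) * p y.
    by rewrite partial1of2E; exact: derive_val.
  have G_ub c y : `|partial1of2 f c y| <= `|y - m| * p y.
    rewrite pf normrM normrN normrM (ger0_norm (normal_pdf_ge0 _ _ _)) ler_wpM2r ?normal_pdf_ge0//.
    by rewrite ler_piMr// sin_max.
  have iG : intg mu (fun y => `|y - m| * p y).
    apply: (@intg_normal_pdf _ 1).
      by apply: measurableT_comp => //; exact: measurable_funB.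
    by move=> y; rewrite normr_id; have := normr_ge0 (y - m); nra.
  have dd : derivable psi b 1.
    apply: (@derivable_under_integral _ _ _ mu f setT measurableT b (b - 1) (b + 1) Ib _ _ (fun y => `|y - m| * p y)) => //.
    - by move=> x _; exact: icos.
    - by move=> y; rewrite mulr_ge0// normal_pdf_ge0.
  have de : derive1 psi b = - (s ^+ 2 * b) * psi b.
    rewrite -E1 (@differentiation_under_integral _ _ _ mu f setT measurableT b (b - 1) (b + 1) Ib _ _ (fun y => `|y - m| * p y)) //.
    - by apply: eq_Rint => y; rewrite pf.
    - by move=> x _; exact: icos.
    - by move=> y; rewrite mulr_ge0// normal_pdf_ge0.
  by rewrite -de derive1E; exact: derivableP.
pose g a := psi a * expR (a ^+ 2 * s ^+ 2 / 2).
have gc b c : g b = g c.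
  apply: is_derive_0_is_cst => x; have := dpsi x => dx.
  apply: trigger_derive; rewrite /GRing.scale/=.
  by field.
have g0 : g 0 = cos t.
  rewrite /g expr0n !mul0r expR0 mulr1 /psi.
  transitivity (\int[mu]_y (cos t * p y)).
    by apply: eq_Rint => y; rewrite mul0r add0r.
  rewrite RintZ; last exact: integrable_normal_pdf.
  by rewrite /Rintegral integral_normal_pdf /= mulr1.
have := gc a 0; rewrite g0 /g => <-.
rewrite mulrCA -expRD.
have -> : - (a ^+ 2 * s ^+ 2) / 2 + a ^+ 2 * s ^+ 2 / 2 = 0 by field.
by rewrite expR0 mulr1.
Qed.

(** Completing the square: an exponential weight shifts the mean by l s^2. Both the moment
    generating function and the truncated exponential moment of [tilt_int] rest on this. *)
Lemma normal_pdf_tilt (l y : R) :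
  expR (l * (y - m)) * p y = expR (l ^+ 2 * s ^+ 2 / 2) * normal_pdf (m + l * s ^+ 2) s y.
Proof.
rewrite normal_pdf_expR (@normal_pdfE _ _ _ s0) /normal_fun mulrCA [RHS]mulrCA -!expRD.
congr (_ * expR _); rewrite -mulr_natl.
by field.
Qed.

Lemma normal_mgf (l : R) : intg mu (fun y => expR (l * (y - m)) * p y) /\
  \int[mu]_y (expR (l * (y - m)) * p y) = expR (l ^+ 2 * s ^+ 2 / 2).
Proof.
under eq_fun do rewrite normal_pdf_tilt.
split; first by apply: intgZ; exact: integrable_normal_pdf.
rewrite RintZ; last exact: integrable_normal_pdf.
by rewrite /Rintegral integral_normal_pdf /= mulr1.
Qed.

End normal_integrals.

(** * Transforms of a centred Gaussian variable *)

Section gaussianRV_theory.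
Context {d : measure_display} {T : measurableType d} {R : realType}.
Variable P : probability T R.
Implicit Type X : T -> R.

(** Handles the degenerate alternative of [gaussianRV]. *)
Lemma Rint_ae_cst X (m : R) (g : R -> R) : measurable_fun setT X ->
  P [set w | X w = m] = 1%E -> measurable_fun setT g ->
  intg P (fun x => g (X x)) /\ \int[P]_x g (X x) = g m.
Proof.
move=> mX Xm mg.
have mA : measurable [set w | X w = m].
  by rewrite -[X in measurable X]setTI; exact: (mX measurableT [set m]).
have ae (h : R -> R) : {ae P, forall x, setT x -> (h (X x))%:E = (h m)%:E}.
  exists (~` [set w | X w = m]); split; first exact: measurableC.
    by rewrite -[LHS]/(P _) probability_setC// Xm subee.
  by move=> x /= nX; apply: contra_not nX => ->.
have mgX : measurable_fun setT (fun x => g (X x)) by exact: measurableT_comp.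
split.
  apply/integrableP; split; first exact/measurable_EFinP.
  rewrite (ae_eq_integral (fun=> `|g m|%:E))//.
  - by have := Rint_cst P `|g m|; rewrite integral_cst//= (@probability_setT _ _ _ P) mule1 ltry.
  - by apply/measurable_EFinP; apply: measurableT_comp.
  - exact: (ae (fun y => `|g y|)).
rewrite -[RHS](Rint_cst P); congr fine; apply: ae_eq_integral => //; first exact/measurable_EFinP.
exact: (ae g).
Qed.

Lemma gaussianRV_measurable X : gaussianRV P X -> measurable_fun setT X.
Proof. by case. Qed.

Lemma gaussianRV_intg X : gaussianRV P X ->
  intg P X /\ intg P (fun x => X x * X x).
Proof.
case=> mX [[m [s [s0 XP]]]|[m Xm]]; last first.
  split; first by have [] := Rint_ae_cst mX Xm (@measurable_id _ _ setT).
  by have [] := @Rint_ae_cst _ _ (fun y => y * y) mX Xm (measurable_funM (@measurable_id _ _ setT) (@measurable_id _ _ setT)).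
have ip := integrable_normal_pdf m s.
have h (f : R -> R) (C : R) : measurable_fun setT f ->
    (forall y, `|f y| <= C * (1 + `|y - m|) ^+ 2) -> intg P (fun x => f (X x)).
  move=> mf fC; apply: (intg_density mX (@normal_pdf_ge0 _ m s) ip XP) => //.
  exact: intg_normal_pdf fC.
have i1 : intg P X.
  apply: (h id (1 + `|m|)); first exact: measurable_id.
  move=> y /=; have -> : y = (y - m) + m by ring.
  apply: (le_trans (ler_normD _ _)); rewrite addrK.
  have := normr_ge0 m; have := normr_ge0 (y - m); nra.
split => //.
have i2 : intg P (fun x => (X x - m) ^+ 2).
  apply: (h (fun y => (y - m) ^+ 2) 1).
    by apply: measurable_funX; exact: measurable_funB.
  by move=> y; rewrite normrX; have := normr_ge0 (y - m); nra.
have -> : (fun x => X x * X x) = (fun x => ((X x - m) ^+ 2 + (2 * m) * X x) - m ^+ 2).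
  by apply/funext => x; ring.
apply: intgB; first by apply: intgD => //; exact: intgZ.
by apply: (@intg_bounded _ _ _ _ _ `|m ^+ 2|) => // x.
Qed.

(** The parameters are read off the moments: m = 0 and s^2 = q. The degenerate law has m = 0 and q =
    0 and satisfies the first two formulas; in the third it is excluded by q = 1. *)
Lemma gaussianRV_centered X (q : R) : gaussianRV P X -> \int[P]_x X x = 0 ->
  \int[P]_x (X x * X x) = q ->
  [/\ forall a t, \int[P]_x cos (a * X x + t) = expR (- (a ^+ 2 * q) / 2) * cos t,
      forall l, intg P (fun x => expR (l * X x)) /\
        \int[P]_x expR (l * X x) = expR (l ^+ 2 * q / 2) &
      q = 1 -> forall A, measurable A -> P (X @^-1` A) = normal_prob 0 1 A].
Proof.
move=> gX; have [iX iXX] := gaussianRV_intg gX.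
have mcos a t : measurable_fun setT (fun y : R => cos (a * y + t)).
  apply: measurableT_comp; first by apply: continuous_measurable_fun; exact: continuous_cos.
  by apply: measurable_funD => //; exact: measurable_funM.
have mexp l : measurable_fun setT (fun y : R => expR (l * y)).
  by apply: measurableT_comp => //; exact: measurable_funM.
case: gX => mX [[m [s [s0 XP]]]|[m Xm]] X0 XXq; last first.
  have E g mg := proj2 (@Rint_ae_cst _ _ g mX Xm mg).
  have m0 : m = 0 by rewrite -(E id (@measurable_id _ _ setT)).
  have q0 : q = 0.
    by rewrite -XXq (E (fun y => y * y) (measurable_funM (@measurable_id _ _ setT) (@measurable_id _ _ setT))) m0 mul0r.
  split.
  - by move=> a t; rewrite (E _ (mcos a t)) m0 q0 !mulr0 oppr0 mul0r expR0 mul1r add0r.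
  - move=> l; have [] := @Rint_ae_cst _ _ _ mX Xm (mexp l); rewrite m0 q0 !mulr0 mul0r expR0; by [].
  - by rewrite q0 => /esym/eqP; rewrite oner_eq0.
have ip := integrable_normal_pdf m s.
have E := Rint_density mX (@normal_pdf_ge0 _ m s) ip XP.
have idp (h : R -> R) (C : R) : measurable_fun setT h ->
  (forall y, `|h y| <= C * (1 + `|y - m|) ^+ 2) ->
  intg (@lebesgue_measure R) (fun y => h y * normal_pdf m s y) by exact: intg_normal_pdf.
have m0 : m = 0.
  have : \int[P]_x (X x - m) = 0.
    rewrite (E (fun y => y - m)); first exact: normal_mean0.
      exact: measurable_funB.
    apply: (idp _ 1); first exact: measurable_funB.
    by move=> y; have := normr_ge0 (y - m); nra.
  have ic : intg P (fun=> m) by apply: (@intg_bounded _ _ _ _ _ `|m|).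
  by rewrite RintB// X0 Rint_cst sub0r => /eqP; rewrite oppr_eq0 => /eqP.
have qs : q = s ^+ 2.
  rewrite -XXq -(normal_variance m s0) -(E (fun y => (y - m) ^+ 2)).
  - by apply: eq_Rint => x; rewrite m0 subr0.
  - by apply: measurable_funX; exact: measurable_funB.
  - apply: (idp _ 1); first by apply: measurable_funX; exact: measurable_funB.
    by move=> y; rewrite normrX; have := normr_ge0 (y - m); nra.
split.
- move=> a t; rewrite qs -(normal_cos m s0) -(E (fun y => cos (a * (y - m) + t))).
  + by apply: eq_Rint => x; rewrite m0 subr0.
  + have -> : (fun y => cos (a * (y - m) + t)) = (fun y => cos (a * y + t)).
      by apply/funext => y; rewrite m0 subr0.
    exact: mcos.
  + apply: (idp _ 1).
      have -> : (fun y => cos (a * (y - m) + t)) = (fun y => cos (a * y + t)).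
        by apply/funext => y; rewrite m0 subr0.
      exact: mcos.
    by move=> y; apply: (le_trans (cos_max _)); have := normr_ge0 (y - m); nra.
- move=> l; have [i1 e1] := normal_mgf m s0 l.
  have ee : (fun y => expR (l * (y - m)) * normal_pdf m s y) = (fun y => expR (l * y) * normal_pdf m s y).
    by apply/funext => y; rewrite m0 subr0.
  rewrite ee in i1 e1; split.
    exact: (intg_density mX (@normal_pdf_ge0 _ m s) ip XP (mexp l)).
  by rewrite (E _ (mexp l))// e1 qs.
(* [s] may be 1 or -1; the density depends on [s ^+ 2] only. *)
- move=> q1 A mA; rewrite XP// m0 /normal_prob; apply: eq_integral => y _; congr EFin.
  rewrite !normal_pdf_expR ?oner_neq0// -qs q1 expr1n; congr (_ * _).
  by rewrite /normal_peak -qs q1 expr1n.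
Qed.
End gaussianRV_theory.

(** * Gaussian tail bounds *)

Section mills.
Context {R : realType}.
Local Notation mu := (@lebesgue_measure R).
Local Notation p m := (normal_pdf m (1 : R)).

Definition gtail (t : R) : R := fine (normal_prob 0 1 `]t, +oo[%classic).

Let one0 : (1 : R) != 0. Proof. exact: oner_neq0. Qed.

Lemma is_derive_pdf1 (m y : R) : is_derive y (1 : R) (p m) (- (y - m) * p m y).
Proof.
by have := is_derive_normal_pdf m one0 y; rewrite expr1n divr1.
Qed.

(** On y >= t one has 1 <= (y - m) / (t - m), and (y - m) p has the explicit primitive - p. A
    general mean is allowed because [tilt_int] applies it to a shifted law. *)
Lemma pdf_mills_ub (m t : R) : m < t ->
  (\int[mu]_(y in `[t, +oo[) (p m y)%:E <= (p m t / (t - m))%:E)%E.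
Proof.
move=> mt.
have [Fy _] := @cvg_normal_pdf0 _ m 1 one0 (cst (-1)) 1 (fun y =>
  ltac:(by rewrite /= normrN1 mul1r lerDl)).
have cp := @continuous_pdf _ m 1 one0.
have dF y : is_derive y (1 : R) (fun y => cst (-1) y * p m y) ((y - m) * p m y).
  have := is_derive_pdf1 m y => dp; apply: trigger_derive; rewrite /GRing.scale/=.
  by ring.
have := @ge0_continuous_FTC2y _ (fun y => (y - m) * p m y) (fun y => cst (-1) y * p m y) t 0.
move=> /(_ _ _ _ _ _ _) H.
have {}H : (\int[mu]_(y in `[t, +oo[) ((y - m) * p m y)%:E = (p m t)%:E)%E.
  rewrite H /= ?mulN1r ?oppeK ?add0e //.
  - by rewrite opprK.
  - by move=> x tx; rewrite mulr_ge0 ?normal_pdf_ge0// subr_ge0 (le_trans (ltW mt)).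
  - apply: continuous_subspaceT => x; apply: cvgM; last exact: cp.
    by apply: cvgB; [exact: cvg_id|exact: cvg_cst].
  - by rewrite -[X in _ --> X]mulN1r; apply: cvg_at_right_filter; apply: cvgM; [exact: cvg_cst|exact: cp].
  - by move=> x _; rewrite derive1E; exact: derive_val.
rewrite EFinM -H muleC -ge0_integralZl//; first last.
- by rewrite lee_fin invr_ge0 subr_ge0 ltW.
- move=> x /=; rewrite in_itv/= andbT => tx.
  by rewrite lee_fin mulr_ge0 ?normal_pdf_ge0// subr_ge0 (le_trans (ltW mt)).
- apply/measurable_EFinP/measurable_funTS/measurable_funM; last exact: measurable_normal_pdf.
  exact: measurable_funB.
apply: ge0_le_integral => //.
- by move=> x _; rewrite lee_fin normal_pdf_ge0.
- by apply/measurable_EFinP/measurable_funTS; exact: measurable_normal_pdf.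
- apply: measurable_funeM.
  apply/measurable_EFinP/measurable_funTS/measurable_funM; last exact: measurable_normal_pdf.
  exact: measurable_funB.
- move=> x /=; rewrite in_itv/= andbT => tx; rewrite -EFinM lee_fin mulrA ler_peMl ?normal_pdf_ge0//.
  by rewrite mulrC ler_pdivlMr ?subr_gt0// mul1r lerD2r.
Qed.

Lemma gtailE (t : R) : (gtail t)%:E = (\int[mu]_(y in `[t, +oo[) (p 0 y)%:E)%E.
Proof.
rewrite /gtail fineK; last by apply: fin_num_measure.
rewrite /normal_prob integral_itv_obnd_cbnd//.
by apply/measurable_EFinP/measurable_funTS; exact: measurable_normal_pdf.
Qed.

Lemma gtail_ub (t : R) : 0 < t -> gtail t <= p 0 t / t.
Proof. by move=> t0; rewrite -lee_fin gtailE; have := pdf_mills_ub t0; rewrite subr0. Qed.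

(** The function - p(y) / y has derivative (1 + 1 / y^2) p(y), so p(t) / t is the integral of the
    latter over y >= t, at most (1 + 1 / t^2) times the tail. *)
Lemma gtail_lb (t : R) : 0 < t -> p 0 t * t / (1 + t ^+ 2) <= gtail t.
Proof.
move=> t0.
have cp := @continuous_pdf _ 0 1 one0.
have dF (y : R) : 0 < y ->
    is_derive y (1 : R) (fun y => - (y^-1 * p 0 y)) ((1 + (y ^+ 2)^-1) * p 0 y).
  move=> y0; have := is_derive_pdf1 0 y; rewrite subr0 => dp.
  have y1 : y != 0 by rewrite gt_eqF.
  have dV : is_derive y (1 : R) (fun y => y^-1) (- (y ^+ 2)^-1).
    have := @is_deriveV R id y 1 1 y1 (is_derive_id _ _).
    by rewrite /GRing.scale/= mulr1.
  apply: trigger_derive; rewrite /GRing.scale/=.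
  by field.
have [py _] := @cvg_normal_pdf0 _ 0 1 one0 (cst 1) 1 (fun y =>
  ltac:(by rewrite /= normr1 mul1r lerDl)).
have Fy : - (y^-1 * p 0 y) @[y --> +oo] --> (0 : R).
  rewrite -[X in _ --> X]oppr0; apply: cvgN.
  apply: (squeeze_cvgr (f := fun=> 0) (h := fun y => cst 1 y * p 0 y)) => //; last exact: cvg_cst.
  near=> y; have y1 : 1 <= y by near: y; apply: nbhs_pinfty_ge; exact: num_real.
  have y0 : 0 <= y by apply: le_trans y1.
  rewrite mulr_ge0 ?normal_pdf_ge0 ?invr_ge0//= ler_wpM2r ?normal_pdf_ge0//.
  by rewrite invf_le1// (lt_le_trans _ y1).
have cx (x : R) : t <= x -> {for x, continuous (fun y : R => (1 + (y ^+ 2)^-1) * p 0 y)}.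
  move=> tx; have x0 : x ^+ 2 != 0 by rewrite gt_eqF// exprn_gt0// (lt_le_trans t0).
  apply: cvgM; last exact: cp.
  apply: cvgD; first exact: cvg_cst.
  by apply: cvgV => //; exact: exprn_continuous.
have H := @ge0_continuous_FTC2y _ (fun y => (1 + (y ^+ 2)^-1) * p 0 y) (fun y => - (y^-1 * p 0 y)) t 0.
have {}H : (\int[mu]_(y in `[t, +oo[) ((1 + (y ^+ 2)^-1) * p 0 y)%:E = (t^-1 * p 0 t)%:E)%E.
  rewrite H.
  - by rewrite EFinN oppeK add0e.
  - by move=> x tx; rewrite mulr_ge0 ?normal_pdf_ge0// addr_ge0// invr_ge0 sqr_ge0.
  - apply: continuous_in_subspaceT => x; rewrite inE/= in_itv/= andbT; exact: cx.
  - exact: Fy.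
  - by move=> x tx; apply: ex_derive; apply: dF; exact: lt_trans tx.
  - apply: cvg_at_right_filter; apply: cvgN; apply: cvgM; last exact: cp.
    by apply: cvgV; [rewrite gt_eqF|exact: cvg_id].
  - move=> x; rewrite in_itv/= andbT => tx; rewrite derive1E.
    by have := dF x (lt_trans t0 tx) => dx; exact: derive_val.
have : ((t^-1 * p 0 t)%:E <= (1 + (t ^+ 2)^-1)%:E * (gtail t)%:E)%E.
  rewrite -H gtailE -ge0_integralZl//; first last.
  - by rewrite lee_fin addr_ge0// invr_ge0 sqr_ge0.
  - by move=> x _; rewrite lee_fin normal_pdf_ge0.
  - by apply/measurable_EFinP/measurable_funTS; exact: measurable_normal_pdf.
  apply: ge0_le_integral => //.
  - by move=> x _; rewrite lee_fin mulr_ge0 ?normal_pdf_ge0// addr_ge0// invr_ge0 sqr_ge0.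
  - apply/measurable_EFinP; apply: subspace_continuous_measurable_fun => //.
    by apply: continuous_in_subspaceT => x; rewrite inE/= in_itv/= andbT; exact: cx.
  - apply: measurable_funeM.
    by apply/measurable_EFinP/measurable_funTS; exact: measurable_normal_pdf.
  - move=> x /=; rewrite in_itv/= andbT => tx; rewrite -EFinM lee_fin ler_wpM2r ?normal_pdf_ge0//.
    rewrite lerD2l lef_pV2 ?posrE ?exprn_gt0 ?(lt_le_trans t0)//.
    by rewrite lerXn2r ?nnegrE ?(ltW t0) ?(le_trans (ltW t0)).
rewrite -EFinM lee_fin => K.
rewrite ler_pdivrMr ?ltr_pwDl ?sqr_ge0//.
have -> : p 0 t * t = (t^-1 * p 0 t) * t ^+ 2 by field; rewrite gt_eqF.
have -> : gtail t * (1 + t ^+ 2) = ((1 + (t ^+ 2)^-1) * gtail t) * t ^+ 2 by field; rewrite gt_eqF.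
by apply: ler_wpM2r => //; exact: sqr_ge0.
Unshelve. all: by end_near.
Qed.

Lemma gtail_ge0 (t : R) : 0 <= gtail t.
Proof. by apply: fine_ge0; exact: measure_ge0. Qed.
End mills.

(** * Extreme value asymptotics *)

Section extreme_asymptotics.
Context {R : realType}.
Local Notation c n := (c_seq n : R).
Local Notation d n := (d_seq n : R).
Local Notation p := (normal_pdf 0 (1 : R)).

Lemma cvgr_ninfty_ln : (fun n => ln n%:R : R) @ \oo --> +oo.
Proof.
apply/(@cvgryPge R) => A.
near=> n; rewrite -(expRK A) ler_ln ?posrE ?expR_gt0//; near: n.
  exact: nbhs_infty_ger.
by exists 1%N => // n /= n1; rewrite ltr0n.
Unshelve. all: by end_near.
Qed.

Lemma c_seq_sqr n : (0 < n)%N -> c n ^+ 2 = 2 * ln n%:R.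
Proof. by move=> n0; rewrite sqr_sqrtr// mulr_ge0// ln_ge0// ler1n. Qed.

Lemma cvg_c_seq : (fun n => c n) @ \oo --> +oo.
Proof.
apply/(@cvgryPge R) => A.
have /(@cvgryPge R)/(_ (A ^+ 2)) := cvgr_ninfty_ln.
apply: filterS => n An; apply: (@le_trans _ _ `|A|); first exact: ler_norm.
rewrite -sqrtr_sqr ler_wsqrtr//.
have := le_trans (sqr_ge0 A) An; nra.
Qed.

Lemma c_seq_gt0 : \forall n \near \oo, 0 < c n.
Proof. by have /(@cvgryPgt R)/(_ 0) := cvg_c_seq. Qed.

(** The correction in [d_seq], chosen so that exp(kappa / 2) = sqrt(2 pi) c: it cancels the
    normalising constant of the density and the factor 1 / t of the tail estimate. *)
Definition kappa n : R := ln (ln n%:R) + ln (4 * pi).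

Lemma d_seqE n : d n = c n - kappa n / (2 * c n).
Proof. by []. Qed.

Lemma cvg_c_seqV : (fun n => (c n)^-1) @ \oo --> (0 : R).
Proof. by apply/gtr0_cvgV0; [exact: c_seq_gt0|exact: cvg_c_seq]. Qed.

Lemma cvg_kappa : (fun n => kappa n / c n) @ \oo --> (0 : R).
Proof.
have -> : (fun n => kappa n / c n) = (fun n => ln (ln n%:R) / c n + ln (4 * pi) * (c n)^-1).
  by apply/funext => n; rewrite /kappa mulrDl.
rewrite -[X in _ --> X]addr0; apply: cvgD; last first.
  rewrite -[X in _ --> X](mulr0 (ln (4 * pi))); apply: cvgM; [exact: cvg_cst|exact: cvg_c_seqV].
(* As log n <= c^2 = q^4, the iterated logarithm is at most 4 log q <= 4 q, negligible against c =
   q^2. *)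
pose q n : R := Num.sqrt (c n).
have cq : (fun n => (q n)^-1) @ \oo --> (0 : R).
  rewrite -[X in _ --> X]sqrtr0.
  under eq_fun do rewrite /q -sqrtrV ?sqrtr_ge0//.
  by apply: continuous_cvg; [exact: sqrt_continuous|exact: cvg_c_seqV].
apply: (squeeze_cvgr (f := fun=> 0) (h := fun n => 4 * (q n)^-1)).
- have /(@cvgryPge R)/(_ 1) := cvgr_ninfty_ln.
  apply: filter_app; near=> n => ln1.
  have c0 : 0 < c n by near: n; exact: c_seq_gt0.
  have q0 : 0 < q n by rewrite sqrtr_gt0.
  rewrite divr_ge0 ?ln_ge0 ?(ltW c0)//=.
  have lq : ln n%:R <= q n ^+ 4 :> R.
    rewrite -[4%N]/(2 * 2)%N exprM sqr_sqrtr ?(ltW c0)// sqr_sqrtr; lra.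
  have l0 : 0 < ln n%:R :> R by lra.
  have : ln (ln n%:R) <= 4 * q n.
    apply: (@le_trans _ _ (ln (q n ^+ 4))).
      by rewrite ler_ln// posrE exprn_gt0.
    rewrite lnXn// -[leLHS]mulr_natl; apply: ler_wpM2l => //.
    by have := ln_sublinear q0; lra.
  move=> H; rewrite ler_pdivrMr//.
  have -> : c n = q n * q n by rewrite -expr2 sqr_sqrtr// ltW.
  by rewrite mulrA -[4 * _ * _]mulrA mulVf ?mulr1// gt_eqF.
- exact: cvg_cst.
- rewrite -[X in _ --> X](mulr0 4); apply: cvgM => //; exact: cvg_cst.
Unshelve. all: by end_near.
Qed.

Section level.
Variable a : R.
Let b n : R := a - kappa n / 2.

Lemma levelE n : 0 < c n -> d n + a / c n = c n + b n / c n.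
Proof. by move=> c0; rewrite d_seqE /b; field; rewrite gt_eqF. Qed.

Lemma cvg_level_b : (fun n => b n / c n) @ \oo --> (0 : R).
Proof.
have -> : (fun n => b n / c n) = (fun n => a * (c n)^-1 - 2^-1 * (kappa n / c n)).
  by apply/funext => n; rewrite /b; ring.
rewrite -[X in _ --> X]subr0 -{1}(mulr0 a) -[X in _ --> _ - X](mulr0 2^-1).
by apply: cvgB; apply: cvgM; [exact: cvg_cst|exact: cvg_c_seqV|exact: cvg_cst|exact: cvg_kappa].
Qed.

Lemma cvg_level_ratio : (fun n => (d n + a / c n) / c n) @ \oo --> (1 : R).
Proof.
have : (fun n => 1 + (b n / c n) * (c n)^-1) @ \oo --> (1 + 0 * 0 : R).
  by apply: cvgD; [exact: cvg_cst|apply: cvgM; [exact: cvg_level_b|exact: cvg_c_seqV]].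
rewrite mulr0 addr0; apply: cvg_trans; apply: near_eq_cvg; near=> n.
have c0 : 0 < c n by near: n; exact: c_seq_gt0.
by rewrite levelE//; field; rewrite gt_eqF.
Unshelve. all: by end_near.
Qed.

Lemma cvg_level_y : (fun n => d n + a / c n) @ \oo --> +oo.
Proof.
apply/(@cvgryPge R) => A; near=> n.
have c0 : 0 < c n by near: n; exact: c_seq_gt0.
have r2 : 2^-1 <= (d n + a / c n) / c n.
  by near: n; apply: (cvgr_ge 1 cvg_level_ratio); lra.
have cA : 2 * `|A| <= c n by near: n; have /(@cvgryPge R) := cvg_c_seq; exact.
have : 2^-1 * c n <= d n + a / c n by rewrite -ler_pdivlMr.
have := ler_norm A; lra.
Unshelve. all: by end_near.
Qed.

(** With n = exp(c^2 / 2) and the level c + b / c, expanding the square cancels n and leaves exp(-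
    b), where b = a - kappa / 2; only the square of b / c survives as an error. *)
Lemma level_pdf n : 0 < c n -> 0 < ln n%:R :> R -> (0 < n)%N ->
  n%:R * p (d n + a / c n) = expR (- a) * c n * expR (- (b n / c n) ^+ 2 / 2).
Proof.
move=> c0 l0 n0.
rewrite levelE// normal_pdf_expR ?oner_neq0// subr0 expr1n.
have nE : n%:R = expR (c n ^+ 2 / 2) :> R.
  by rewrite c_seq_sqr// mulrAC divff// mul1r lnK// posrE ltr0n.
have pE : (normal_peak (1 : R))^-1 * c n = expR (kappa n / 2).
  have pi2 : 0 < pi *+ 2 :> R by rewrite mulrn_wgt0// pi_gt0.
  rewrite /normal_peak invrK expr1n mul1r -sqrtrM ?(ltW pi2)//.
  rewrite /kappa -lnM ?posrE ?mulr_gt0 ?pi_gt0//.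
  have x0 : 0 < ln n%:R * (4 * pi) :> R by rewrite !mulr_gt0// pi_gt0.
  rewrite -[LHS]lnK ?posrE ?sqrtr_gt0; last first.
    by apply: mulr_gt0 => //; exact: mulr_gt0.
  congr expR; have -> : pi *+ 2 * (2 * ln n%:R) = ln n%:R * (4 * pi) :> R.
    by rewrite -mulr_natl; ring.
  have s0 : 0 < Num.sqrt (ln n%:R * (4 * pi)) :> R by rewrite sqrtr_gt0.
  rewrite -{2}(sqr_sqrtr (ltW x0)) lnXn// -mulr_natl; by field.
have k0 : 0 < normal_peak (1 : R) by apply: normal_peak_gt0; exact: oner_neq0.
have cE : c n = normal_peak (1 : R) * expR (kappa n / 2).
  by rewrite -pE mulrA divff ?mul1r// gt_eqF.
rewrite [in LHS]nE mulrCA -expRD.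
have -> : c n ^+ 2 / 2 + - (c n + b n / c n) ^+ 2 / (2 * 1) =
    - a + (kappa n / 2 + - (b n / c n) ^+ 2 / 2).
  by rewrite /b; field; rewrite gt_eqF.
rewrite !expRD [in RHS]mulrAC [in X in _ = _ * X]cE; ring.
Qed.

Lemma level_exp_cvg : (fun n => expR (- (b n / c n) ^+ 2 / 2)) @ \oo --> (1 : R).
Proof.
rewrite -[X in _ --> X]expR0; apply: continuous_cvg; first exact: continuous_expR.
rewrite [X in _ --> X](_ : 0 = - (0 * 0) / 2); last by rewrite mul0r oppr0 mul0r.
apply: cvgM; last exact: cvg_cst.
by apply: cvgN; apply: cvgM; exact: cvg_level_b.
Qed.

(** Both tail bounds are p(t) / t up to factors tending to 1, and n p(t) / t is exp(- a) c / t up to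
    such a factor, with t / c tending to 1. *)
Lemma cvg_level_tail : (fun n => n%:R * gtail (d n + a / c n)) @ \oo --> expR (- a).
Proof.
pose t n : R := d n + a / c n.
pose h n : R := expR (- a) * expR (- (b n / c n) ^+ 2 / 2) * (t n / c n)^-1.
have hc : h @ \oo --> expR (- a).
  rewrite (_ : expR (- a) = expR (- a) * 1 * 1^-1); last by rewrite invr1 !mulr1.
  apply: cvgM; first by apply: cvgM; [exact: cvg_cst|exact: level_exp_cvg].
  by apply: cvgV; [exact: oner_neq0|exact: cvg_level_ratio].
have tVc : (fun n => (t n)^-1) @ \oo --> (0 : R).
  apply/gtr0_cvgV0; last exact: cvg_level_y.
  by have /(@cvgryPgt R)/(_ 0) := cvg_level_y.
have gc : (fun n => h n * (1 + (t n)^-1 * (t n)^-1)^-1) @ \oo --> expR (- a).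
  rewrite -[X in _ --> X]mulr1; apply: cvgM => //.
  rewrite -[X in _ --> X]invr1; apply: cvgV; first exact: oner_neq0.
  rewrite -[X in _ --> X]addr0 -[X in _ --> _ + X](mulr0 0).
  by apply: cvgD; [exact: cvg_cst|exact: cvgM].
apply: squeeze_cvgr gc hc.
near=> n.
have c0 : 0 < c n by near: n; exact: c_seq_gt0.
have t0 : 0 < t n by near: n; have /(@cvgryPgt R) := cvg_level_y; exact.
have l0 : 0 < ln n%:R :> R by near: n; have /(@cvgryPgt R) := cvgr_ninfty_ln; exact.
have n0 : (0 < n)%N by near: n; exists 1%N.
have E : h n = n%:R * (p (t n) / t n).
  by rewrite mulrA level_pdf// /h; field; rewrite !gt_eqF.
have E2 : h n * (1 + (t n)^-1 * (t n)^-1)^-1 = n%:R * (p (t n) * t n / (1 + t n ^+ 2)).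
  have t1 : t n != 0 by rewrite gt_eqF.
  have t2 : 1 + t n ^+ 2 != 0 by rewrite gt_eqF// ltr_pwDl// sqr_ge0.
  have t3 : t n ^+ 2 + 1 != 0 by rewrite addrC.
  by rewrite E; field; rewrite t1 /= ?t2 ?t3.
by rewrite E2 E !ler_wpM2l// ?gtail_lb ?gtail_ub.
Unshelve. all: by end_near.
Qed.

(* The factor multiplying [n] bounds E(exp (2 c (N - d)); N <= d + a / c) for a standard normal [N], see [tilt_int]. *)
Lemma cvg_level_tilt :
  (fun n => n%:R * (expR (2 * a) * (p (d n + a / c n) / (2 * c n - (d n + a / c n)))))
    @ \oo --> expR a.
Proof.
pose t n : R := d n + a / c n.
have : (fun n => expR a * expR (- (b n / c n) ^+ 2 / 2) * (2 - t n / c n)^-1) @ \oo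
    --> (expR a * 1 * 1^-1).
  apply: cvgM; first by apply: cvgM; [exact: cvg_cst|exact: level_exp_cvg].
  apply: cvgV; first exact: oner_neq0.
  rewrite [X in _ --> X](_ : 1 = 2 - 1); last by ring.
  by apply: cvgB; [exact: cvg_cst|exact: cvg_level_ratio].
rewrite invr1 !mulr1.
apply: cvg_trans; apply: near_eq_cvg; near=> n.
have c0 : 0 < c n by near: n; exact: c_seq_gt0.
have l0 : 0 < ln n%:R :> R by near: n; have /(@cvgryPgt R) := cvgr_ninfty_ln; exact.
have n0 : (0 < n)%N by near: n; exists 1%N.
have r2 : (d n + a / c n) / c n < 2.
  by near: n; apply: (cvgr_lt 1 cvg_level_ratio); lra.
rewrite -/(t n) in r2 *.
have t2 : t n < 2 * c n by rewrite -ltr_pdivrMr.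
have -> : n%:R * (expR (2 * a) * (p (t n) / (2 * c n - t n))) =
  expR (2 * a) * (n%:R * p (t n)) / (2 * c n - t n) by ring.
rewrite level_pdf// mulr_natl mulr2n expRD expRN.
field; rewrite !gt_eqF ?expR_gt0 ?subr_gt0//.
Unshelve. all: by end_near.
Qed.
End level.

(** Squeeze: 1 - q lies between exp(- q / (1 - q)) and exp(- q). *)
Lemma cvg_1BM (q : nat -> R) (l : R) : (forall n, 0 <= q n) ->
  (fun n => n%:R * q n) @ \oo --> l -> (fun n => (1 - q n) ^+ n) @ \oo --> expR (- l).
Proof.
move=> q0 ql.
have nV : (fun n => n%:R^-1 : R) @ \oo --> (0 : R).
  by apply/gtr0_cvgV0; [exists 1%N => // n /= n0; rewrite ltr0n|exact: cvgr_idn].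
have qc : q @ \oo --> (0 : R).
  have : (fun n => n%:R^-1 * (n%:R * q n)) @ \oo --> 0 * l by exact: cvgM.
  rewrite mul0r; apply: cvg_trans; apply: near_eq_cvg; near=> n.
  by rewrite mulKf// pnatr_eq0 -lt0n; near: n; exists 1%N.
have uc : (fun n => expR (- (n%:R * q n))) @ \oo --> expR (- l).
  by apply: continuous_cvg; [exact: continuous_expR|exact: cvgN].
have lc : (fun n => expR (- (n%:R * q n * (1 - q n)^-1))) @ \oo --> expR (- l).
  apply: continuous_cvg; first exact: continuous_expR.
  have : (fun n => n%:R * q n * (1 - q n)^-1) @ \oo --> l * 1^-1.
    apply: cvgM => //; apply: cvgV; first exact: oner_neq0.
    by rewrite -[X in _ --> X]subr0; apply: cvgB => //; exact: cvg_cst.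
  by rewrite invr1 mulr1 => H; exact: cvgN.
apply: squeeze_cvgr lc uc; near=> n.
have q1 : q n < 1 by near: n; apply: (cvgr_lt 0 qc); exact: ltr01.
have s0 : 0 < 1 - q n by rewrite subr_gt0.
have -> : expR (- (n%:R * q n / (1 - q n))) = expR (- (q n / (1 - q n))) ^+ n.
  by rewrite -expRM_natr; congr expR; ring.
have -> : expR (- (n%:R * q n)) = expR (- q n) ^+ n.
  by rewrite -expRM_natr; congr expR; ring.
apply/andP; split.
  rewrite lerXn2r ?nnegrE ?expR_ge0 ?(ltW s0)//.
  rewrite expRN -[leRHS]invrK lef_pV2 ?posrE ?expR_gt0 ?invr_gt0//.
  apply: le_trans (expR_ge1Dx _); rewrite le_eqVlt; apply/orP; left; apply/eqP.
  by field; rewrite gt_eqF.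
by rewrite lerXn2r ?nnegrE ?expR_ge0 ?(ltW s0)//; exact: expR_ge1Dx.
Unshelve. all: by end_near.
Qed.

(* [cdfU n u] is the distribution function of [c n * (N - d n)] for a standard normal [N], and [top2 n u v] the probability that, among [n] independent copies, the largest is at most [u] and the second largest at most [v]. *)
Definition cdfU n (u : R) : R := 1 - gtail (d n + u / c n).

Definition top2 n (u v : R) : R :=
  cdfU n (Num.min u v) ^+ n +
  n%:R * ((cdfU n u - cdfU n (Num.min u v)) * cdfU n (Num.min u v) ^+ n.-1).

(** Joint distribution function of the two highest points of the Poisson process with intensity
    e^{-x} dx: with m the minimum, either no point lies above m, or exactly one lies in (m, u] and
    none above u. *)
Definition top2_lim (u v : R) : R :=
  expR (- expR (- Num.min u v)) * (1 + expR (- Num.min u v) - expR (- u)).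

Lemma cvg_cdfU_exp u : (fun n => cdfU n u ^+ n) @ \oo --> expR (- expR (- u)).
Proof. by apply: cvg_1BM; [move=> n; exact: gtail_ge0|exact: cvg_level_tail]. Qed.

Lemma cvg_cdfU u : (fun n => cdfU n u) @ \oo --> (1 : R).
Proof.
have nV : (fun n => n%:R^-1 : R) @ \oo --> (0 : R).
  by apply/gtr0_cvgV0; [exists 1%N => // n /= n0; rewrite ltr0n|exact: cvgr_idn].
have : (fun n => 1 - n%:R^-1 * (n%:R * gtail (d n + u / c n))) @ \oo --> 1 - 0 * expR (- u).
  by apply: cvgB; [exact: cvg_cst|apply: cvgM => //; exact: cvg_level_tail].
rewrite mul0r subr0; apply: cvg_trans; apply: near_eq_cvg; near=> n.
by rewrite mulKf// pnatr_eq0 -lt0n; near: n; exists 1%N.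
Unshelve. all: by end_near.
Qed.

Lemma cvg_top2 u v : (fun n => top2 n u v) @ \oo --> top2_lim u v.
Proof.
set m := Num.min u v.
(* The power [n.-1] is rewritten as the power [n] divided by [cdfU n m], which tends to 1. *)
have : (fun n => cdfU n m ^+ n + (n%:R * gtail (d n + m / c n) - n%:R * gtail (d n + u / c n)) *
   (cdfU n m ^+ n * (cdfU n m)^-1)) @ \oo -->
   expR (- expR (- m)) + (expR (- m) - expR (- u)) * (expR (- expR (- m)) * 1^-1).
  apply: cvgD; first exact: cvg_cdfU_exp.
  apply: cvgM; first by apply: cvgB; exact: cvg_level_tail.
  apply: cvgM; first exact: cvg_cdfU_exp.
  by apply: cvgV; [exact: oner_neq0|exact: cvg_cdfU].
have -> : expR (- expR (- m)) + (expR (- m) - expR (- u)) * (expR (- expR (- m)) * 1^-1) =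
  top2_lim u v by rewrite /top2_lim -/m; field.
apply: cvg_trans; apply: near_eq_cvg; near=> n.
have n0 : (0 < n)%N by near: n; exists 1%N.
have U0 : 0 < cdfU n m by near: n; apply: (cvgr_gt 1 (cvg_cdfU m)); exact: ltr01.
rewrite /top2 -/m; congr (_ + _).
have -> : cdfU n m ^+ n * (cdfU n m)^-1 = cdfU n m ^+ n.-1.
  have E x : x != 0 -> x ^+ n / x = x ^+ n.-1 :> R.
    by move=> x0; rewrite -{1}(prednK n0) exprSr mulfK.
  by rewrite E// gt_eqF.
by rewrite /cdfU; ring.
Unshelve. all: by end_near.
Qed.
End extreme_asymptotics.

(** * Convergence of the law of a sum *)

Section real_probability.
Context {d : measure_display} {T : measurableType d} {R : realType}.
Variable P : probability T R.
Implicit Types A B : set T.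

Definition pr A : R := fine (P A).

Lemma EFin_pr A : measurable A -> (pr A)%:E = P A.
Proof. by move=> mA; rewrite fineK// fin_num_measure. Qed.

Lemma pr_ge0 A : 0 <= pr A. Proof. by apply: fine_ge0; exact: measure_ge0. Qed.

Lemma prT : pr setT = 1. Proof. by rewrite /pr (@probability_setT _ _ _ P). Qed.

Lemma pr_le A B : measurable A -> measurable B -> A `<=` B -> pr A <= pr B.
Proof.
by move=> mA mB AB; rewrite -lee_fin !EFin_pr// le_measure// inE.
Qed.

Lemma prU_le A B : measurable A -> measurable B -> pr (A `|` B) <= pr A + pr B.
Proof.
move=> mA mB; rewrite -lee_fin EFinD !EFin_pr//; last exact: measurableU.
exact: measureU2.
Qed.

Lemma prD A B : measurable A -> measurable B -> B `<=` A ->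
  pr (A `\` B) = pr A - pr B.
Proof.
move=> mA mB BA; apply/eqP; rewrite -eqe EFinB !EFin_pr//; last exact: measurableD.
by rewrite measureD ?setIidr// -ge0_fin_numE// fin_num_measure.
Qed.

Lemma prC A : measurable A -> pr (~` A) = 1 - pr A.
Proof. by move=> mA; rewrite -setTD prD// prT. Qed.

Lemma pr_indic A : measurable A -> \int[P]_x \1_A x = pr A.
Proof. by move=> mA; rewrite Rint_indic. Qed.

End real_probability.

Section strips.
Context {R : realType}.

(** Mass of a staircase inscribed in the half-plane a + b <= s: over each strip of width [h] in the
    first coordinate, the second is held below the line at the right end of the strip. *)
Definition strip_lo (Q : R -> R -> R) (a0 h : R) N s : R :=
  \sum_(k < N) (Q (a0 + k.+1%:R * h) (s - (a0 + k.+1%:R * h)) -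
                Q (a0 + k%:R * h) (s - (a0 + k.+1%:R * h))).

(** Raising the level by one strip width turns the inscribed staircase into the circumscribed one,
    so a single sum serves for both bounds. *)
Lemma strip_lo_shift Q a0 h N s : strip_lo Q a0 h N (s + h) =
  \sum_(k < N) (Q (a0 + k.+1%:R * h) (s - (a0 + k%:R * h)) -
                Q (a0 + k%:R * h) (s - (a0 + k%:R * h))).
Proof.
apply: eq_bigr => k _.
have -> : s + h - (a0 + k.+1%:R * h) = s - (a0 + k%:R * h) by rewrite -natr1; ring.
by [].
Qed.

(* [S], [M] and [Q] behave like the distribution functions of [A + B], [A] and [(A, B)]. *)
Definition strip_bounds (S M : R -> R) (Q : R -> R -> R) :=
  forall a0 h N s, 0 <= h ->
    strip_lo Q a0 h N s <= S s <=
      M a0 + (1 - M (a0 + N%:R * h)) + strip_lo Q a0 h N (s + h).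

Section strips_probability.
Context {d : measure_display} {T : measurableType d} (P : probability T R).
Variables A B : T -> R.
Hypotheses (mA : measurable_fun setT A) (mB : measurable_fun setT B).
Let Q u v := pr P [set w | A w <= u /\ B w <= v].

Lemma measurable_le_cst (f : T -> R) (u : R) : measurable_fun setT f ->
  measurable [set w | f w <= u].
Proof.
move=> mf; rewrite -[X in measurable X]setTI.
have -> : [set w | f w <= u] = f @^-1` `]-oo, u]%classic.
  by apply/seteqP; split => w /=; rewrite in_itv.
exact: mf.
Qed.

(** On the strip a < A <= a', the event B <= s - a' implies A + B <= s, which implies B <= s - a. *)
Lemma strips_itv a0 h N s : 0 <= h ->
  strip_lo Q a0 h N s <=
  pr P [set w | A w <= a0 + N%:R * h /\ A w + B w <= s] -
  pr P [set w | A w <= a0 /\ A w + B w <= s] <=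
  strip_lo Q a0 h N (s + h).
Proof.
move=> h0.
have mAB : measurable_fun setT (fun w => A w + B w) by exact: measurable_funD.
have mI (f g : T -> R) u v : measurable_fun setT f -> measurable_fun setT g ->
    measurable [set w | f w <= u /\ g w <= v].
  by move=> mf mg; apply: measurableI; exact: measurable_le_cst.
pose f x := pr P [set w | A w <= x /\ A w + B w <= s].
have strip a a' : a <= a' ->
    Q a' (s - a') - Q a (s - a') <= f a' - f a <= Q a' (s - a) - Q a (s - a).
  move=> aa'; rewrite -!prD; try (exact: mI); try (by move=> w [wa wb]; split => //; exact: le_trans aa').
  apply/andP; split; apply: pr_le; try (apply: measurableD; exact: mI).
    move=> w [[wa wb] nw]; split; first by split => //=; lra.
    by move=> [wa2 _]; apply: nw; split.
  move=> w [[wa wb] nw]; split.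
    split => //=; have : a < A w by rewrite ltNge; apply/negP => wa2; apply: nw; split.
    move=> aw; lra.
  by move=> [wa2 _]; apply: nw; split.
rewrite strip_lo_shift.
have -> : pr P [set w | A w <= a0 + N%:R * h /\ A w + B w <= s] -
   pr P [set w | A w <= a0 /\ A w + B w <= s] =
   \sum_(k < N) (f (a0 + k.+1%:R * h) - f (a0 + k%:R * h)).
  rewrite -(big_mkord xpredT (fun k => f (a0 + k.+1%:R * h) - f (a0 + k%:R * h))).
  rewrite (telescope_sumr (fun k => f (a0 + k%:R * h)))//.
  by rewrite mul0r addr0.
have st k : a0 + k%:R * h <= a0 + k.+1%:R * h by rewrite lerD2l ler_wpM2r// ler_nat.
apply/andP; split; apply: ler_sum => k _; by have /andP[] := strip _ _ (st k).
Qed.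

Lemma strip_bounds_pr :
  strip_bounds (fun s => pr P [set w | A w + B w <= s])
    (fun u => pr P [set w | A w <= u]) Q.
Proof.
move=> a0 h N s h0.
have mAB : measurable_fun setT (fun w => A w + B w) by exact: measurable_funD.
have mI u : measurable [set w | A w <= u /\ A w + B w <= s].
  by apply: measurableI; exact: measurable_le_cst.
have /andP[H1 H2] := @strips_itv a0 h N s h0.
have ml u : measurable [set w | A w <= u] by exact: measurable_le_cst.
have mls : measurable [set w | A w + B w <= s] by exact: measurable_le_cst.
apply/andP; split.
  apply: (le_trans H1).
  apply: (@le_trans _ _ (pr P [set w | A w <= a0 + N%:R * h /\ A w + B w <= s])).
    by rewrite gerBl pr_ge0.
  by apply: pr_le => // w [].
have K : pr P [set w | A w + B w <= s] <=
    pr P [set w | A w <= a0 + N%:R * h /\ A w + B w <= s] + pr P (~` [set w | A w <= a0 + N%:R * h]).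
  apply: (@le_trans _ _ (pr P ([set w | A w <= a0 + N%:R * h /\ A w + B w <= s] `|`
     (~` [set w | A w <= a0 + N%:R * h])))).
    apply: pr_le => //; first by apply: measurableU => //; exact: measurableC.
    move=> w ws; have [wa|wa] := pselect (A w <= a0 + N%:R * h); first by left.
    by right.
  by apply: prU_le => //; exact: measurableC.
have K2 : pr P [set w | A w <= a0 /\ A w + B w <= s] <= pr P [set w | A w <= a0].
  by apply: pr_le => // w [].
rewrite prC// in K.
lra.
Qed.
End strips_probability.

(** Outside [K1, K2] the limit has little mass, and inside only finitely many strips matter, so
    pointwise convergence of [Q] suffices. The outer staircase at [s] is the inner one at [s + h],
    which the limit compares with S0 (s + h), and symmetrically below. The loss [h] in the argument
    stands in for continuity of [S0]. *)
Lemma strip_portmanteau (S M : nat -> R -> R) (Q : nat -> R -> R -> R)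
  (S0 M0 : R -> R) (Q0 : R -> R -> R) :
  (\forall n \near \oo, strip_bounds (S n) (M n) (Q n)) -> strip_bounds S0 M0 Q0 ->
  (forall u v, (fun n => Q n u v) @ \oo --> Q0 u v) ->
  (forall u, (fun n => M n u) @ \oo --> M0 u) ->
  M0 u @[u --> -oo] --> (0 : R) -> M0 u @[u --> +oo] --> (1 : R) ->
  forall s h e, 0 < h -> 0 < e -> \forall n \near \oo,
    S0 (s - h) - e <= S n s <= S0 (s + h) + e.
Proof.
move=> bS bS0 QQ MM M0Ny M0y s h e h0 e0.
have [K1 HK1] : exists K1, forall u, u <= K1 -> M0 u < e / 4.
  have : \forall u \near -oo, M0 u < e / 4 by apply: (cvgr_lt 0 M0Ny); lra.
  by move=> [K1 [_ HK]]; exists (K1 - 1) => u uK; apply: HK; lra.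
have [K2 HK2] : exists K2, forall u, K2 <= u -> 1 - M0 u < e / 4.
  have : \forall u \near +oo, 1 - e / 4 < M0 u by apply: (cvgr_gt 1 M0y); lra.
  by move=> [K2 [_ HK]]; exists (K2 + 1) => u uK; have := HK u; lra.
(* Enough strips of width [h] to lead from [K1] beyond [K2]. *)
pose N := (Num.bound `|(K2 - K1) / h|).+1.
have aN : K2 <= K1 + N%:R * h.
  have : (K2 - K1) / h <= N%:R.
    apply: (le_trans (ler_norm _)); apply: ltW; apply: (lt_trans (archi_boundP _)) => //.
    by rewrite ltr_nat.
  by rewrite ler_pdivrMr//; lra.
have cs t : (fun n => strip_lo (Q n) K1 h N t) @ \oo --> strip_lo Q0 K1 h N t.
  rewrite /strip_lo; elim: N {aN} => [|N IH].
    by under eq_cvg do rewrite big_ord0; rewrite big_ord0; exact: cvg_cst.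
  under eq_cvg do rewrite big_ord_recr/=.
  by rewrite big_ord_recr/=; apply: cvgD; [exact: IH|apply: cvgB; exact: QQ].
have cM : (fun n => M n K1 + (1 - M n (K1 + N%:R * h))) @ \oo -->
    M0 K1 + (1 - M0 (K1 + N%:R * h)).
  by apply: cvgD => //; apply: cvgB => //; exact: cvg_cst.
have eps : M0 K1 + (1 - M0 (K1 + N%:R * h)) < e / 2.
  have := HK1 K1 (lexx _); have := HK2 _ aN; lra.
have n1 : \forall n \near \oo, strip_lo Q0 K1 h N s - e / 4 < strip_lo (Q n) K1 h N s.
  by apply: (cvgr_gt _ (cs s)); lra.
have n2 : \forall n \near \oo, strip_lo (Q n) K1 h N (s + h) < strip_lo Q0 K1 h N (s + h) + e / 4.
  by apply: (cvgr_lt _ (cs (s + h))); lra.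
have n3 : \forall n \near \oo, M n K1 + (1 - M n (K1 + N%:R * h)) < e / 2.
  by apply: (cvgr_lt _ cM).
near=> n.
have b : strip_bounds (S n) (M n) (Q n) by near: n.
have b1 := b K1 h N s (ltW h0).
have l1 : strip_lo Q0 K1 h N s - e / 4 < strip_lo (Q n) K1 h N s by near: n.
have l2 : strip_lo (Q n) K1 h N (s + h) < strip_lo Q0 K1 h N (s + h) + e / 4 by near: n.
have l3 : M n K1 + (1 - M n (K1 + N%:R * h)) < e / 2 by near: n.
have := bS0 K1 h N (s - h) (ltW h0); rewrite subrK => b2.
have b3 := bS0 K1 h N (s + h) (ltW h0).
move/andP: b1 => [b1 b1']; move/andP: b2 => [_ b2']; move/andP: b3 => [b3 _].
apply/andP; split; lra.
Unshelve. all: by end_near.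
Qed.
End strips.

(** * Two independent exponential variables *)

Section exponential.
Context {d : measure_display} {T : measurableType d} {R : realType}.
Variable P : probability T R.

Lemma exponential_tail (X : T -> R) (t : R) : std_exponential P X -> 0 <= t ->
  pr P [set w | t <= X w] = expR (- t).
Proof.
move=> [mX XP] t0.
have -> : [set w | t <= X w] = X @^-1` `[t, +oo[%classic.
  by apply/seteqP; split => w /=; rewrite in_itv/= andbT.
rewrite /pr XP// /exponential_prob.
have -> : (\int[lebesgue_measure]_(x in `[t, +oo[) (exponential_pdf 1 x)%:E =
    \int[lebesgue_measure]_(x in `[t, +oo[) (expR (- x))%:E)%E.
  apply: eq_integral => x; rewrite inE/= in_itv/= andbT => tx; congr EFin.
  by rewrite exponential_pdfE ?(le_trans t0)// mul1r mulN1r.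
have dF (x : R) : is_derive x (1 : R) (fun x => - expR (- x)) (expR (- x)).
  apply: trigger_derive; rewrite /GRing.scale/=; ring.
have cE (x : R) : {for x, continuous (fun x : R => expR (- x))}.
  by apply: (@cvg_comp _ _ _ -%R expR); [apply: cvgN; exact: cvg_id|exact: continuous_expR].
rewrite (@ge0_continuous_FTC2y _ _ (fun x => - expR (- x)) t 0).
- by rewrite -EFinB sub0r opprK.
- by move=> x _; exact: expR_ge0.
- by apply: continuous_subspaceT => x; exact: cE.
- by rewrite -[X in _ --> X]oppr0; apply: cvgN; exact: cvgr_expR.
- by move=> x _; exact: ex_derive.
- by apply: cvg_at_right_filter; apply: cvgN; exact: cE.
- by move=> x _; rewrite derive1E; exact: derive_val.
Qed.

Variables zeta1 zeta2 : T -> R.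
Hypotheses (z1 : std_exponential P zeta1) (z2 : std_exponential P zeta2).
Hypothesis z12 : indep2 P zeta1 zeta2.
Let mz1 : measurable_fun setT zeta1. Proof. by case: z1. Qed.
Let mz2 : measurable_fun setT zeta2. Proof. by case: z2. Qed.


(** The logarithm takes a default value at nonpositive arguments, so events expressed through it are
    compared only off this negligible set. *)
Let null : set T := [set w | zeta1 w <= 0] `|` [set w | zeta2 w <= 0].

Lemma exponential_null (X : T -> R) : std_exponential P X -> pr P [set w | X w <= 0] = 0.
Proof.
move=> eX; have mX : measurable_fun setT X by case: eX.
apply/eqP; rewrite eq_le pr_ge0 andbT.
apply/ler_addgt0Pl => e e0; rewrite addr0.
have ge t : measurable [set w | t <= X w].
  have -> : [set w | t <= X w] = X @^-1` `[t, +oo[%classic.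
    by apply/seteqP; split => w /=; rewrite in_itv/= andbT.
  by rewrite -[X in measurable X]setTI; exact: mX.
apply: (@le_trans _ _ (pr P (~` [set w | e <= X w]))).
  apply: pr_le; [exact: measurable_le_cst|exact: measurableC|].
  by move=> w /= w0; apply/negP; rewrite -ltNge (le_lt_trans w0).
rewrite prC// exponential_tail ?(ltW e0)//.
have := expR_ge1Dx (- e); lra.
Qed.

Lemma measurable_null : measurable null.
Proof. by apply: measurableU; exact: measurable_le_cst. Qed.

Lemma pr_null : pr P null = 0.
Proof.
apply/eqP; rewrite eq_le pr_ge0 andbT.
apply: (le_trans (prU_le P _ _)); try exact: measurable_le_cst.
by rewrite !exponential_null// addr0.
Qed.

Lemma eq_pr_null (A B : set T) : measurable A -> measurable B ->
  (forall w, 0 < zeta1 w -> 0 < zeta2 w -> A w <-> B w) -> pr P A = pr P B.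
Proof.
move=> mA mB AB.
have key (A' B' : set T) : measurable A' -> measurable B' ->
    (forall w, 0 < zeta1 w -> 0 < zeta2 w -> A' w -> B' w) -> pr P A' <= pr P B'.
  move=> mA' mB' AB'; rewrite -[leRHS]addr0 -pr_null.
  apply: (@le_trans _ _ (pr P (B' `|` null))); last by apply: prU_le => //; exact: measurable_null.
  apply: pr_le => //; first by apply: measurableU => //; exact: measurable_null.
  move=> w Aw; have [w1|w1] := ltP 0 (zeta1 w); last by right; left.
  have [w2|w2] := ltP 0 (zeta2 w); last by right; right.
  by left; exact: AB'.
by apply/eqP; rewrite eq_le !key// => w w1 w2 /AB; apply.
Qed.

Let Q u v := pr P [set w | - zeta1 w <= u /\ - zeta2 w <= v].

Lemma exponential_joint u v : u <= 0 -> v <= 0 -> Q u v = expR u * expR v.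
Proof.
move=> u0 v0; rewrite /Q /pr.
have -> : [set w | - zeta1 w <= u /\ - zeta2 w <= v] =
    zeta1 @^-1` `[- u, +oo[%classic `&` zeta2 @^-1` `[- v, +oo[%classic.
  by apply/seteqP; split => w /=; rewrite !in_itv/= !andbT lerNl (lerNl v).
have E (X : T -> R) t : std_exponential P X -> t <= 0 -> P (X @^-1` `[- t, +oo[%classic) = (expR t)%:E.
  move=> eX t0; have mX : measurable_fun setT X by case: eX.
  have <- : [set w | - t <= X w] = X @^-1` `[- t, +oo[%classic.
    by apply/seteqP; split => w /=; rewrite in_itv/= andbT.
  rewrite -EFin_pr; first by rewrite exponential_tail ?opprK// oppr_ge0.
  have -> : [set w | - t <= X w] = [set w | - X w <= t].
    by apply/seteqP; split => w /=; rewrite lerNl.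
  by apply: measurable_le_cst; exact: measurableT_comp.
by rewrite z12// !E.
Qed.

(** The part be <= zeta1 contributes exp(- be). The rest is cut into strips of zeta1 between [al]
    and [be]; the bounds on their masses are the same for each strip, and letting the number of
    strips grow gives exp(- be) (be - al), without an integral over a product space. Signs are
    reversed since the strips are stated for upper bounds. *)
Lemma exponential_sum (al be : R) : 0 < al -> al <= be ->
  pr P [set w | al <= zeta1 w /\ be <= zeta1 w + zeta2 w] = expR (- be) * (1 + be - al).
Proof.
move=> al0 albe.
have mN1 : measurable_fun setT (fun w => - zeta1 w) by exact: measurableT_comp.
have mN2 : measurable_fun setT (fun w => - zeta2 w) by exact: measurableT_comp.
have mN : measurable_fun setT (fun w => - zeta1 w + - zeta2 w) by exact: measurable_funD.
have mI u s : measurable [set w | - zeta1 w <= u /\ - zeta1 w + - zeta2 w <= s].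
  by apply: measurableI; exact: measurable_le_cst.
have -> : [set w | al <= zeta1 w /\ be <= zeta1 w + zeta2 w] =
    [set w | - zeta1 w <= - al /\ - zeta1 w + - zeta2 w <= - be].
  by apply/seteqP; split => w /=; rewrite -opprD !lerN2.
(* Where zeta1 >= be, the condition on the sum holds as soon as zeta2 is positive. *)
have e1 : pr P [set w | - zeta1 w <= - be /\ - zeta1 w + - zeta2 w <= - be] = expR (- be).
  rewrite -(exponential_tail z1); last lra.
  apply: eq_pr_null => //.
    have -> : [set w | be <= zeta1 w] = [set w | - zeta1 w <= - be].
      by apply/seteqP; split => w /=; rewrite lerN2.
    exact: measurable_le_cst.
  by move=> w w1 w2 /=; split; [move=> []; lra|move=> H; split; lra].
set p := pr P _.
have bound N : expR (- be) * (N.+1%:R * (1 - expR (- ((be - al) / N.+1%:R)))) <= p - expR (- be)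
      <= expR (- be) * (N.+1%:R * (expR ((be - al) / N.+1%:R) - 1)).
  pose h := (be - al) / N.+1%:R.
  have h0 : 0 <= h by rewrite divr_ge0// subr_ge0.
  have Nh : - be + N.+1%:R * h = - al by rewrite /h mulrC divfK ?pnatr_eq0//; ring.
  have kh (k : 'I_N.+1) : - be + k.+1%:R * h <= - al.
    by rewrite -Nh lerD2l ler_wpM2r// ler_nat.
  have kh' (k : 'I_N.+1) : 0 <= k%:R * h by rewrite mulr_ge0.
  have kh2 (k : 'I_N.+1) : k.+1%:R * h = k%:R * h + h by rewrite -natr1; ring.
  have := @strips_itv _ _ _ P _ _ mN1 mN2 (- be) h N.+1 (- be) h0.
  rewrite Nh e1 -/p.
  have -> : strip_lo (fun u v => pr P [set w | - zeta1 w <= u /\ - zeta2 w <= v]) (- be) h N.+1 (- be) =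
     expR (- be) * (N.+1%:R * (1 - expR (- h))).
    transitivity (\sum_(k < N.+1) (expR (- be) * (1 - expR (- h)))); last first.
      by rewrite sumr_const card_ord -mulr_natl; ring.
    apply: eq_bigr => k _; have := kh k; have := kh' k; rewrite kh2 => k1 k2.
    rewrite -!/(Q _ _) !exponential_joint; try lra.
    rewrite -!expRD mulrBr mulr1 -expRD; congr (expR _ - expR _); ring.
  rewrite strip_lo_shift.
  have -> : \sum_(k < N.+1) (pr P [set w | - zeta1 w <= - be + k.+1%:R * h /\ - zeta2 w <= - be - (- be + k%:R * h)] -
      pr P [set w | - zeta1 w <= - be + k%:R * h /\ - zeta2 w <= - be - (- be + k%:R * h)]) =
     expR (- be) * (N.+1%:R * (expR h - 1)).
    transitivity (\sum_(k < N.+1) (expR (- be) * (expR h - 1))); last first.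
      by rewrite sumr_const card_ord -mulr_natl; ring.
    apply: eq_bigr => k _; have := kh k; have := kh' k; rewrite kh2 => k1 k2.
    rewrite -!/(Q _ _) !exponential_joint; try lra.
    rewrite -!expRD mulrBr mulr1 -expRD; congr (expR _ - expR _); ring.
  by [].
pose x N := (be - al) / N.+1%:R.
have xN N : N.+1%:R * x N = be - al by rewrite mulrC divfK ?pnatr_eq0.
have xc : x @ \oo --> (0 : R).
  rewrite -[X in _ --> X](mulr0 (be - al)); apply: cvgM; first exact: cvg_cst.
  exact: cvg_harmonic.
have x0 N : 0 <= x N by rewrite divr_ge0// subr_ge0.
have lim : (fun N => expR (- be) * ((be - al) * expR (x N))) @ \oo --> expR (- be) * (be - al).
  rewrite (_ : expR (- be) * (be - al) = expR (- be) * ((be - al) * expR 0)); last by rewrite expR0 mulr1.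
  apply: cvgM; first exact: cvg_cst; apply: cvgM; first exact: cvg_cst.
  by apply: continuous_cvg; first exact: continuous_expR.
have lim2 : (fun N => expR (- be) * ((be - al) * expR (- x N))) @ \oo --> expR (- be) * (be - al).
  rewrite (_ : expR (- be) * (be - al) = expR (- be) * ((be - al) * expR (- 0))); last by rewrite oppr0 expR0 mulr1.
  apply: cvgM; first exact: cvg_cst; apply: cvgM; first exact: cvg_cst.
  apply: continuous_cvg; first exact: continuous_expR.
  exact: cvgN.
have E1 N : expR (x N) * expR (- x N) = 1 by rewrite -expRD subrr expR0.
have E2 N : 1 - x N <= expR (- x N) by exact: expR_ge1Dx.
have E3 N : 1 + x N <= expR (x N) by exact: expR_ge1Dx.
have : (fun _ : nat => p - expR (- be)) @ \oo --> expR (- be) * (be - al).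
  apply: squeeze_cvgr lim2 lim; apply: nearW => N.
  have /andP[] := bound N; rewrite -/(x N) => b1 b2; apply/andP; split.
    apply: le_trans b1; rewrite ler_wpM2l ?expR_ge0// -(xN N) -mulrA ler_wpM2l//.
    have := E1 N; have := E3 N; have := expR_gt0 (- x N); nra.
  apply: (le_trans b2); rewrite ler_wpM2l ?expR_ge0// -(xN N) -mulrA ler_wpM2l//.
  have := E1 N; have := E2 N; have := expR_gt0 (x N); nra.
move=> /cvg_lim; rewrite lim_cst// => H.
have {}H := H (@Rhausdorff R).
have -> : expR (- be) * (1 + be - al) = expR (- be) * (be - al) + expR (- be) by ring.
by rewrite -H subrK.
Qed.
End exponential.

(** * Decomposition of the field *)

Section pair_sums.
Context {R : realType} (n : nat).
Implicit Types (a b : 'I_n -> 'I_n -> R) (x y : 'I_n -> R).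

Definition psum (F : 'I_n -> 'I_n -> R) : R :=
  \sum_(i < n) \sum_(j < n | (i < j)%N) F i j.

Lemma psumE F : psum F = \sum_(q : 'I_n * 'I_n | (q.1 < q.2)%N) F q.1 q.2.
Proof. by rewrite /psum pair_big_dep. Qed.

Lemma eq_psum F H : (forall i j : 'I_n, (i < j)%N -> F i j = H i j) -> psum F = psum H.
Proof. by move=> FH; apply: eq_bigr => i _; apply: eq_bigr => j; exact: FH. Qed.

Lemma psum_sym F : psum (fun i j => F i j + F j i) =
  \sum_i \sum_j F i j - \sum_i F i i.
Proof.
rewrite /psum; under eq_bigr do rewrite big_split/=.
rewrite big_split/= [X in _ + X](exchange_big_dep xpredT)//=.
rewrite -big_split/= -sumrB; apply: eq_bigr => i _.
rewrite [in RHS](bigD1 i)//= addrAC subrr add0r.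
rewrite [RHS](bigID (fun j : 'I_n => (i < j)%N))/=; congr (_ + _).
  by apply: eq_bigl => j; rewrite andb_idl// => ij; rewrite neq_ltn ij orbT.
by apply: eq_bigl => j; rewrite -leqNgt ltn_neqAle.
Qed.

Definition row (m : 'I_n) a : R := psum (fun i j => ((m == i)%:R + (m == j)%:R) * a i j).

Lemma sum_eqM (m : 'I_n) x : \sum_i (m == i)%:R * x i = x m.
Proof.
rewrite (bigD1 m)//= eqxx mul1r big1 ?addr0// => i.
by rewrite eq_sym => /negbTE ->; rewrite mul0r.
Qed.

Lemma sum_eqMr (m : 'I_n) x : \sum_i (i == m)%:R * x i = x m.
Proof. by rewrite -(sum_eqM m x); apply: eq_bigr => i _; rewrite eq_sym. Qed.

(** These coefficients form a space on which the covariance is a combination of the identity and the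
    all-ones matrix; the Y_i are sought there. *)
Definition vcoef x : 'I_n -> 'I_n -> R := fun i j => x i + x j.

Definition dcoef (k l : 'I_n) : 'I_n -> 'I_n -> R := fun i j => ((k == i) && (l == j))%:R.

Lemma psum_dcoef (k l : 'I_n) F : (k < l)%N -> psum (fun i j => dcoef k l i j * F i j) = F k l.
Proof.
move=> kl; rewrite psumE (bigD1 (k, l))//= /dcoef !eqxx mul1r big1 ?addr0// => -[i j] /=.
rewrite xpair_eqE => /andP[_]; rewrite (eq_sym i) (eq_sym j).
by move=> /negbTE ->; rewrite mul0r.
Qed.

Lemma row_vcoef m x : row m (vcoef x) = (n%:R - 2) * x m + \sum_i x i.
Proof.
rewrite /row /vcoef.
rewrite (eq_psum (H := fun i j => (m == i)%:R * (x i + x j) + (m == j)%:R * (x j + x i))); last first.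
  by move=> i j _; ring.
rewrite (psum_sym (fun i j => (m == i)%:R * (x i + x j))).
under eq_bigr do rewrite -mulr_sumr big_split/= sumr_const card_ord.
rewrite !sum_eqM -mulr_natl; ring.
Qed.

Lemma psum_vcoef a y : psum (fun i j => a i j * vcoef y i j) = \sum_m y m * row m a.
Proof.
rewrite /row psumE; under [RHS]eq_bigr do rewrite psumE mulr_sumr.
rewrite exchange_big/=; apply: eq_bigr => q _.
transitivity (a q.1 q.2 * (\sum_i (i == q.1)%:R * y i + \sum_i (i == q.2)%:R * y i)).
  by rewrite !sum_eqMr.
by rewrite -big_split/= mulr_sumr; apply: eq_bigr => m _; ring.
Qed.

Lemma row_dcoef m (k l : 'I_n) : (k < l)%N -> row m (dcoef k l) = (m == k)%:R + (m == l)%:R.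
Proof.
move=> kl; rewrite /row.
rewrite (eq_psum (H := fun i j => dcoef k l i j * ((m == i)%:R + (m == j)%:R))) ?psum_dcoef//.
by move=> i j _; rewrite mulrC.
Qed.

Variable r : R.

(** The covariance of the combinations of the field with coefficients [a] and [b], as [lin_cov]
    shows: [r] times a Gram matrix of incidence vectors plus 1 - 2 r times the identity. *)
Definition Qf a b : R := r * \sum_m (row m a * row m b) +
  (1 - 2 * r) * psum (fun i j => a i j * b i j).

Lemma QfC a b : Qf a b = Qf b a.
Proof.
rewrite /Qf; congr (_ * _ + _ * _); first by apply: eq_bigr => m _; rewrite mulrC.
by apply: eq_psum => i j _; rewrite mulrC.
Qed.

Lemma Qf_suml (I : Type) (s : seq I) (c : I -> R) (A : I -> 'I_n -> 'I_n -> R) b :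
  Qf (fun i j => \sum_(k <- s) c k * A k i j) b = \sum_(k <- s) c k * Qf (A k) b.
Proof.
have rowE m : row m (fun i j => \sum_(k <- s) c k * A k i j) = \sum_(k <- s) c k * row m (A k).
  rewrite /row psumE; under [RHS]eq_bigr do rewrite psumE mulr_sumr.
  rewrite exchange_big/=; apply: eq_bigr => q _; rewrite mulr_sumr.
  by apply: eq_bigr => k _; ring.
rewrite /Qf; under eq_bigr do rewrite rowE mulr_suml.
rewrite exchange_big/= psumE; under [X in _ + _ * X]eq_bigr do rewrite mulr_suml.
rewrite [X in _ + _ * X]exchange_big/= !mulr_sumr -big_split/=.
apply: eq_bigr => k _; rewrite psumE mulrDr mulrCA [in RHS]mulrCA; congr (_ + _).
  by rewrite mulrCA; congr (_ * _); rewrite mulr_sumr; apply: eq_bigr => m _; ring.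
rewrite [RHS]mulrCA; congr (_ * _); rewrite mulr_sumr; apply: eq_bigr => q _; ring.
Qed.

(** Pythagoras for the covariance form: it supplies the variance in the joint cosine transform. *)
Lemma Qf_orthogonal (I : eqType) (s : seq I) (c v : I -> R) (A : I -> 'I_n -> 'I_n -> R) :
  uniq s -> (forall k l, k \in s -> l \in s -> Qf (A k) (A l) = if k == l then v k else 0) ->
  Qf (fun i j => \sum_(k <- s) c k * A k i j) (fun i j => \sum_(k <- s) c k * A k i j) =
  \sum_(k <- s) c k ^+ 2 * v k.
Proof.
move=> us QA; rewrite Qf_suml; apply: eq_big_seq => k ks.
rewrite QfC Qf_suml (bigD1_seq k)//= QA// eqxx big_seq_cond big1 ?addr0; first by ring.
by move=> l /andP[ls lk]; rewrite QA// (negbTE lk) mulr0.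
Qed.

Local Notation lam := (r * (n%:R - 2) + (1 - 2 * r)).

Lemma Qf_vcoefr a y : Qf a (vcoef y) = \sum_m row m a * (lam * y m + r * \sum_i y i).
Proof.
rewrite /Qf psum_vcoef.
have rE m := row_vcoef m y; move: rE; move: (\sum_i y i) => Y rE.
by rewrite !mulr_sumr -big_split/=; apply: eq_bigr => m _; rewrite rE; ring.
Qed.

Lemma Qf_vcoef x y : Qf (vcoef x) (vcoef y) =
  (n%:R - 2) * lam * (\sum_m x m * y m) +
  (r * (3 * n%:R - 4) + (1 - 2 * r)) * (\sum_i x i) * (\sum_i y i).
Proof.
rewrite Qf_vcoefr; set X := \sum_i x i; set Y := \sum_i y i.
transitivity (\sum_m ((n%:R - 2) * lam * (x m * y m) + (n%:R - 2) * r * Y * x m + X * lam * y m + X * r * Y)).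
  by apply: eq_bigr => m _; rewrite row_vcoef -/X; ring.
rewrite !big_split/= -!mulr_sumr -/X -/Y sumr_const card_ord -mulr_natl; ring.
Qed.

Lemma Qf_dcoef_vcoef (k l : 'I_n) y : (k < l)%N ->
  Qf (dcoef k l) (vcoef y) = lam * (y k + y l) + 2 * r * \sum_i y i.
Proof.
move=> kl; rewrite Qf_vcoefr; under eq_bigr do rewrite row_dcoef// mulrDl.
rewrite big_split/= !sum_eqMr; ring.
Qed.

Lemma Qf_dcoef (k l : 'I_n) : (k < l)%N -> Qf (dcoef k l) (dcoef k l) = 1.
Proof.
move=> kl; rewrite /Qf psum_dcoef// /dcoef !eqxx.
under eq_bigr do rewrite row_dcoef// mulrDl.
have kl' : (k == l) = false by rewrite -val_eqE/= ltn_eqF.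
by rewrite big_split/= !sum_eqMr !eqxx kl' [l == k]eq_sym kl' /=; ring.
Qed.

Lemma card_setI_pair (i j : 'I_n) (B : {set 'I_n}) : i != j ->
  #|([set i; j] :&: B)%SET| = ((i \in B) + (j \in B))%N.
Proof.
move=> ij; rewrite finset.setIUl cardsU.
have -> : (([set i] :&: B) :&: ([set j] :&: B) = finset.set0)%SET.
  apply/finset.setP => x; rewrite !inE; apply/negP => /andP[/andP[/eqP -> _] /andP[/eqP ji _]].
  by rewrite ji eqxx in ij.
have c1 (x : 'I_n) : #|([set x] :&: B)%SET| = (x \in B).
  have [xB|xB] := boolP (x \in B).
    have -> : ([set x] :&: B = [set x])%SET by apply/finset.setIidPl; rewrite finset.sub1set.
    by rewrite cards1.
  by apply/eqP; rewrite cards_eq0 finset.setI_eq0 disjoints1.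
by rewrite !c1 cards0 subn0.
Qed.

(** The inner product of two incidence vectors counts the shared indices; for equal pairs it
    contributes 2 r, and 1 - 2 r completes this to 1. *)
Lemma field_covE (i j k l : 'I_n) : (i < j)%N -> (k < l)%N ->
  field_cov r i j k l =
  r * \sum_m (((m == i)%:R + (m == j)%:R) * ((m == k)%:R + (m == l)%:R)) +
  (1 - 2 * r) * dcoef i j k l.
Proof.
move=> ij kl.
have nij : i != j by rewrite -val_eqE/= ltn_eqF.
have nkl : k != l by rewrite -val_eqE/= ltn_eqF.
have -> : \sum_m (((m == i)%:R + (m == j)%:R) * ((m == k)%:R + (m == l)%:R)) =
    (i == k)%:R + (i == l)%:R + ((j == k)%:R + (j == l)%:R) :> R.
  under eq_bigr do rewrite mulrDl.
  by rewrite big_split/= !sum_eqMr.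
rewrite /field_cov /pair_overlap card_setI_pair// !inE /dcoef.
have [ik|ik] := eqVneq i k; have [il|il] := eqVneq i l; have [jk|jk] := eqVneq j k;
  have [jl|jl] := eqVneq j l; rewrite /=; subst; rewrite ?eqxx // in nij nkl *; try ring.
(* The remaining case i = l, j = k contradicts the two orderings. *)
by have := ltn_trans ij kl; rewrite ltnn.
Qed.

End pair_sums.

(** * Regression of the field on orthonormal combinations *)

Section gaussian_field.
Context {d : measure_display} {T : measurableType d} {R : realType}.
Variable P : probability T R.
Variables (n : nat) (r : R) (G : 'I_n -> 'I_n -> T -> R).
Hypothesis HG : centered_gaussian_field P r G.
Implicit Types a b : 'I_n -> 'I_n -> R.

Definition lin a w : R := psum (fun i j => a i j * G i j w).

Lemma lin_gaussian a : gaussianRV P (lin a).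
Proof. by case: HG => H _; exact: H. Qed.

Lemma lin_dcoef (i j : 'I_n) : (i < j)%N -> lin (dcoef i j) = G i j.
Proof. by move=> ij; apply/funext => w; rewrite /lin psum_dcoef. Qed.

Lemma G_intg (i j : 'I_n) : (i < j)%N -> intg P (G i j) /\ intg P (fun w => G i j w * G i j w).
Proof. by move=> ij; rewrite -lin_dcoef//; apply: gaussianRV_intg; exact: lin_gaussian. Qed.

Lemma GG_intg (i j k l : 'I_n) : (i < j)%N -> (k < l)%N ->
  intg P (fun w => G i j w * G k l w).
Proof.
move=> ij kl; have [i1 i2] := G_intg ij; have [i3 i4] := G_intg kl.
apply: (le_intg _ (intgD i2 i4)).
  by apply: measurable_funM; [exact: (intg_measurable i1)|exact: (intg_measurable i3)].
move=> w; rewrite ler_norml.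
have := sqr_ge0 (G i j w + G k l w); have := sqr_ge0 (G i j w - G k l w).
have := sqr_ge0 (G i j w); have := sqr_ge0 (G k l w).
move=> *; apply/andP; split; nra.
Qed.

Lemma lin_mean a : \int[P]_w lin a w = 0.
Proof.
rewrite /lin; under eq_Rint do rewrite psumE.
rewrite Rint_sum => [|q qlt]; last by apply: intgZ; have [] := G_intg qlt.
apply: big1 => q qlt; rewrite RintZ; last by have [] := G_intg qlt.
have [_ [/(_ q.1 q.2 qlt) + _]] := HG; rewrite unlock => H.
by rewrite /Rintegral H /= mulr0.
Qed.

Lemma lin_cov a b : \int[P]_w (lin a w * lin b w) = Qf r a b.
Proof.
transitivity (\int[P]_w (\sum_(q : 'I_n * 'I_n | (q.1 < q.2)%N) \sum_(q' : 'I_n * 'I_n | (q'.1 < q'.2)%N)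
    (a q.1 q.2 * b q'.1 q'.2) * (G q.1 q.2 w * G q'.1 q'.2 w))).
  apply: eq_Rint => w; rewrite /lin !psumE mulr_suml; apply: eq_bigr => q _.
  by rewrite mulr_sumr; apply: eq_bigr => q' _; ring.
have ii (q q' : 'I_n * 'I_n) : (q.1 < q.2)%N -> (q'.1 < q'.2)%N ->
    intg P (fun w => (a q.1 q.2 * b q'.1 q'.2) * (G q.1 q.2 w * G q'.1 q'.2 w)).
  by move=> qlt q'lt; apply: intgZ; exact: GG_intg.
rewrite Rint_sum => [|q qlt]; last by apply: intg_sum => q' q'lt; exact: ii.
transitivity (\sum_(q : 'I_n * 'I_n | (q.1 < q.2)%N) \sum_(q' : 'I_n * 'I_n | (q'.1 < q'.2)%N)
   (r * \sum_m ((((m == q.1)%:R + (m == q.2)%:R) * a q.1 q.2) * (((m == q'.1)%:R + (m == q'.2)%:R) * b q'.1 q'.2))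
   + (1 - 2 * r) * (a q.1 q.2 * (dcoef q.1 q.2 q'.1 q'.2 * b q'.1 q'.2)))).
  apply: eq_bigr => q qlt; rewrite Rint_sum => [|q' q'lt]; last exact: ii.
  apply: eq_bigr => q' q'lt; rewrite RintZ; last exact: GG_intg.
  have [_ [_ /(_ q.1 q.2 q'.1 q'.2 qlt q'lt)]] := HG; rewrite unlock => H.
  rewrite [X in _ * X]/Rintegral H /= field_covE// mulrDr; congr (_ + _); last by ring.
  rewrite mulrCA; congr (_ * _); rewrite mulr_sumr; apply: eq_bigr => m _; ring.
rewrite /Qf; under eq_bigr do rewrite big_split/=.
rewrite big_split/=; congr (_ + _).
  under eq_bigr do rewrite -mulr_sumr exchange_big/=.
  rewrite -mulr_sumr exchange_big/=; congr (_ * _); apply: eq_bigr => m _.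
  rewrite /row !psumE mulr_suml; apply: eq_bigr => q _.
  by rewrite mulr_sumr.
under eq_bigr do rewrite -mulr_sumr.
rewrite -mulr_sumr psumE; congr (_ * _); apply: eq_bigr => q qlt.
rewrite -mulr_sumr; congr (_ * _).
by have := @psum_dcoef _ _ q.1 q.2 b qlt; rewrite psumE.
Qed.

Lemma lin_sum (I : Type) (s : seq I) (c : I -> R) (A : I -> 'I_n -> 'I_n -> R) w :
  lin (fun i j => \sum_(k <- s) c k * A k i j) w = \sum_(k <- s) c k * lin (A k) w.
Proof.
rewrite /lin psumE; under eq_bigr do rewrite mulr_suml.
rewrite exchange_big/=; apply: eq_bigr => k _; rewrite psumE mulr_sumr.
by apply: eq_bigr => q _; rewrite mulrA.
Qed.

Lemma lin_cos a c t : \int[P]_w cos (c * lin a w + t) = expR (- (c ^+ 2 * Qf r a a) / 2) * cos t.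
Proof. by have [H _ _] := gaussianRV_centered (lin_gaussian a) (lin_mean a) (lin_cov a a). Qed.

(** A combination of the [lin (A k)] is again a [lin], hence Gaussian, so the joint cosine transform
    depends only on its variance, which orthogonality splits. *)
Lemma lin_gauss_weight (I : eqType) (s : seq I) (v : I -> R) (A : I -> 'I_n -> 'I_n -> R) :
  uniq s -> (forall k l, k \in s -> l \in s -> Qf r (A k) (A l) = if k == l then v k else 0) ->
  gauss_weight P s v (fun k => lin (A k)) (cst 1).
Proof.
move=> us QA c t; rewrite Rint_cst mul1r.
have := lin_cos (fun i j => \sum_(k <- s) c k * A k i j) 1 t.
rewrite (Qf_orthogonal c us QA) expr1n mul1r => <-.
by apply: eq_Rint => w; rewrite lin_sum !mul1r.
Qed.

Lemma lin_independent (I : eqType) (s : seq I) (v : I -> R) (A : I -> 'I_n -> 'I_n -> R)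
    (f : I -> R -> R) (M : I -> R) :
  uniq s -> (forall k l, k \in s -> l \in s -> Qf r (A k) (A l) = if k == l then v k else 0) ->
  (forall k, v k = Qf r (A k) (A k)) ->
  (forall i, i \in s -> measurable_fun setT (f i)) ->
  (forall i y, i \in s -> 0 <= f i y <= M i) ->
  \int[P]_w (\prod_(i <- s) f i (lin (A i) w)) = \prod_(i <- s) \int[P]_w f i (lin (A i) w).
Proof.
move=> us QA vA mf fM.
have mX i : measurable_fun setT (lin (A i)) by apply: gaussianRV_measurable; exact: lin_gaussian.
have gX i c t : \int[P]_w cos (c * lin (A i) w + t) = expR (- (c ^+ 2 * v i) / 2) * cos t.
  by rewrite lin_cos vA.
have i1 : intg P (cst 1) by apply: (@intg_bounded _ _ _ _ _ 1) => // x; rewrite normr1.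
have := @gauss_weight_prod _ _ _ P _ v _ mX gX s (cst 1) f M us i1 (lin_gauss_weight us QA) mf fM.
by rewrite Rint_cst mul1r => <-; apply: eq_Rint => w; rewrite mul1r.
Qed.

(** The unbounded exponential factor is peeled off first and becomes the weight under which the
    bounded factors are treated. *)
Lemma lin_independent_exp (I : eqType) (i0 : I) (s : seq I) (v : I -> R)
    (A : I -> 'I_n -> 'I_n -> R) (f : I -> R -> R) (M : I -> R) (l : R) :
  uniq (i0 :: s) ->
  (forall k l, k \in i0 :: s -> l \in i0 :: s -> Qf r (A k) (A l) = if k == l then v k else 0) ->
  (forall k, v k = Qf r (A k) (A k)) ->
  (forall i, i \in s -> measurable_fun setT (f i)) ->
  (forall i y, i \in s -> 0 <= f i y <= M i) ->
  intg P (fun w => expR (l * lin (A i0) w)) /\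
  \int[P]_w (expR (l * lin (A i0) w) * \prod_(i <- s) f i (lin (A i) w)) =
  expR (l ^+ 2 * v i0 / 2) * \prod_(i <- s) \int[P]_w f i (lin (A i) w).
Proof.
move=> us QA vA mf fM.
have mX i : measurable_fun setT (lin (A i)) by apply: gaussianRV_measurable; exact: lin_gaussian.
have gX i c t : \int[P]_w cos (c * lin (A i) w + t) = expR (- (c ^+ 2 * v i) / 2) * cos t.
  by rewrite lin_cos vA.
have i1 : intg P (cst 1) by apply: (@intg_bounded _ _ _ _ _ 1) => // x; rewrite normr1.
have [_ H _] := gaussianRV_centered (lin_gaussian (A i0)) (lin_mean (A i0)) (lin_cov (A i0) (A i0)).
have [ie Ee] := H l; split => //.
have mexp : measurable_fun setT (fun y : R => expR (l * y)).
  by apply: measurableT_comp => //; exact: measurable_funM.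
have /andP[ni0 us'] : (i0 \notin s) && uniq s by [].
have ie1 : intg P (fun w => cst 1 w * expR (l * lin (A i0) w)).
  by under eq_fun do rewrite mul1r.
have [E gW] := @gauss_weight_factor _ _ _ P _ v _ mX gX i0 s (cst 1) (fun y => expR (l * y)) ni0 i1
  (lin_gauss_weight us QA) mexp (fun y => expR_ge0 _) ie ie1.
have := @gauss_weight_prod _ _ _ P _ v _ mX gX s _ f M us' ie1 gW mf fM.
rewrite E Rint_cst mul1r Ee vA => <-.
by apply: eq_Rint => w; rewrite mul1r.
Qed.

(* The coefficients below make the [Yv k] orthonormal: by [Qf_vcoef] the covariance of two combinations [vcoef x], [vcoef y] only involves [x . y] and the two coordinate sums. *)
Hypothesis n3 : (3 <= n)%N.
Hypothesis r4 : (4^-1 : R) <= r.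
Hypothesis r2 : r <= (2^-1 : R).

Definition lamY : R := r * (n%:R - 2) + (1 - 2 * r).
Definition msumY : R := r * (3 * n%:R - 4) + (1 - 2 * r).
Definition alphaY : R := (Num.sqrt ((n%:R - 2) * lamY))^-1.
Definition gamY : R := (Num.sqrt ((n%:R - 2) * lamY + n%:R * msumY))^-1.
(** Row [k] of the symmetric inverse square root of that covariance: [alphaY] scales vectors with
    zero sum, [gamY] the constant direction. *)
Definition ycoef (k m : 'I_n) : R := alphaY * (k == m)%:R + (gamY - alphaY) / n%:R.

Lemma natr_ge3 : 3 <= n%:R :> R. Proof. by rewrite ler_nat. Qed.
Lemma natr_neq0 : n%:R != 0 :> R. Proof. by rewrite pnatr_eq0 -lt0n (leq_trans _ n3). Qed.
Lemma lamY_gt0 : 0 < lamY.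
Proof.
have r4' := r4; have r2' := r2; have N3 := natr_ge3; have : 0 <= r * (n%:R - 3) by apply: mulr_ge0; lra.
rewrite /lamY; lra.
Qed.
Lemma msumY_gt0 : 0 < msumY.
Proof.
have r4' := r4; have r2' := r2; have N3 := natr_ge3; have : 0 <= r * (n%:R - 3) by apply: mulr_ge0; lra.
rewrite /msumY; lra.
Qed.
Lemma nlamY_gt0 : 0 < (n%:R - 2) * lamY.
Proof. by rewrite mulr_gt0 ?lamY_gt0//; have := natr_ge3; lra. Qed.
Lemma nmsumY_gt0 : 0 < (n%:R - 2) * lamY + n%:R * msumY.
Proof. by rewrite addr_gt0 ?nlamY_gt0// mulr_gt0 ?msumY_gt0//; have := natr_ge3; lra. Qed.
Lemma gamY_gt0 : 0 < gamY.
Proof. by rewrite invr_gt0 sqrtr_gt0 nmsumY_gt0. Qed.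

Lemma ycoef_sum k : \sum_m ycoef k m = gamY.
Proof.
rewrite /ycoef big_split/= -mulr_sumr sumr_const card_ord.
have -> : \sum_m (k == m)%:R = 1 :> R.
  by rewrite -[RHS](sum_eqM k (fun=> 1)); apply: eq_bigr => i _; rewrite mulr1.
by rewrite -[X in _ + X]mulr_natr divfK ?natr_neq0// mulr1 addrC subrK.
Qed.

Lemma ycoef_dot k l : \sum_m ycoef k m * ycoef l m =
  alphaY ^+ 2 * (k == l)%:R + (gamY ^+ 2 - alphaY ^+ 2) / n%:R.
Proof.
pose be := (gamY - alphaY) / n%:R.
transitivity (\sum_m ((k == m)%:R * (alphaY ^+ 2 * (l == m)%:R) + (k == m)%:R * (alphaY * be)
   + (l == m)%:R * (alphaY * be) + be ^+ 2)).
  by apply: eq_bigr => m _; rewrite /ycoef -/be; ring.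
rewrite !big_split/= !sum_eqM sumr_const card_ord -mulr_natl [l == k]eq_sym /be.
by field; rewrite natr_neq0.
Qed.

Lemma ycoef_orthonormal k l : Qf r (vcoef (ycoef k)) (vcoef (ycoef l)) = (k == l)%:R.
Proof.
rewrite Qf_vcoef !ycoef_sum ycoef_dot -/lamY -/msumY.
have l0 := nlamY_gt0; have m0 := nmsumY_gt0.
have aE : alphaY ^+ 2 = ((n%:R - 2) * lamY)^-1 by rewrite exprVn sqr_sqrtr// ltW.
have gE : gamY ^+ 2 = ((n%:R - 2) * lamY + n%:R * msumY)^-1 by rewrite exprVn sqr_sqrtr// ltW.
have -> : msumY * gamY * gamY = msumY * gamY ^+ 2 by ring.
rewrite aE gE; field.
have N3 := natr_ge3; have l1 := lamY_gt0; have n2 : 0 < n%:R - 2 :> R by lra.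
by rewrite natr_neq0 !gt_eqF.
Qed.

Definition Yv k := lin (vcoef (ycoef k)).
(** The common covariance of [G i j] with [Yv i] and [Yv j], hence its regression coefficient on
    them. *)
Definition slope : R := lamY * (alphaY + 2 * ((gamY - alphaY) / n%:R)) + 2 * r * gamY.

Lemma cov_G_Y (i j k : 'I_n) : (i < j)%N -> (k == i) || (k == j) ->
  Qf r (dcoef i j) (vcoef (ycoef k)) = slope.
Proof.
move=> ij kij; rewrite Qf_dcoef_vcoef// ycoef_sum -/lamY /ycoef /slope.
have nij : (i == j) = false by rewrite -val_eqE/= ltn_eqF.
by case/orP: kij => /eqP ->; rewrite eqxx ?[j == i]eq_sym nij /=; ring.
Qed.

(** The regression residual, written as a sum over a list so that [Qf_suml] and [lin_sum] expand
    it. *)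
Definition rcoef (i j : 'I_n) : 'I_n -> 'I_n -> R := fun k l =>
  \sum_(z <- [:: (1, dcoef i j); (- slope, vcoef (ycoef i)); (- slope, vcoef (ycoef j))])
    z.1 * z.2 k l.

Definition Rv i j := lin (rcoef i j).

Lemma G_decomposition (i j : 'I_n) w : (i < j)%N ->
  G i j w = slope * (Yv i w + Yv j w) + Rv i j w.
Proof.
move=> ij; rewrite /Rv /rcoef (lin_sum _ (fun z => z.1) (fun z => z.2)).
by rewrite !big_cons big_nil/= lin_dcoef// -!/(Yv _ _); ring.
Qed.

Lemma rcoef_Y (i j k : 'I_n) : (i < j)%N -> (k == i) || (k == j) ->
  Qf r (rcoef i j) (vcoef (ycoef k)) = 0.
Proof.
move=> ij kij; rewrite /rcoef (Qf_suml _ _ (fun z => z.1) (fun z => z.2)).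
rewrite !big_cons big_nil/= cov_G_Y// !ycoef_orthonormal.
have nij : (i == j) = false by rewrite -val_eqE/= ltn_eqF.
by case/orP: kij => /eqP ->; rewrite eqxx ?[j == i]eq_sym nij /=; ring.
Qed.

Lemma rcoef_var (i j : 'I_n) : (i < j)%N ->
  Qf r (rcoef i j) (rcoef i j) = 1 - 2 * slope ^+ 2.
Proof.
move=> ij; rewrite {1}/rcoef (Qf_suml _ _ (fun z => z.1) (fun z => z.2)).
rewrite !big_cons big_nil/= !(QfC _ _ (rcoef i j)) !rcoef_Y ?eqxx ?orbT//.
rewrite /rcoef (Qf_suml _ _ (fun z => z.1) (fun z => z.2)).
rewrite !big_cons big_nil/= Qf_dcoef// !(QfC _ _ (dcoef i j)) !cov_G_Y ?eqxx ?orbT//.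
by ring.
Qed.

(** Nonnegativity of 1 - 2 slope^2 holds because it is the variance of a residual. For the upper
    bound, lamY >= r (n - 2) gives slope >= sqrt r (1 - 2 / n), and 2 r (1 - 2 / n)^2 >= 2 r - 4 / n
    because r <= 1 / 2. *)
Lemma slope_bounds : [/\ 0 <= slope, 0 <= 1 - 2 * slope ^+ 2 &
  1 - 2 * slope ^+ 2 <= (1 - 2 * r) + 4 / n%:R].
Proof.
have r4' := r4; have r2' := r2.
have n2 : 0 < n%:R - 2 :> R by have := natr_ge3; lra.
have lamY0 := lamY_gt0; have gamY0 := gamY_gt0; have nlamY0 := nlamY_gt0; have nY0 := natr_neq0.
have npos : 0 < n%:R :> R by have := natr_ge3; lra.
have lE : lamY * alphaY >= Num.sqrt r.
  rewrite /alphaY ler_pdivlMr ?sqrtr_gt0// -sqrtrM; last lra.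
  rewrite -[leRHS](ger0_norm (ltW lamY_gt0)) -sqrtr_sqr ler_wsqrtr// expr2 mulrA.
  rewrite ler_wpM2r ?(ltW lamY_gt0)// /lamY; lra.
have sE : slope = lamY * alphaY * (1 - 2 / n%:R) + gamY * (2 * lamY / n%:R + 2 * r).
  by rewrite /slope; field.
have r0 : 0 < r by lra.
have f0 : 0 < 1 - 2 / n%:R :> R by rewrite subr_gt0 ltr_pdivrMr//; have := natr_ge3; lra.
have f1 : 1 - 2 / n%:R <= 1 :> R by rewrite gerBl divr_ge0// ltW.
have g0 : 0 <= gamY * (2 * lamY / n%:R + 2 * r).
  by rewrite mulr_ge0 ?(ltW gamY_gt0)// addr_ge0// ?divr_ge0 ?mulr_ge0// ltW.
have lb : Num.sqrt r * (1 - 2 / n%:R) <= slope.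
  rewrite sE -[leLHS]addr0 lerD// ler_wpM2r// ltW//.
have s0 : 0 <= slope by apply: le_trans lb; rewrite mulr_ge0 ?sqrtr_ge0// ltW.
split => //.
- have [i [j ij]] : exists i j : 'I_n, (i < j)%N.
    exists (Ordinal (leq_trans (isT : (0 < 3)%N) n3)), (Ordinal (leq_trans (isT : (1 < 3)%N) n3)).
    by [].
  rewrite -(rcoef_var ij) -lin_cov; apply: Rintegral_ge0 => w _.
  by rewrite -expr2 sqr_ge0.
- have H : (Num.sqrt r * (1 - 2 / n%:R)) ^+ 2 <= slope ^+ 2.
    by rewrite lerXn2r// nnegrE// mulr_ge0 ?sqrtr_ge0// ltW.
  rewrite exprMn sqr_sqrtr ?(ltW r0)// in H.
  have : r * (1 - 4 / n%:R) <= r * (1 - 2 / n%:R) ^+ 2.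
    rewrite ler_wpM2l ?(ltW r0)//.
    have -> : (1 - 2 / n%:R) ^+ 2 = 1 - 4 / n%:R + (2 / n%:R) ^+ 2 :> R by field.
    by rewrite lerDl sqr_ge0.
  have : 0 <= n%:R^-1 :> R by rewrite invr_ge0 ltW.
  move: H; move: (n%:R^-1) => z H z0.
  have : r * z <= 2^-1 * z by rewrite ler_wpM2r.
  lra.
Qed.

Lemma Yv_measurable k : measurable_fun setT (Yv k).
Proof. by apply: gaussianRV_measurable; exact: lin_gaussian. Qed.

Lemma Rv_measurable i j : measurable_fun setT (Rv i j).
Proof. by apply: gaussianRV_measurable; exact: lin_gaussian. Qed.

Lemma lin_law a (A : set R) : Qf r a a = 1 -> measurable A ->
  P (lin a @^-1` A) = normal_prob 0 1 A.
Proof.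
have [_ _ H] := gaussianRV_centered (lin_gaussian a) (lin_mean a) (lin_cov a a).
by move=> q1; exact: H.
Qed.

Lemma Yv_law k (A : set R) : measurable A -> P (Yv k @^-1` A) = normal_prob 0 1 A.
Proof. by apply: lin_law; rewrite ycoef_orthonormal eqxx. Qed.

(** Lets [tilt_int] treat a lower part of the law of [Yv k] as an upper tail. *)
Lemma YvN_law k (A : set R) : measurable A ->
  P ((fun w => - Yv k w) @^-1` A) = normal_prob 0 1 A.
Proof.
move=> mA; pose b := [:: (-1 : R)].
have E : (fun w => - Yv k w) = lin (fun i j => \sum_(c <- b) c * vcoef (ycoef k) i j).
  apply/funext => w; rewrite (lin_sum _ id (fun=> vcoef (ycoef k))) big_seq1.
  by rewrite mulN1r.
rewrite E; apply: lin_law => //.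
rewrite (Qf_suml _ _ id (fun=> vcoef (ycoef k))) big_seq1 QfC.
rewrite (Qf_suml _ _ id (fun=> vcoef (ycoef k))) big_seq1 ycoef_orthonormal eqxx.
by rewrite !mulN1r opprK.
Qed.

Lemma Yv_independent (f : 'I_n -> R -> R) (M : R) :
  (forall i, measurable_fun setT (f i)) -> (forall i y, 0 <= f i y <= M) ->
  \int[P]_w (\prod_(i < n) f i (Yv i w)) = \prod_(i < n) \int[P]_w f i (Yv i w).
Proof.
move=> mf fM.
apply: (@lin_independent _ _ (fun=> 1) (fun k => vcoef (ycoef k)) f (fun=> M)) => //.
- exact: index_enum_uniq.
- by move=> k l _ _; rewrite ycoef_orthonormal; case: eqP.
- by move=> k; rewrite ycoef_orthonormal eqxx.
Qed.

Lemma YR_independent (i j : 'I_n) (f : R -> R) (M l : R) : (i < j)%N ->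
  measurable_fun setT f -> (forall y, 0 <= f y <= M) ->
  intg P (fun w => expR (l * Rv i j w)) /\
  \int[P]_w (expR (l * Rv i j w) * (f (Yv i w) * f (Yv j w))) =
  expR (l ^+ 2 * (1 - 2 * slope ^+ 2) / 2) *
    ((\int[P]_w f (Yv i w)) * \int[P]_w f (Yv j w)).
Proof.
move=> ij mf fM.
have nij : (i == j) = false by rewrite -val_eqE/= ltn_eqF.
(* [None] indexes the residual and [Some k] the variable [Yv k], so that the three form one
   orthogonal family. *)
pose A (o : option 'I_n) := if o is Some k then vcoef (ycoef k) else rcoef i j.
pose v (o : option 'I_n) := Qf r (A o) (A o).
have us : uniq [:: None; Some i; Some j].
  by rewrite /= !inE/= -[Some i == Some j]/(i == j) nij.
have QA k l' : k \in [:: None; Some i; Some j] -> l' \in [:: None; Some i; Some j] ->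
    Qf r (A k) (A l') = if k == l' then v k else 0.
  have nji : (j == i) = false by rewrite eq_sym.
  rewrite !inE => /or3P[] /eqP -> /or3P[] /eqP ->; rewrite ?eqxx//=.
  - by rewrite rcoef_Y// eqxx.
  - by rewrite rcoef_Y// eqxx orbT.
  - by rewrite QfC rcoef_Y// eqxx.
  - by rewrite ycoef_orthonormal -[Some i == Some j]/(i == j) nij.
  - by rewrite QfC rcoef_Y// eqxx orbT.
  - by rewrite ycoef_orthonormal -[Some j == Some i]/(j == i) nji.
have [ie E] := @lin_independent_exp _ None [:: Some i; Some j] v A (fun=> f) (fun=> M) l us QA
  (fun=> erefl) (fun _ _ => mf) (fun _ y _ => fM y).
split => //.
rewrite !big_cons big_nil mulr1 {1}/v /= rcoef_var// in E.
by rewrite -E; apply: eq_Rint => w; rewrite !big_cons big_nil mulr1.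
Qed.

End gaussian_field.

(** * The two largest independent variables *)

Lemma measurable_bigmax {d : measure_display} {T : measurableType d} {R : realType}
  (I : Type) (s : seq I) (Q : pred I) (x0 : T -> R) (F : I -> T -> R) :
  measurable_fun setT x0 -> (forall i, Q i -> measurable_fun setT (F i)) ->
  measurable_fun setT (fun w => \big[Num.max/x0 w]_(i <- s | Q i) F i w).
Proof.
move=> m0 mF; elim: s => [|i s IH].
  by under eq_fun do rewrite big_nil.
have [Qi|Qi] := boolP (Q i); last by under eq_fun do rewrite big_cons (negbTE Qi).
by under eq_fun do rewrite big_cons Qi; apply: measurable_maxr => //; exact: mF.
Qed.

(** [field_max] is the [fine] part of an extended maximum with default -oo. For [2 <= n] the pair
    (0, 1) exists, so the maximum is finite and [fine] loses nothing. *)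
Lemma field_max_le {T : Type} {R : realType} (n : nat) (G : 'I_n -> 'I_n -> T -> R) w (y : R) :
  (2 <= n)%N ->
  (field_max G w <= y) <-> (forall i j : 'I_n, (i < j)%N -> G i j w <= y).
Proof.
move=> n2; rewrite /field_max; set M := (\big[_/_]_(i < n) _).
have leM (z : \bar R) : (M <= z)%E <-> forall i j : 'I_n, (i < j)%N -> ((G i j w)%:E <= z)%E.
  split=> [Mz i j ij|H].
    apply: le_trans Mz; rewrite /M.
    apply: le_trans (le_bigmax _ _ i).
    exact: (@le_bigmax_cond _ _ _ _ _ (fun j : 'I_n => (i < j)%N)).
  apply: bigmax_le => [|i _]; first exact: leNye.
  by apply: bigmax_le => [|j ij]; [exact: leNye|exact: H].
pose i0 : 'I_n := Ordinal (leq_trans (isT : (0 < 2)%N) n2).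
pose i1 : 'I_n := Ordinal n2.
have Mfin : M \is a fin_num.
  rewrite fin_numE; apply/andP; split.
    have : ((G i0 i1 w)%:E <= M)%E by have /leM := lexx M; exact.
    by move=> H; apply/eqP => Moo; rewrite Moo leeNy_eq in H.
  pose B := \big[Num.max/0]_(q : 'I_n * 'I_n) G q.1 q.2 w.
  have : (M <= B%:E)%E.
    by apply/leM => i j _; rewrite lee_fin; exact: (le_bigmax _ (fun q => G q.1 q.2 w) (i, j)).
  by move=> H; apply/eqP => Moo; rewrite Moo leye_eq in H.
by rewrite -lee_fin fineK//; split => [/leM|H] //; apply/leM.
Qed.

Section fixed_size.
Context {d : measure_display} {T : measurableType d} {R : realType}.
Variable P : probability T R.
Variables (n : nat) (r : R) (G : 'I_n -> 'I_n -> T -> R).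
Hypothesis HG : centered_gaussian_field P r G.
Hypothesis n3 : (3 <= n)%N.
Hypothesis r4 : (4^-1 : R) <= r.
Hypothesis r2 : r <= (2^-1 : R).
Local Notation c := (c_seq n : R).
Local Notation dn := (d_seq n : R).
Hypothesis c0 : 0 < c.

Definition Uv (i : 'I_n) w : R := c * (Yv r G i w - dn).

Lemma Uv_measurable i : measurable_fun setT (Uv i).
Proof.
apply: measurable_funM => //; apply: measurable_funB => //.
exact: (Yv_measurable HG).
Qed.

Lemma Uv_le i w u : (Uv i w <= u) = (Yv r G i w <= dn + u / c).
Proof. by rewrite /Uv -lerBlDl ler_pdivlMr// mulrC. Qed.

Let i0 : 'I_n := Ordinal (leq_trans (isT : (0 < 3)%N) n3).
Let i1 : 'I_n := Ordinal (leq_trans (isT : (1 < 3)%N) n3).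

(** The default value is one of the entries and does not alter the maximum; the same device is used
    for [Smax]. *)
Definition Amax w : R := \big[Num.max/Uv i0 w]_(i < n) Uv i w.
Definition Smax w : R := \big[Num.max/Uv i0 w + Uv i1 w]_(q : 'I_n * 'I_n | (q.1 < q.2)%N)
  (Uv q.1 w + Uv q.2 w).

Lemma Amax_measurable : measurable_fun setT Amax.
Proof. by apply: measurable_bigmax => [|i _]; exact: Uv_measurable. Qed.

Lemma Smax_measurable : measurable_fun setT Smax.
Proof.
by apply: measurable_bigmax => [|i _]; apply: measurable_funD; exact: Uv_measurable.
Qed.

Lemma Amax_le w u : (Amax w <= u) <-> (forall i, Uv i w <= u).
Proof.
split=> [Au i|H]; first by apply: le_trans Au; exact: le_bigmax.
by apply: bigmax_le.
Qed.

Lemma Smax_le w s : (Smax w <= s) <-> (forall i j : 'I_n, (i < j)%N -> Uv i w + Uv j w <= s).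
Proof.
split=> [Ss i j ij|H]; last by apply: bigmax_le => [|q q12]; exact: H.
apply: le_trans Ss.
exact: (@le_bigmax_cond _ _ _ _ (i, j) (fun q : 'I_n * 'I_n => (q.1 < q.2)%N) (fun q => Uv q.1 w + Uv q.2 w)).
Qed.

(* [Smax - Amax] plays the role of the second largest of the [Uv i]. *)
Lemma second_le w v : (Smax w - Amax w <= v) <->
  (forall i j : 'I_n, i != j -> Uv i w <= v \/ Uv j w <= v).
Proof.
have ltij (i j : 'I_n) : i != j -> (i < j)%N \/ (j < i)%N.
  by rewrite neq_ltn => /orP.
rewrite lerBlDr; split.
  move=> /Smax_le H i j ij.
  have [k kA] : exists k : 'I_n, Amax w = Uv k w.
    case: (@arg_maxP _ R 'I_n i0 xpredT (fun i => Uv i w) isT) => k _ kmax.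
    exists k; apply/le_anti/andP; split; last by have /Amax_le := lexx (Amax w); exact.
    by apply/Amax_le => l; exact: kmax.
  rewrite kA in H.
  have Hk l : l != k -> Uv l w <= v.
    by move=> lk; case: (ltij _ _ lk) => /H; lra.
  have [ik|ik] := eqVneq i k; last by left; exact: Hk.
  by right; apply: Hk; rewrite -ik eq_sym.
move=> H; apply/Smax_le => i j ij.
have iA k : Uv k w <= Amax w by have /Amax_le := lexx (Amax w); exact.
have nij : i != j by rewrite -val_eqE/= ltn_eqF.
by have := iA i; have := iA j; case: (H i j nij); lra.
Qed.

Definition ind (b : bool) : R := if b then 1 else 0.

Lemma ind_measurable (f : R -> R) u : measurable_fun setT f ->
  measurable_fun setT (fun y => ind (f y <= u)).
Proof. by move=> mf; apply: measurable_fun_ifT => //; exact: measurable_fun_ler. Qed.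

Lemma ind01 b : 0 <= ind b <= 1.
Proof. by rewrite /ind; case: b; rewrite ?lexx ?ler01. Qed.

Let Uy (y : R) : R := c * (y - dn).

Let mUy : measurable_fun setT Uy.
Proof. by apply: measurable_funM => //; exact: measurable_funB. Qed.

Lemma pr_ind (A : set T) (b : T -> bool) : measurable A -> (forall w, A w <-> b w) ->
  pr P A = \int[P]_w ind (b w).
Proof.
move=> mA Ab; rewrite -pr_indic//; apply: eq_Rint => w.
rewrite indicE /ind; have [Aw|nA] := pselect (A w).
  by rewrite mem_set//; have /Ab -> := Aw.
by rewrite memNset//; case: ifPn => // /Ab.
Qed.

Lemma cdfU_pr i u : \int[P]_w ind (Uv i w <= u) = cdfU n u.
Proof.
have mYA : measurable [set w | Yv r G i w <= dn + u / c].
  by apply: measurable_le_cst; exact: (Yv_measurable HG).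
rewrite -(@pr_ind [set w | Yv r G i w <= dn + u / c]); last 2 first.
- exact: mYA.
- by move=> w /=; rewrite Uv_le.
rewrite /cdfU -[LHS](subKr 1) -prC//; congr (1 - _).
rewrite /pr /gtail; congr fine; rewrite -(Yv_law HG n3 r4 r2 i)//.
by congr (P _); apply/seteqP; split => w /=; rewrite in_itv/= andbT ltNge => /negP.
Qed.

Lemma Amax_law u : pr P [set w | Amax w <= u] = cdfU n u ^+ n.
Proof.
rewrite (@pr_ind _ (fun w => [forall i, Uv i w <= u])); last 2 first.
- by apply: measurable_le_cst; exact: Amax_measurable.
- move=> w /=; split; first by move=> /Amax_le H; apply/forallP.
  by move=> /forallP H; apply/Amax_le.
transitivity (\int[P]_w (\prod_(i < n) ind (Uy (Yv r G i w) <= u))).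
  apply: eq_Rint => w; rewrite /ind; case: ifPn => [/forallP H|].
    by rewrite big1// => i _; rewrite -/(Uv i w) H.
  by rewrite negb_forall => /existsP[i iu]; rewrite (bigD1 i)//= -/(Uv i w) (negbTE iu) mul0r.
rewrite (@Yv_independent _ _ _ _ _ _ _ HG n3 r4 r2 (fun _ y => ind (Uy y <= u)) 1).
- by under eq_bigr do rewrite cdfU_pr; rewrite prodr_const card_ord.
- by move=> i; exact: ind_measurable.
- by move=> i y; exact: ind01.
Qed.

Lemma top2_law u v : pr P [set w | Amax w <= u /\ Smax w - Amax w <= v] = top2 n u v.
Proof.
have [mA mS] := (Amax_measurable, Smax_measurable).
have mAS : measurable_fun setT (fun w => Smax w - Amax w) by exact: measurable_funB.
pose m := Num.min u v.
have mu : m <= u by rewrite /m ge_min lexx.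
have mv : m <= v by rewrite /m ge_min lexx orbT.
(* Either every [Uv j] is at most [m], or exactly one index [i] exceeds [m]. *)
pose f (i j : 'I_n) y := if j == i then ind (Uy y <= u) - ind (Uy y <= m) else ind (Uy y <= m).
have fij i j w : f i j (Yv r G j w) = if j == i then ind (Uv j w <= u) - ind (Uv j w <= m) else ind (Uv j w <= m) by [].
have f01 i j y : 0 <= f i j y <= 1.
  rewrite /f; case: eqP => _; last exact: ind01.
  rewrite /ind; case: (leP (Uy y) m) => H; first by rewrite (le_trans H mu) subrr lexx ler01.
  by case: ifP; rewrite subr0 ?lexx ?ler01.
have mf i j : measurable_fun setT (f i j).
  rewrite /f; case: (j == i); last exact: ind_measurable.
  by apply: measurable_funB; exact: ind_measurable.
have mY i := Yv_measurable HG i.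
have iprod i : intg P (fun w => \prod_(j < n) f i j (Yv r G j w)).
  apply: (@intg_bounded _ _ _ _ _ 1).
    by apply: measurable_prod => j _; exact: measurableT_comp.
  move=> w; rewrite normr_prod; apply: prodr_ile1 => j _.
  by have /andP[f0 f1] := f01 i j (Yv r G j w); rewrite normr_ge0 ger0_norm.
have iprod0 : intg P (fun w => \prod_(j < n) ind (Uy (Yv r G j w) <= m)).
  apply: (@intg_bounded _ _ _ _ _ 1).
    by apply: measurable_prod => j _; apply: (measurableT_comp (ind_measurable m mUy)).
  move=> w; rewrite normr_prod; apply: prodr_ile1 => j _.
  by have /andP[f0 f1] := ind01 (Uy (Yv r G j w) <= m); rewrite normr_ge0 ger0_norm.
pose b w := (Amax w <= u) && (Smax w - Amax w <= v).
rewrite (@pr_ind _ b); last 2 first.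
- by apply: measurableI; exact: measurable_le_cst.
- by move=> w; apply/(rwP andP).
transitivity (\int[P]_w (\prod_(j < n) ind (Uy (Yv r G j w) <= m) +
   \sum_(i < n) \prod_(j < n) f i j (Yv r G j w))).
  apply: eq_Rint => w; rewrite /b.
  have [all_le|/existsP[i iw]] := boolP [forall i, Uv i w <= m].
    move/forallP in all_le.
    have -> : Amax w <= u by apply/Amax_le => i; exact: le_trans mu.
    have -> : Smax w - Amax w <= v by apply/second_le => i j _; left; exact: le_trans mv.
    rewrite /= [X in _ = X + _]big1 => [|j _]; last by rewrite -/(Uv j w) all_le.
    rewrite big1 ?addr0// => i _; rewrite (bigD1 i)//= fij eqxx all_le (le_trans (all_le i) mu).
    by rewrite subrr mul0r.
  have iw' : (Uv i w <= m) = false by apply/negbTE.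
  rewrite [X in _ = X + _](bigD1 i)//= -/(Uv i w) iw' mul0r add0r.
  (* With two indices above [m], every product contains a vanishing factor; on the left, the first
     condition fails if m = u and the second if m = v. *)
  have [two|] := boolP [exists j, (j != i) && ~~ (Uv j w <= m)].
    have /existsP[j /andP[ji jm]] := two.
    rewrite big1 => [|k _]; last first.
      have [ki|ki] := eqVneq k i.
        by rewrite (bigD1 j)//= fij ki (negbTE ji) (negbTE jm) mul0r.
      by rewrite (bigD1 i)//= fij eq_sym (negbTE ki) iw' mul0r.
    rewrite -[RHS]/(ind false); congr ind; apply/negP => /andP[Au Bv].
    have [uv|uv] := leP u v.
      have mE : m = u by rewrite /m; apply/min_idPl.
      by move/Amax_le/(_ i): Au; rewrite -mE iw'.
    have mE : m = v by rewrite /m; apply/min_idPr; exact: ltW.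
    move/second_le/(_ j i ji): Bv; rewrite -mE iw' => -[|//].
    by rewrite (negbTE jm).
  rewrite negb_exists => /forallP one.
  have others j : j != i -> Uv j w <= m by move=> ji; have := one j; rewrite ji/= negbK.
  rewrite (bigD1 i)//= [X in _ = _ + X]big1 ?addr0 => [|k ki]; last first.
    by rewrite (bigD1 i)//= fij eq_sym (negbTE ki) iw' mul0r.
  rewrite (bigD1 i)//= fij eqxx iw' /ind subr0 big1 ?mulr1 => [|j ji]; last first.
    by rewrite fij (negbTE ji) others.
  have [iu|iu] := boolP (Uv i w <= u).
    have -> : Amax w <= u.
      apply/Amax_le => j; have [->//|ji] := eqVneq j i; exact: le_trans (others j ji) mu.
    have -> // : Smax w - Amax w <= v.
    apply/second_le => j k jk; have [ji|ji] := eqVneq j i.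
      by right; apply: le_trans mv; apply: others; rewrite -ji eq_sym.
    by left; apply: le_trans mv; exact: others.
  by case: (boolP (Amax w <= u)) => // /Amax_le/(_ i); rewrite (negbTE iu).
rewrite RintD//; last by apply: intg_sum => i _; exact: iprod.
rewrite Rint_sum => [|i _]; last exact: iprod.
rewrite (@Yv_independent _ _ _ _ _ _ _ HG n3 r4 r2 (fun _ y => ind (Uy y <= m)) 1); last 2 first.
- by move=> i; exact: ind_measurable.
- by move=> i y; exact: ind01.
under eq_bigr do rewrite cdfU_pr.
rewrite prodr_const card_ord /top2 -/m; congr (_ + _).
transitivity (\sum_(i < n) ((cdfU n u - cdfU n m) * cdfU n m ^+ n.-1)).
  apply: eq_bigr => i _.
  rewrite (@Yv_independent _ _ _ _ _ _ _ HG n3 r4 r2 (f i) 1)//.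
  have ii u' j : intg P (fun w => ind (Uv j w <= u')).
    apply: (@intg_bounded _ _ _ _ _ 1).
      by apply: (measurableT_comp (ind_measurable u' mUy)).
    by move=> w; have /andP[? ?] := ind01 (Uv j w <= u'); rewrite ger0_norm.
  rewrite (bigD1 i)//=; congr (_ * _).
    under eq_Rint do rewrite fij eqxx.
    by rewrite RintB// !cdfU_pr.
  rewrite (eq_bigr (fun=> cdfU n m)) => [|j ji]; last first.
    by under eq_Rint do rewrite fij (negbTE ji); rewrite cdfU_pr.
  by rewrite prodr_const; congr (_ ^+ _); rewrite cardC1 card_ord.
by rewrite sumr_const card_ord mulr_natl.
Qed.

Lemma strip_bounds_fixed :
  strip_bounds (fun s => pr P [set w | Smax w <= s]) (fun u => cdfU n u ^+ n) (top2 n).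
Proof.
have mAS : measurable_fun setT (fun w => Smax w - Amax w).
  by apply: measurable_funB; [exact: Smax_measurable|exact: Amax_measurable].
have := @strip_bounds_pr _ _ _ P _ _ Amax_measurable mAS.
have -> : (fun s => pr P [set w | Amax w + (Smax w - Amax w) <= s]) = (fun s => pr P [set w | Smax w <= s]).
  by apply/funext => s; congr (pr P _); apply/seteqP; split => w /=; rewrite addrC subrK.
have -> : (fun u => pr P [set w | Amax w <= u]) = (fun u => cdfU n u ^+ n).
  by apply/funext => u; exact: Amax_law.
suff -> : (fun u v => pr P [set w | Amax w <= u /\ Smax w - Amax w <= v]) = top2 n by [].
by apply/funext => u; apply/funext => v; exact: top2_law.
Qed.

End fixed_size.

(** * Negligibility of the residuals *)

Lemma measurable_forall_le {d : measure_display} {T : measurableType d} {R : realType} (n : nat)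
  (F : 'I_n -> 'I_n -> T -> R) (s : R) :
  (forall i j : 'I_n, (i < j)%N -> measurable_fun setT (F i j)) ->
  measurable [set w | forall i j : 'I_n, (i < j)%N -> F i j w <= s].
Proof.
move=> mF.
pose M w := \big[Num.max/s]_(q : 'I_n * 'I_n | (q.1 < q.2)%N) F q.1 q.2 w.
have -> : [set w | forall i j : 'I_n, (i < j)%N -> F i j w <= s] = [set w | M w <= s].
  apply/seteqP; split => w /= H; last first.
    move=> i j ij; apply: le_trans H.
    exact: (@le_bigmax_cond _ _ _ _ (i, j) (fun q : 'I_n * 'I_n => (q.1 < q.2)%N) (fun q => F q.1 q.2 w)).
  by apply: bigmax_le => [|q q12]; [exact: lexx|exact: H].
by apply: measurable_le_cst; apply: measurable_bigmax => // q; exact: mF.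
Qed.

Lemma pr_union_le {d : measure_display} {T : measurableType d} {R : realType}
  (P : probability T R) (I : eqType) (D : I -> set T) (b : R) (l : seq I) :
  (forall q, measurable (D q)) -> (forall q, pr P (D q) <= b) ->
  measurable [set w | exists2 q, q \in l & D q w] /\
  pr P [set w | exists2 q, q \in l & D q w] <= (size l)%:R * b.
Proof.
move=> mD Db; elim: l => [|q l [mI pI]].
  rewrite (_ : [set w | _] = set0); last by apply/seteqP; split => w //= -[].
  by rewrite /pr measure0 mul0r.
rewrite (_ : [set w | _] = D q `|` [set w | exists2 q, q \in l & D q w]); last first.
  apply/seteqP; split => w /=.
    by case=> q'; rewrite inE => /predU1P[->|q'l] Dw; [left|right; exists q'].
  case=> [Dw|[q' q'l Dw]]; first by exists q; rewrite ?mem_head.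
  by exists q' => //; rewrite inE q'l orbT.
split; first exact: measurableU.
apply: le_trans (prU_le P (mD q) mI) _.
by rewrite /= -natr1 mulrDl mul1r addrC lerD.
Qed.

Lemma pr_pair_union {d : measure_display} {T : measurableType d} {R : realType}
  (P : probability T R) (n : nat) (B : 'I_n -> 'I_n -> set T) (b : R) : 0 <= b ->
  (forall i j : 'I_n, (i < j)%N -> measurable (B i j)) ->
  (forall i j : 'I_n, (i < j)%N -> pr P (B i j) <= b) ->
  measurable [set w | exists i j : 'I_n, (i < j)%N /\ B i j w] /\
  pr P [set w | exists i j : 'I_n, (i < j)%N /\ B i j w] <= n%:R ^+ 2 * b.
Proof.
move=> b0 mB Bb.
pose D (q : 'I_n * 'I_n) w := (q.1 < q.2)%N /\ B q.1 q.2 w.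
have DE q : D q = B q.1 q.2 /\ (q.1 < q.2)%N \/ D q = set0.
  have [q12|q12] := boolP (q.1 < q.2)%N; [left; split => //|right].
    by apply/seteqP; split => w // -[].
  by apply/seteqP; split => w // -[] /(negP q12).
have mD q : measurable (D q) by case: (DE q) => [[-> /mB]|->].
have pD q : pr P (D q) <= b by case: (DE q) => [[-> /Bb]|->] //; rewrite /pr measure0.
have [] := pr_union_le (enum {: 'I_n * 'I_n}) mD pD.
rewrite -cardE card_prod card_ord natrM -expr2.
suff -> : [set w | exists2 q, q \in enum {: 'I_n * 'I_n} & D q w] =
  [set w | exists i j : 'I_n, (i < j)%N /\ B i j w] by [].
apply/seteqP; split => w /=; first by move=> [[i j] _ [? ?]]; exists i, j.
by move=> [i [j [? ?]]]; exists (i, j); rewrite ?mem_enum.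
Qed.

Section crossing.
Context {d : measure_display} {T : measurableType d} {R : realType}.
Variable P : probability T R.
Variables (n : nat) (r : R) (G : 'I_n -> 'I_n -> T -> R).
Hypothesis HG : centered_gaussian_field P r G.
Hypothesis n3 : (3 <= n)%N.
Hypothesis r4 : (4^-1 : R) <= r.
Hypothesis r2 : r <= (2^-1 : R).
Local Notation c := (c_seq n : R).
Local Notation dn := (d_seq n : R).
Hypothesis c0 : 0 < c.
Local Notation U := (Uv r G).
Local Notation mu := (@lebesgue_measure R).

(** The weight exp(2 U) on U <= K. Truncation makes it bounded, as [YR_independent] requires, and
    keeps its mean of order 1 / n. *)
Definition tilt (K y : R) : R := ind (c * (y - dn) <= K) * expR (2 * (c * (y - dn))).

Lemma tilt_ge0 K y : 0 <= tilt K y.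
Proof. by rewrite mulr_ge0 ?expR_ge0//; case/andP: (@ind01 R (c * (y - dn) <= K)). Qed.

Lemma tilt_le K y : tilt K y <= expR (2 * K).
Proof.
rewrite /tilt /ind; case: ifP => h; last by rewrite mul0r expR_ge0.
by rewrite mul1r ler_expR ler_pM2l.
Qed.

Lemma measurable_tilt K : measurable_fun [set: R] (tilt K).
Proof.
have mU : measurable_fun [set: R] (fun y : R => c * (y - dn)).
  by apply: measurable_funM => //; exact: measurable_funB.
apply: measurable_funM; first exact: ind_measurable.
by apply: measurableT_comp => //; exact: measurable_funM.
Qed.

Definition tilt_bound (K : R) : R :=
  expR (2 * K) * (normal_pdf 0 1 (dn + K / c) / (2 * c - (dn + K / c))).

Lemma tilt_int i K : dn + K / c < 2 * c -> \int[P]_w tilt K (Yv r G i w) <= tilt_bound K.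
Proof.
move=> tc; set t := dn + K / c in tc *.
have c0' := c0.
have one0 : (1 : R) != 0 by exact: oner_neq0.
have mYN : measurable_fun setT (fun w => - Yv r G i w).
  by apply: measurableT_comp => //; exact: (Yv_measurable HG).
(* Weighting the law of [- Yv i] by the exponential shifts its mean to [- 2 c], below the threshold [- t], where the upper tail estimate applies. *)
have itp : intg mu (normal_pdf 0 (1 : R)).
  exact: integrable_normal_pdf.
have mN : measurable_fun [set: R] (fun z : R => tilt K (- z)).
  by apply: measurableT_comp; [exact: measurable_tilt|exact: oppr_measurable].
have E := @ge0_integral_density _ _ _ P _ _ mYN (fun y => normal_pdf_ge0 0 1 y) itp
  (fun A mA => YvN_law HG n3 r4 r2 i mA) _ mN (fun y => tilt_ge0 K (- y)).
have {}E : (\int[P]_w (tilt K (Yv r G i w))%:E = \int[mu]_z (tilt K (- z) * normal_pdf 0 1 z)%:E)%E.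
  by rewrite -E; apply: eq_integral => w _; rewrite opprK.
pose A := expR (- (2 * (c * dn))) * expR ((- (2 * c)) ^+ 2 * 1 ^+ 2 / 2).
have A0 : 0 <= A by rewrite mulr_ge0// expR_ge0.
have tiltE z : - t <= z -> tilt K (- z) * normal_pdf 0 1 z = A * normal_pdf (- (2 * c)) 1 z.
  move=> tz; rewrite /tilt /ind ifT; last first.
    have : - z - dn <= K / c by rewrite /t in tz; lra.
    by rewrite ler_pdivlMr// mulrC.
  have := normal_pdf_tilt 0 one0 (- (2 * c)) z.
  rewrite subr0 add0r expr1n !mulr1 /A => H.
  rewrite expr1n mulr1 -[RHS]mulrA -H [RHS]mulrA -expRD mul1r; congr (expR _ * _); ring.
have E2 : (\int[mu]_z (tilt K (- z) * normal_pdf 0 1 z)%:E =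
    A%:E * \int[mu]_(z in `[(- t)%R, +oo[) (normal_pdf (- (2 * c)) 1 z)%:E)%E.
  rewrite -ge0_integralZl//; last 2 first.
  - by apply/measurable_EFinP/measurable_funTS; exact: measurable_normal_pdf.
  - by move=> x _; rewrite lee_fin normal_pdf_ge0.
  rewrite [RHS]integral_mkcond; apply: eq_integral => z _; rewrite patchE.
  have [tz|tz] := leP (- t) z; first by rewrite mem_set ?tiltE//= in_itv/= tz.
  rewrite memNset; last by rewrite /= in_itv/= andbT => /(lt_le_trans tz); rewrite ltxx.
  rewrite /tilt /ind ifN ?mul0r// -ltNge.
  have : K / c < - z - dn by rewrite /t in tz; lra.
  by rewrite ltr_pdivrMr// mulrC.
have it : intg P (fun w => tilt K (Yv r G i w)).
  apply: (@intg_bounded _ _ _ _ _ (expR (2 * K))).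
    by apply: (measurableT_comp (measurable_tilt K)); exact: (Yv_measurable HG).
  by move=> w; rewrite ger0_norm ?tilt_ge0 ?tilt_le.
rewrite -lee_fin -(Rint_EFin it).
rewrite E E2.
apply: (@le_trans _ _ (A%:E * (normal_pdf (- (2 * c)) 1 (- t) / (- t - - (2 * c)))%:E)%E).
  by rewrite lee_wpmul2l ?lee_fin// pdf_mills_ub// ltrN2.
rewrite -EFinM lee_fin mulrA -tiltE// /tilt opprK /ind ifT; last first.
  by rewrite /t addrAC subrr add0r mulrC divfK// gt_eqF.
have -> : c * (t - dn) = K by rewrite /t addrAC subrr add0r mulrC divfK// gt_eqF.
rewrite mul1r /tilt_bound -/t.
have -> : normal_pdf 0 1 (- t) = normal_pdf 0 1 t by rewrite !normal_pdf_expR// !subr0 sqrrN.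
by rewrite opprK [- t + _]addrC -mulrA.
Qed.

Definition resid i j w : R := Num.sqrt 2 * c * Rv r G i j w.

(** Normalised so that it is close to [U i + U j]; the event of the theorem at [x] becomes that all
    heights are at most sqrt 2 x. *)
Definition height i j w : R := c * (Num.sqrt 2 * G i j w - 2 * dn).

Local Notation rho := (2 * (c * dn) * (1 - Num.sqrt 2 * slope n r)).

Lemma height_decomposition (i j : 'I_n) w : (i < j)%N ->
  height i j w = Num.sqrt 2 * slope n r * (U i w + U j w) - rho + resid i j w.
Proof.
move=> ij; rewrite /height /resid /Uv (G_decomposition r G w ij); ring.
Qed.

(* Both configurations force [resid] to be at least a quarter of the distance of [U i + U j] from [s]. *)
Definition crossing K s e (i j : 'I_n) : set T :=
  [set w | U i w <= K /\ U j w <= K /\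
     ((U i w + U j w <= s - e /\ s < height i j w) \/
      (s + e < U i w + U j w /\ height i j w <= s))].

(** Let a = |U_i + U_j - s|. Then a >= e, and the residual with one of its signs is at least a / 4.
    So the total exponent is at least (m / 4 - 2) (a - e), nonnegative for m >= 8; adding both signs
    of the residual covers the two cases. *)
Lemma crossing_exp K s e m (i j : 'I_n) w : (i < j)%N -> 0 < e -> 8 <= m ->
  2^-1 <= Num.sqrt 2 * slope n r <= 1 ->
  (1 - Num.sqrt 2 * slope n r) * `|s| + `|rho| <= e / 4 ->
  crossing K s e i j w ->
  1 <= expR (- ((m / 4 - 2) * e + 2 * s)) *
    ((expR (m * resid i j w) + expR (- m * resid i j w)) *
     (tilt K (Yv r G i w) * tilt K (Yv r G j w))).
Proof.
move=> ij e0 m8 /andP[p2 p1] small [iK [jK H]].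
have -> : tilt K (Yv r G i w) = expR (2 * U i w) by rewrite /tilt -/(Uv r G i w) iK mul1r.
have -> : tilt K (Yv r G j w) = expR (2 * U j w) by rewrite /tilt -/(Uv r G j w) jK mul1r.
rewrite height_decomposition// in H.
move: (Num.sqrt 2 * slope n r) (resid i j w) p1 p2 small H => p z p1 p2.
move: (2 * (c * dn) * (1 - p)) => q small H.
have s1 : - e / 4 <= (1 - p) * s + q <= e / 4.
  have := ler_norm q; have := ler_normr.
  have : `|(1 - p) * s + q| <= e / 4.
    by apply: le_trans small; rewrite (le_trans (ler_normD _ _))// normrM (ger0_norm (_ : 0 <= 1 - p)) ?subr_ge0.
  by rewrite ler_norml mulNr.
move/andP: s1 => [s1 s2].
set x := U i w + U j w in H.
have key y : 4 * y >= `|x - s| -> `|x - s| >= e ->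
   1 <= expR (- ((m / 4 - 2) * e + 2 * s)) * (expR (m * y) * (expR (2 * U i w) * expR (2 * U j w))).
  move=> y1 y2; rewrite -!expRD -[leLHS]expR0 ler_expR.
  have -> : 2 * U i w + 2 * U j w = 2 * x by rewrite /x; ring.
  have : x - s >= - `|x - s| by rewrite lerNl -normrN ler_norm.
  move: (`|x - s|) y1 y2 => a y1 y2 xa.
  have : 0 <= (m - 8) * (a - e) by apply: mulr_ge0; lra.
  have : 0 <= m * (4 * y - a) by apply: mulr_ge0; lra.
  nra.
have e1 := expR_ge0 (m * z); have e2 := expR_ge0 (- m * z).
(* Because p >= 1 / 2, the residual has to cover half the distance, less a deterministic drift of at
   most e / 4, itself at most a quarter of the distance. *)
have [z1|z1] : 4 * z >= `|x - s| /\ `|x - s| >= e \/ 4 * - z >= `|x - s| /\ `|x - s| >= e.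
  case: H => -[h1 h2]; [left|right].
    rewrite ler0_norm; last lra.
    split; last lra.
    have : 0 <= (p - 2^-1) * (s - x) by apply: mulr_ge0; lra.
    lra.
  rewrite ger0_norm; last lra.
  split; last lra.
  have : 0 <= (p - 2^-1) * (x - s) by apply: mulr_ge0; lra.
  lra.
- apply: le_trans (key z z1.1 z1.2) _.
  by rewrite ler_wpM2l ?expR_ge0// ler_wpM2r ?lerDl// mulr_ge0 ?expR_ge0.
- apply: le_trans (key (- z) z1.1 z1.2) _.
  by rewrite ler_wpM2l ?expR_ge0// ler_wpM2r ?mulrN ?mulNr ?lerDr// mulr_ge0 ?expR_ge0.
Qed.

Lemma resid_measurable i j : measurable_fun setT (resid i j).
Proof. by apply: measurable_funM => //; exact: (Rv_measurable HG). Qed.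

Lemma height_measurable (i j : 'I_n) : (i < j)%N -> measurable_fun setT (height i j).
Proof.
move=> ij; have := @height_decomposition i j => /(_ _ ij) E.
rewrite (_ : height i j = fun w => Num.sqrt 2 * slope n r * (U i w + U j w) - rho + resid i j w); last first.
  by apply/funext => w; exact: E.
have mU := Uv_measurable HG.
apply: measurable_funD; last exact: resid_measurable.
apply: measurable_funB => //; apply: measurable_funM => //.
exact: measurable_funD.
Qed.

Lemma crossing_measurable K s e (i j : 'I_n) : (i < j)%N -> measurable (crossing K s e i j).
Proof.
move=> ij; have mU := Uv_measurable HG.
have mH := height_measurable ij.
have mS : measurable_fun setT (fun w => U i w + U j w) by exact: measurable_funD.
have ml (f : T -> R) u : measurable_fun setT f -> measurable [set w | f w <= u] by exact: measurable_le_cst.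
have mg (f : T -> R) u : measurable_fun setT f -> measurable [set w | u < f w].
  move=> mf; rewrite (_ : [set w | u < f w] = ~` [set w | f w <= u]); first exact/measurableC/ml.
  by apply/seteqP; split => w /=; rewrite ltNge => /negP.
apply: measurableI; first exact: ml.
apply: measurableI; first exact: ml.
by apply: measurableU; apply: measurableI; [exact: ml|exact: mg|exact: mg|exact: ml].
Qed.

Definition crossing_bound K s e m : R :=
  expR (- ((m / 4 - 2) * e + 2 * s)) *
  (2 * expR (m ^+ 2 * (c ^+ 2 * (1 - 2 * slope n r ^+ 2))) * tilt_bound K ^+ 2).

(** [crossing_exp] is integrated. The residual is independent of (Y_i, Y_j), so its exponential
    moment factors out and each tilt contributes [tilt_bound]; the factor 2 comes from the two
    signs. *)
Lemma pr_crossing K s e m (i j : 'I_n) : (i < j)%N -> 0 < e -> 8 <= m ->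
  2^-1 <= Num.sqrt 2 * slope n r <= 1 ->
  (1 - Num.sqrt 2 * slope n r) * `|s| + `|rho| <= e / 4 ->
  dn + K / c < 2 * c ->
  pr P (crossing K s e i j) <= crossing_bound K s e m.
Proof.
move=> ij e0 m8 p12 small tc.
pose l := m * (Num.sqrt 2 * c).
pose W w := tilt K (Yv r G i w) * tilt K (Yv r G j w).
have fb y : 0 <= tilt K y <= expR (2 * K) by rewrite tilt_ge0 tilt_le.
have mf := measurable_tilt K.
have mW : measurable_fun setT W.
  by apply: measurable_funM; apply: (measurableT_comp mf); exact: (Yv_measurable HG).
have W0 w : 0 <= W w by rewrite mulr_ge0 ?tilt_ge0.
have WK w : `|W w| <= expR (2 * K) * expR (2 * K).
  by rewrite ger0_norm// ler_pM ?tilt_ge0 ?tilt_le.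
have [i1 E1] := YR_independent HG n3 r4 r2 l ij mf fb.
have [i2 E2] := YR_independent HG n3 r4 r2 (- l) ij mf fb.
have j1 := intgMb i1 mW WK; have j2 := intgMb i2 mW WK.
set C := expR (- ((m / 4 - 2) * e + 2 * s)).
have C0 : 0 <= C by exact: expR_ge0.
have mB := crossing_measurable K s e ij.
rewrite -pr_indic//.
apply: (@le_trans _ _ (\int[P]_w (C * (expR (l * Rv r G i j w) * W w + expR (- l * Rv r G i j w) * W w)))).
  apply: le_Rint.
  - apply: (@intg_bounded _ _ _ _ _ 1); first exact: measurable_indic.
    by move=> w; rewrite indicE; case: (_ \in _); rewrite ?normr1 ?normr0.
  - by apply: intgZ; apply: intgD.
  - move=> w; rewrite indicE -mulrDl.
    have [cw|ncw] := pselect (crossing K s e i j w); last first.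
      by rewrite memNset// mulr_ge0// mulr_ge0// addr_ge0 ?expR_ge0.
    rewrite mem_set//=; have := crossing_exp ij e0 m8 p12 small cw.
    by rewrite /resid /l !mulNr !mulrA.
rewrite RintZ; last exact: intgD.
have El : l ^+ 2 * (1 - 2 * slope n r ^+ 2) / 2 = m ^+ 2 * (c ^+ 2 * (1 - 2 * slope n r ^+ 2)).
  by rewrite /l !exprMn sqr_sqrtr//; field.
rewrite RintD// E1 E2 sqrrN El -mulrDl -mulr2n -[_ *+ 2]mulr_natl /crossing_bound -/C ler_wpM2l//.
rewrite ler_wpM2l ?mulr_ge0 ?expR_ge0// expr2 ler_pM ?tilt_int//.
- by apply: Rintegral_ge0 => w _; exact: tilt_ge0.
- by apply: Rintegral_ge0 => w _; exact: tilt_ge0.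
Qed.

Definition sandwich_error K s e m : R :=
  (1 - cdfU n K ^+ n) + n%:R ^+ 2 * crossing_bound K s e m.

(** Unless some [U i] exceeds [K] or some pair crosses, moving the level by [e] makes the events for
    heights and for sums [U i + U j] comparable in both directions; [sandwich_error] bounds the
    exceptional probability. *)
Lemma max_sandwich K x e m (s := Num.sqrt 2 * x) : 0 < e -> 8 <= m ->
  2^-1 <= Num.sqrt 2 * slope n r <= 1 ->
  (1 - Num.sqrt 2 * slope n r) * `|s| + `|rho| <= e / 4 ->
  dn + K / c < 2 * c ->
  pr P [set w | forall i j : 'I_n, (i < j)%N -> U i w + U j w <= s - e] - sandwich_error K s e m <=
  pr P [set w | c * (field_max G w - Num.sqrt 2 * dn) <= x] <=
  pr P [set w | forall i j : 'I_n, (i < j)%N -> U i w + U j w <= s + e] + sandwich_error K s e m.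
Proof.
move=> e0 m8 p12 small tc.
have mU := Uv_measurable HG.
have -> : [set w | c * (field_max G w - Num.sqrt 2 * dn) <= x] =
    [set w | forall i j : 'I_n, (i < j)%N -> height i j w <= s].
  have s2 : Num.sqrt 2 * Num.sqrt 2 = 2 :> R by rewrite -expr2 sqr_sqrtr.
  have s20 : 0 < Num.sqrt 2 :> R by rewrite sqrtr_gt0.
  have hE i j w : (height i j w <= s) = (G i j w <= Num.sqrt 2 * dn + x / c).
    rewrite /height /s -{2}s2 -mulrA -mulrBr mulrCA ler_pM2l//.
    by rewrite -lerBlDl ler_pdivlMr// mulrC.
  have fE w : (c * (field_max G w - Num.sqrt 2 * dn) <= x) =
      (field_max G w <= Num.sqrt 2 * dn + x / c).
    by rewrite -lerBlDl ler_pdivlMr// mulrC.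
  apply/seteqP; split => w /=; rewrite fE => H.
    move=> i j ij; rewrite hE.
    by have [/(_ H) + _] := @field_max_le _ _ _ G w (Num.sqrt 2 * dn + x / c) (ltnW n3); exact.
  by apply/field_max_le => [|i j ij]; [exact: ltnW|rewrite -hE; exact: H].
set L := [set w | forall i j : 'I_n, (i < j)%N -> height i j w <= s].
have mL : measurable L by apply: measurable_forall_le => i j; exact: height_measurable.
have mS y : measurable [set w | forall i j : 'I_n, (i < j)%N -> U i w + U j w <= y].
  by apply: measurable_forall_le => i j ij; exact: measurable_funD.
have b0 : 0 <= crossing_bound K s e m.
  by apply: mulr_ge0; [exact: expR_ge0|apply: mulr_ge0; [rewrite mulr_ge0 ?expR_ge0|exact: sqr_ge0]].
have [mB pB] := pr_pair_union b0 (fun i j => @crossing_measurable K s e i j)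
  (fun i j ij => @pr_crossing K s e m i j ij e0 m8 p12 small tc).
set B := [set w | exists i j : 'I_n, (i < j)%N /\ crossing K s e i j w] in mB pB.
have mA : measurable [set w | Amax r G n3 w <= K].
  by apply: measurable_le_cst; exact: (Amax_measurable HG).
pose N := ~` [set w | Amax r G n3 w <= K] `|` B.
have mN : measurable N by apply: measurableU => //; exact: measurableC.
have pN : pr P N <= sandwich_error K s e m.
  apply: le_trans (prU_le P (measurableC mA) mB) _.
  by rewrite prC// (Amax_law HG n3 r4 r2 c0) lerD2l.
have sub A A' : measurable A -> measurable A' -> A `<=` A' `|` N ->
    pr P A <= pr P A' + sandwich_error K s e m.
  move=> mA1 mA2 AA; apply: (@le_trans _ _ (pr P (A' `|` N))).
    by apply: pr_le => //; exact: measurableU.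
  by apply: le_trans (prU_le P mA2 mN) _; rewrite lerD2l.
have good w : ~ N w -> (forall i, U i w <= K) /\ (forall i j : 'I_n, (i < j)%N -> ~ crossing K s e i j w).
  move=> /not_orP[/contrapT/Amax_le H1 H2]; split => // i j ij H3.
  by apply: H2; exists i, j.
apply/andP; split.
  rewrite lerBlDr; apply: sub => // w /= Sw.
  have [Nw|/good[UK nc]] := pselect (N w); [by right|left] => i j ij.
  rewrite leNgt; apply/negP => sH; apply: (nc i j ij).
  by do 2!split => //; left; split => //; exact: Sw.
apply: sub => // w /= Lw.
have [Nw|/good[UK nc]] := pselect (N w); [by right|left] => i j ij.
rewrite leNgt; apply/negP => sU; apply: (nc i j ij).
by do 2!split => //; right; split => //; exact: Lw.
Qed.

End crossing.

(** * Convergence *)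

Section poisson_points.
Context {d : measure_display} {T : measurableType d} {R : realType}.
Variable P : probability T R.
Variables zeta1 zeta2 : T -> R.
Hypotheses (z1 : std_exponential P zeta1) (z2 : std_exponential P zeta2).
Hypothesis z12 : indep2 P zeta1 zeta2.
Local Notation eta1 := (fun w => - ln (zeta1 w)).
Local Notation eta2 := (fun w => - ln (zeta1 w + zeta2 w)).

Lemma measurable_eta : measurable_fun setT eta1 /\ measurable_fun setT eta2.
Proof.
have [[m1 _] [m2 _]] := (z1, z2).
split; apply: measurableT_comp => //; first exact: (measurableT_comp (@measurable_ln R)).
by apply: (measurableT_comp (@measurable_ln R)); exact: measurable_funD.
Qed.

Lemma oppln_le (x u : R) : 0 < x -> (- ln x <= u) = (expR (- u) <= x).
Proof. by move=> x0; rewrite lerNl -[RHS]ler_ln ?posrE ?expR_gt0// expRK. Qed.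

Lemma pr_eta1 u : pr P [set w | eta1 w <= u] = expR (- expR (- u)).
Proof.
have [me1 _] := measurable_eta; have [m1 _] := z1.
rewrite -(exponential_tail z1 (expR_ge0 (- u))).
apply: (eq_pr_null z1 z2).
- exact: measurable_le_cst.
- rewrite (_ : [set w | _] = [set w | - zeta1 w <= - expR (- u)]).
    by apply: measurable_le_cst; exact: measurableT_comp.
  by apply/seteqP; split => w /=; rewrite lerN2.
- by move=> w w1 w2 /=; rewrite oppln_le.
Qed.

Lemma pr_eta u v : pr P [set w | eta1 w <= u /\ eta2 w <= v] = top2_lim u v.
Proof.
have [me1 me2] := measurable_eta; have [m1 _] := z1; have [m2 _] := z2.
(* If u < v the condition on eta2 follows from the one on eta1, as eta2 <= eta1 off the null set.
   Otherwise the event is that of [exponential_sum] with thresholds exp(- u) and exp(- v). *)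
have [vu|uv] := leP v u; last first.
  have -> : top2_lim u v = expR (- expR (- u)).
    by rewrite /top2_lim min_l ?(ltW uv)// addrK mulr1.
  rewrite -pr_eta1; apply: (eq_pr_null z1 z2).
  - by apply: measurableI; exact: measurable_le_cst.
  - exact: measurable_le_cst.
  - move=> w w1 w2 /=; split=> [[]//|h]; split => //.
    rewrite oppln_le ?addr_gt0//; move: h; rewrite oppln_le// => h.
    have : expR (- v) <= expR (- u) by rewrite ler_expR lerN2 ltW.
    lra.
rewrite /top2_lim min_r// -(exponential_sum z1 z2 z12); last 2 first.
- exact: expR_gt0.
- by rewrite ler_expR lerN2.
have mge (f : T -> R) a : measurable_fun setT f -> measurable [set w | a <= f w].
  move=> mf; rewrite (_ : [set w | _] = [set w | - f w <= - a]).
    by apply: measurable_le_cst; exact: measurableT_comp.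
  by apply/seteqP; split => w /=; rewrite lerN2.
apply: (eq_pr_null z1 z2).
- by apply: measurableI; exact: measurable_le_cst.
- by apply: measurableI; apply: mge => //; exact: measurable_funD.
- by move=> w w1 w2 /=; rewrite !oppln_le ?addr_gt0.
Qed.

Lemma strip_bounds_eta :
  strip_bounds (fun s => pr P [set w | eta1 w + eta2 w <= s])
    (fun u => expR (- expR (- u))) top2_lim.
Proof.
have [me1 me2] := measurable_eta.
have := strip_bounds_pr P me1 me2.
have -> : (fun u => pr P [set w | eta1 w <= u]) = (fun u => expR (- expR (- u))).
  by apply/funext => u; exact: pr_eta1.
suff -> : (fun u v => pr P [set w | eta1 w <= u /\ eta2 w <= v]) = top2_lim by [].
by apply/funext => u; apply/funext => v; exact: pr_eta.
Qed.

End poisson_points.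

Lemma cvg_gumbel_ninfty {R : realType} :
  expR (- expR (- u)) @[u --> -oo] --> (0 : R).
Proof.
apply/cvgrPdist_le => e e0; near=> u.
rewrite sub0r normrN ger0_norm ?expR_ge0//.
have ue : u <= ln e by near: u; exists (ln e); split; [exact: num_real|move=> y /ltW].
rewrite -[leRHS]lnK ?posrE// ler_expR; apply: le_trans ue.
by rewrite lerNl; apply: le_trans (expR_ge1Dx _); rewrite lerDr.
Unshelve. all: by end_near.
Qed.

Lemma cvg_gumbel_pinfty {R : realType} :
  expR (- expR (- u)) @[u --> +oo] --> (1 : R).
Proof.
rewrite -expR0 -[in X in _ --> X]oppr0.
apply: continuous_cvg; first exact: continuous_expR.
by apply: cvgN; exact: cvgr_expR.
Qed.

Lemma cvg_lnn_div {R : realType} : (fun n => ln n%:R / n%:R : R) @ \oo --> (0 : R).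
Proof.
apply/cvgrPdist_le => e e0; near=> n.
have n0 : (0 < n)%N by near: n; exists 1%N.
have n0' : 0 < n%:R :> R by rewrite ltr0n.
have q0 : 0 < Num.sqrt n%:R :> R by rewrite sqrtr_gt0.
rewrite sub0r normrN ger0_norm; last by rewrite divr_ge0// ln_ge0// ler1n.
have nE : n%:R = Num.sqrt n%:R * Num.sqrt n%:R :> R by rewrite -expr2 sqr_sqrtr// ltW.
have H : 2 / e <= Num.sqrt n%:R.
  rewrite -[leLHS]ger0_norm ?divr_ge0 ?(ltW e0)// -sqrtr_sqr ler_wsqrtr//.
  by near: n; exact: nbhs_infty_ger.
rewrite ler_pdivrMr// {1}nE lnM ?posrE//.
have := ln_sublinear q0; move: H; rewrite ler_pdivrMr// => H l1.
have : 2 * Num.sqrt n%:R <= e * n%:R.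
  by rewrite {2}nE mulrA ler_wpM2r ?(ltW q0)// mulrC.
lra.
Unshelve. all: by end_near.
Qed.

(** * Uniform control along the sequence of fields *)

Section field_sequence.
Context {R : realType}.
Variables (r : nat -> R) (d : nat -> measure_display) (T : forall n, measurableType (d n)).
Variables (P : forall n, probability (T n) R) (G : forall n, 'I_n -> 'I_n -> T n -> R).
Hypothesis r02 : forall n, (2 <= n)%N -> 0 <= r n <= 2^-1.
Hypothesis HG : forall n, (2 <= n)%N -> centered_gaussian_field (P n) (r n) (@G n).
Hypothesis r_lim : (fun n => (1 - 2 * r n) * ln (n%:R : R)) @ \oo --> (0 : R).
Local Notation c n := (c_seq n : R).
Local Notation dd n := (d_seq n : R).
Local Notation resvar n := (1 - 2 * slope n (r n) ^+ 2).

(** As log n tends to infinity, the hypothesis forces r_n to 1 / 2; the threshold 1 / 4 is a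
    convenient value below that. *)
Lemma near_regime : \forall n \near \oo,
  [/\ (3 <= n)%N, 4^-1 <= r n, r n <= 2^-1 & 1 <= c n].
Proof.
near=> n.
have n3 : (3 <= n)%N by near: n; exists 3%N.
have /andP[r0 r2] := r02 (ltnW n3).
have c1 : 1 <= c n by near: n; have /(@cvgryPge R) := @cvg_c_seq R; exact.
split => //.
have l1 : 1 <= ln n%:R :> R by near: n; have /(@cvgryPge R) := @cvgr_ninfty_ln R; exact.
have : (1 - 2 * r n) * ln n%:R < 2^-1 by near: n; apply: (cvgr_lt 0 r_lim); lra.
have : (1 - 2 * r n) * 1 <= (1 - 2 * r n) * ln n%:R by rewrite ler_wpM2l//; lra.
lra.
Unshelve. all: by end_near.
Qed.

(** Here the rate 1 - 2 r = o(1 / log n) enters in full: c^2 = 2 log n multiplies a variance of at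
    most (1 - 2 r) + 4 / n. *)
Lemma cvg_resvar : (fun n => c n ^+ 2 * resvar n) @ \oo --> (0 : R).
Proof.
apply: (squeeze_cvgr (f := fun=> 0)
  (h := fun n => 2 * ((1 - 2 * r n) * ln n%:R) + 8 * (ln n%:R / n%:R))).
- apply: filterS near_regime => n [n3 r4 r2 c1].
  have [s0 v0 v1] := slope_bounds (HG (ltnW n3)) n3 r4 r2.
  rewrite mulr_ge0 ?sqr_ge0//= c_seq_sqr; last exact: leq_trans n3.
  have l0 : 0 <= ln n%:R :> R by rewrite ln_ge0// ler1n (leq_trans _ n3).
  have : 2 * ln n%:R * resvar n <= 2 * ln n%:R * (1 - 2 * r n + 4 / n%:R).
    by rewrite ler_wpM2l// mulr_ge0.
  by move=> /le_trans; apply; rewrite le_eqVlt; apply/orP; left; apply/eqP; ring.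
- exact: cvg_cst.
- rewrite -[X in _ --> X]addr0 -{1}(mulr0 2) -[X in _ --> _ + X](mulr0 8).
  by apply: cvgD; apply: cvgM; [exact: cvg_cst|exact: r_lim|exact: cvg_cst|exact: cvg_lnn_div].
Qed.

(** With p = sqrt 2 slope, the residual variance is (1 - p) (1 + p) >= 1 - p. As |d| <= 2 c
    eventually, both error terms together are at most (|s| + 4) times c^2 Var R, which vanishes. *)
Lemma near_slope (s e : R) : 0 < e -> \forall n \near \oo,
  2^-1 <= Num.sqrt 2 * slope n (r n) <= 1 /\
  (1 - Num.sqrt 2 * slope n (r n)) * `|s| +
    `|2 * (c n * dd n) * (1 - Num.sqrt 2 * slope n (r n))| <= e / 4.
Proof.
move=> e0; near=> n.
have [n3 r4 r2 c1] : [/\ (3 <= n)%N, 4^-1 <= r n, r n <= 2^-1 & 1 <= c n].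
  by near: n; exact: near_regime.
have [s0 v0 _] := slope_bounds (HG (ltnW n3)) n3 r4 r2.
set p := Num.sqrt 2 * slope n (r n).
have p0 : 0 <= p by rewrite mulr_ge0 ?sqrtr_ge0.
have vE : resvar n = (1 - p) * (1 + p).
  have E : (1 - p) * (1 + p) = 1 - Num.sqrt 2 ^+ 2 * slope n (r n) ^+ 2.
    by rewrite /p; ring.
  by rewrite E sqr_sqrtr.
have q2 : c n ^+ 2 * resvar n <= 2^-1.
  by apply: ltW; near: n; apply: (cvgr_lt 0 cvg_resvar); lra.
have qs : c n ^+ 2 * resvar n * (`|s| + 4) <= e / 4.
  have s4 : 0 < `|s| + 4 by have := normr_ge0 s; lra.
  rewrite -ler_pdivlMr//; apply: ltW; near: n; apply: (cvgr_lt 0 cvg_resvar).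
  by rewrite divr_gt0// divr_gt0.
set q := c n ^+ 2 * resvar n in q2 qs.
have vq : resvar n <= q.
  by rewrite /q ler_peMl// -[1](expr1n _ 2) lerXn2r ?nnegrE// (le_trans _ c1).
have p1 : p <= 1 by rewrite leNgt; apply/negP => p1; move: v0; rewrite vE; nra.
have pv : 1 - p <= resvar n by rewrite vE; nra.
split; first by apply/andP; split => //; lra.
have dc : `|dd n| <= 2 * c n.
  have : `|1 - (dd n + 0 / c n) / c n| < 1.
    by near: n; apply: cvgr_dist_lt => //; exact: cvg_level_ratio.
  rewrite mul0r addr0 ltr_norml => /andP[h1 h2].
  have c0 : 0 < c n by lra.
  have h3 : dd n / c n < 2 by lra.
  have h4 : 0 < dd n / c n by lra.
  rewrite ltr_pdivrMr// in h3.
  have : 0 < dd n by rewrite -(divfK (lt0r_neq0 c0) (dd n)) mulr_gt0.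
  by move=> /ltW/ger0_norm ->; exact: ltW.
have : `|2 * (c n * dd n) * (1 - p)| <= 4 * q.
  rewrite !normrM (ger0_norm (_ : 0 <= 1 - p)) ?subr_ge0// (ger0_norm (ler0n _ 2)).
  rewrite (ger0_norm (_ : 0 <= c n)) ?(le_trans _ c1)//.
  have -> : 4 * q = 2 * (c n * (2 * c n)) * resvar n by rewrite /q; ring.
  rewrite ler_pM ?mulr_ge0// ?(le_trans _ c1)// ?subr_ge0//.
  by rewrite ler_wpM2l// ler_wpM2l// (le_trans _ c1).
have : (1 - p) * `|s| <= q * `|s| by rewrite ler_wpM2r// (le_trans pv).
lra.
Unshelve. all: by end_near.
Qed.

Lemma near_sandwich_error (s e a : R) : 0 < e -> 0 < a -> exists K m, [/\ 8 <= m,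
  \forall n \near \oo, dd n + K / c n < 2 * c n &
  \forall n \near \oo, sandwich_error n (r n) K s e m <= a].
Proof.
move=> e0 a0.
have [K HK] : exists K, 1 - a / 4 < expR (- expR (- K)).
  have : \forall u \near +oo, 1 - a / 4 < expR (- expR (- u)).
    by apply: (cvgr_gt 1 cvg_gumbel_pinfty); lra.
  by move=> [M [_ HM]]; exists (M + 1); apply: HM; rewrite ltrDl.
(* Limit of the crossing cost without its decay in [m]: [expR 1] bounds the exponential moment of
   the residual and [2 * expR K] bounds n times [tilt_bound], both for large n. *)
pose C := 2 * expR 1 * (2 * expR K) ^+ 2 * expR (- (2 * s)).
have C0 : 0 < C by rewrite !mulr_gt0 ?exprn_gt0 ?mulr_gt0 ?expR_gt0.
pose y := `|ln (C / (a / 2))|.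
have Cy : expR (- y) * C <= a / 2.
  have X0 : 0 < C / (a / 2) by rewrite divr_gt0// divr_gt0.
  apply: (@le_trans _ _ (expR (- ln (C / (a / 2))) * C)).
    by rewrite ler_wpM2r ?(ltW C0)// ler_expR lerN2 ler_norm.
  rewrite expRN lnK ?posrE// le_eqVlt; apply/orP; left; apply/eqP.
  by field; rewrite !gt_eqF.
(* Chosen so that (m / 4 - 2) e = y, the decay that brings [C] below a / 2. [K] is fixed before [m],
   and both before n. *)
pose m := 8 + 4 * y / e.
have y0 : 0 <= y by exact: normr_ge0.
have m1 : 0 < m ^+ 2 + 1 by have := sqr_ge0 m; lra.
exists K, m; split.
- by rewrite lerDl divr_ge0 ?mulr_ge0// ltW.
- near=> n.
  have c0 : 0 < c n by near: n; exact: c_seq_gt0.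
  rewrite -ltr_pdivrMr//; near: n; apply: (cvgr_lt 1 (@cvg_level_ratio R K)); lra.
- near=> n.
  have [n3 r4 r2 c1] : [/\ (3 <= n)%N, 4^-1 <= r n, r n <= 2^-1 & 1 <= c n].
    by near: n; exact: near_regime.
  have h1 : 1 - a / 2 < cdfU n K ^+ n.
    by near: n; apply: (cvgr_gt _ (@cvg_cdfU_exp R K)); lra.
  have h2 : `|expR K - n%:R * tilt_bound n K| < expR K.
    by near: n; apply: cvgr_dist_lt => //; [exact: cvg_level_tilt|exact: expR_gt0].
  have h3 : m ^+ 2 * (c n ^+ 2 * resvar n) <= 1.
    apply: (@le_trans _ _ ((m ^+ 2 + 1) * (c n ^+ 2 * resvar n))).
      have [_ v0 _] := slope_bounds (HG (ltnW n3)) n3 r4 r2.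
      by rewrite ler_wpM2r ?lerDl// mulr_ge0 ?sqr_ge0.
    rewrite mulrC -ler_pdivlMr//; apply: ltW; near: n; apply: (cvgr_lt 0 cvg_resvar).
    exact: divr_gt0.
  suff : n%:R ^+ 2 * crossing_bound n (r n) K s e m <= a / 2 by rewrite /sandwich_error; lra.
  apply: (le_trans _ Cy); rewrite /crossing_bound.
  have -> : - ((m / 4 - 2) * e + 2 * s) = - y - 2 * s.
    by rewrite /m; field; rewrite gt_eqF.
  have e1 : expR (m ^+ 2 * (c n ^+ 2 * resvar n)) <= expR 1 by rewrite ler_expR.
  have nt : (n%:R * tilt_bound n K) ^+ 2 <= (2 * expR K) ^+ 2.
    rewrite -[leLHS]real_normK ?num_real// lerXn2r ?nnegrE ?mulr_ge0 ?expR_ge0//.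
    by move: h2; rewrite ltr_norml => /andP[? ?]; rewrite ler_norml; apply/andP; split; lra.
  rewrite expRD; move: e1 nt; rewrite /C.
  move: (expR (m ^+ 2 * _)) (expR_ge0 (m ^+ 2 * (c n ^+ 2 * resvar n))) (tilt_bound n K) => V V0 t e1 nt.
  have -> : n%:R ^+ 2 * (expR (- y) * expR (- (2 * s)) * (2 * V * t ^+ 2)) =
      expR (- y) * (2 * V * (n%:R * t) ^+ 2 * expR (- (2 * s))) by ring.
  by rewrite ler_wpM2l ?expR_ge0// ler_wpM2r ?expR_ge0// ler_pM ?sqr_ge0 ?mulr_ge0// ler_wpM2l.
Unshelve. all: by end_near.
Qed.

(** The distribution function of [Smax], phrased without the proof of [3 <= n] that [Smax] takes, so
    that it makes sense along the whole sequence. *)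
Definition pair_cdf n s := pr (P n)
  [set w | forall i j : 'I_n, (i < j)%N -> Uv (r n) (@G n) i w + Uv (r n) (@G n) j w <= s].

Lemma near_strip_bounds : \forall n \near \oo,
  strip_bounds (pair_cdf n) (fun u => cdfU n u ^+ n) (top2 n).
Proof.
apply: filterS near_regime => n [n3 r4 r2 c1].
have := strip_bounds_fixed (HG (ltnW n3)) n3 r4 r2 (lt_le_trans ltr01 c1).
suff -> : (fun s => pr (P n) [set w | Smax (r n) (@G n) n3 w <= s]) = pair_cdf n by [].
apply/funext => s; congr (pr (P n) _); apply/seteqP; split => w /Smax_le; exact.
Qed.

Lemma near_max_sandwich (x e a : R) : 0 < e -> 0 < a -> \forall n \near \oo,
  pair_cdf n (Num.sqrt 2 * x - e) - a <=
  pr (P n) [set w | c n * (field_max (@G n) w - Num.sqrt 2 * dd n) <= x] <=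
  pair_cdf n (Num.sqrt 2 * x + e) + a.
Proof.
move=> e0 a0.
have [K [m [m8 tK eK]]] := near_sandwich_error (Num.sqrt 2 * x) e0 a0.
near=> n.
have [n3 r4 r2 c1] : [/\ (3 <= n)%N, 4^-1 <= r n, r n <= 2^-1 & 1 <= c n].
  by near: n; exact: near_regime.
have [p12 small] : 2^-1 <= Num.sqrt 2 * slope n (r n) <= 1 /\
    (1 - Num.sqrt 2 * slope n (r n)) * `|Num.sqrt 2 * x| +
      `|2 * (c n * dd n) * (1 - Num.sqrt 2 * slope n (r n))| <= e / 4.
  by near: n; exact: near_slope.
have tc : dd n + K / c n < 2 * c n by near: n.
have ea : sandwich_error n (r n) K (Num.sqrt 2 * x) e m <= a by near: n.
have := max_sandwich (HG (ltnW n3)) n3 r4 r2 (lt_le_trans ltr01 c1) e0 m8 p12 small tc.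
rewrite -/(pair_cdf n _) -/(pair_cdf n _) => /andP[h1 h2].
by apply/andP; split; [apply: le_trans h1; rewrite lerD2l lerN2|apply: le_trans h2 _; rewrite lerD2l].
Unshelve. all: by end_near.
Qed.

End field_sequence.
Unset Implicit Arguments.

Theorem theorem2p3 (R : realType) (r : nat -> R)
  (d : nat -> measure_display) (T : forall n, measurableType (d n))
  (P : forall n, probability (T n) R)
  (G : forall n, 'I_n -> 'I_n -> T n -> R)
  (d0 : measure_display) (T0 : measurableType d0) (P0 : probability T0 R)
  (zeta1 zeta2 : T0 -> R) :
  (forall n, (2 <= n)%N -> 0 <= r n <= 2^-1) ->
  (forall n, (2 <= n)%N -> centered_gaussian_field (P n) (r n) (G n)) ->
  (fun n => (1 - 2 * r n) * ln (n%:R : R)) @ \oo --> (0 : R) ->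
  std_exponential P0 zeta1 -> std_exponential P0 zeta2 ->
  indep2 P0 zeta1 zeta2 ->
  let eta1 := fun w => - ln (zeta1 w) in
  let eta2 := fun w => - ln (zeta1 w + zeta2 w) in
  let F := fun x : R =>
    fine (P0 [set w | (eta1 w + eta2 w) / Num.sqrt 2 <= x]) in
  forall x : R, {for x, continuous F} ->
    (fun n => fine (P n [set w |
        c_seq n * (field_max (G n) w - Num.sqrt 2 * d_seq n) <= x]))
      @ \oo --> F x.
Proof.
move=> r02 HG r_lim z1 z2 z12 eta1 eta2 F x cF.
pose S0 s := pr P0 [set w | eta1 w + eta2 w <= s].
have s0 : 0 < Num.sqrt 2 :> R by rewrite sqrtr_gt0.
have FE y : F y = S0 (Num.sqrt 2 * y).
  rewrite /F /S0 /pr; congr (fine (P0 _)).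
  by apply/seteqP; split => w /=; rewrite ler_pdivrMr// mulrC.
have limit := strip_portmanteau (near_strip_bounds r02 HG r_lim) (strip_bounds_eta z1 z2 z12)
  (fun u v => @cvg_top2 R u v) (fun u => @cvg_cdfU_exp R u) cvg_gumbel_ninfty cvg_gumbel_pinfty.
apply/cvgrPdist_lt => a a0.
(* The only point where continuity of [F] at [x] is used. *)
have [e e0 He] : exists2 e : R, 0 < e & forall y, `|x - y| < e -> `|F x - F y| < a / 2.
  have /cvgrPdist_lt/(_ (a / 2)) := cF; rewrite divr_gt0// => /(_ isT)/nbhs_ballP[e /= e0 He].
  by exists e.
(* The level moves by [h] twice, once for the residuals and once for the strips; in the variable of
   [F] this amounts to e / 2, within the radius of continuity. *)
pose h := Num.sqrt 2 * (e / 4).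
have h0 : 0 < h by rewrite mulr_gt0// divr_gt0.
have a8 : 0 < a / 8 by rewrite divr_gt0.
near=> n.
have /andP[m1 m2] : pair_cdf r P G n (Num.sqrt 2 * x - h) - a / 8 <=
  pr (P n) [set w | c_seq n * (field_max (G n) w - Num.sqrt 2 * d_seq n) <= x] <=
  pair_cdf r P G n (Num.sqrt 2 * x + h) + a / 8.
  by near: n; exact: near_max_sandwich.
have /andP[l1 _] : S0 (Num.sqrt 2 * x - h - h) - a / 8 <= pair_cdf r P G n (Num.sqrt 2 * x - h) <=
    S0 (Num.sqrt 2 * x - h + h) + a / 8.
  by near: n; exact: limit.
have /andP[_ l2] : S0 (Num.sqrt 2 * x + h - h) - a / 8 <= pair_cdf r P G n (Num.sqrt 2 * x + h) <=
    S0 (Num.sqrt 2 * x + h + h) + a / 8.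
  by near: n; exact: limit.
have E1 : Num.sqrt 2 * x - h - h = Num.sqrt 2 * (x - e / 2) by rewrite /h; field.
have E2 : Num.sqrt 2 * x + h + h = Num.sqrt 2 * (x + e / 2) by rewrite /h; field.
rewrite E1 -FE in l1; rewrite E2 -FE in l2.
have c1 : `|F x - F (x - e / 2)| < a / 2.
  by apply: He; rewrite opprB addrC subrK ger0_norm; lra.
have c2 : `|F x - F (x + e / 2)| < a / 2.
  by apply: He; rewrite opprD addNKr normrN ger0_norm; lra.
move: c1 c2 m1 m2; rewrite -/(pr _ _) !ltr_norml => /andP[? ?] /andP[? ?] ? ?.
apply/andP; split; lra.
Unshelve. all: by end_near.
Qed.
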